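(* Let $\tau\in(0,1]$. The configurations $L^1(\tau)$ (two arcs $\beta_+,\beta_-$ clasped with one arc $\gamma$) and $L^2(\tau)$ (two arcs $\beta_+,\beta_-$ clasped with two arcs $\gamma_+,\gamma_-$) defined in the context are each strongly critical for minimizing length (all weights equal to $1$) when constrained by Gehring thickness.
   Context: GENERALIZED LINKS AND CRITICALITY. A generalized link $L$ is a curve in $\mathbb{R}^3$ with finitely many, mutually disjoint components $L_i$ (arcs or closed curves), where each endpoint $x\in\partial L$ is constrained to stay on a given affine subspace $M_x\subset\mathbb{R}^3$, together with finitely many obstacles $\{p\in\mathbb{R}^3: g_j(p)<0\}$, with $g_j$ of class $C^1$ having $0$ as a regular value; $L$ must lie in $\{\min_j g_j\ge 0\}$. The Gehring thickness $\mathrm{GThi}(L)$ is the minimal distance between points on different components of $L$. The Gehring ropelength problem is to minimize length subject to $\mathrm{GThi}\ge1$. A Gehring strut is an unordered pair $\{x,y\}$ of points on different components with $|x-y|=\mathrm{GThi}(L)$; a wall strut is a pair $(j,x)$ with $x\in L$, $g_j(x)=0$. A compatible vectorfield is a continuous $\xi:L\to\mathbb{R}^3$ (continuous along the parametrized curve) with $\xi_x$ tangent to $M_x$ at each endpoint $x$. The first variation of length of a component with unit tangent $T$ (of bounded variation) is $\delta_\xi\mathrm{Len}=[T\cdot\xi]_{\mathrm{start}}^{\mathrm{end}}-\int\xi\cdot dT$ (no boundary term for closed components), and $\delta_\xi\mathrm{Len}(L)=\sum_i \delta_\xi\mathrm{Len}(L_i)$. Put $\delta^+_\xi\mathrm{GThi}(L)=\min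 (\xi_x-\xi_y)\cdot\frac{x-y}{|x-y|}$ over all Gehring struts $\{x,y\}$, and $\delta^+_\xi O(L)=\min \xi_x\cdot\nabla g_j(x)$ over all wall struts $(j,x)$; these are the one-sided first variations of $\mathrm{GThi}$ and of $O(L)=\min_j\min_{x\in L}g_j(x)$. $L$ is strongly critical for minimizing length when constrained by $\mathrm{GThi}$ if there is $\varepsilon>0$ such that for all compatible $\xi$ with $\delta_\xi\mathrm{Len}(L)=-1$ we have $\min(\delta^+_\xi\mathrm{GThi}(L),\delta^+_\xi O(L))\le-\varepsilon$. WEIGHTED CLASP ARCS. Use coordinates $(x_1,x_2,z)$ on $\mathbb{R}^3$ with $z$ vertical. Given $\tau_1,\tau_2\in(0,1]$, for $\{i,j\}=\{1,2\}$ and $u\in[0,\tau_i]$ set $v=\tau_j(1-u/\tau_i)$ and $$X_i(u)=\sqrt{\frac{u^2(1-v^2)}{1-u^2v^2}},\qquad Z_i(u)=\int_0^u\frac{s}{\sqrt{1-s^2}}\,X_i'(s)\,ds,$$ extended to $[-\tau_i,\tau_i]$ by $X_i(-u)=-X_i(u)$, $Z_i(-u)=Z_i(u)$. Let $h=Z_2(\tau_2)+\sqrt{1-\tau_2^2}=Z_1(\tau_1)+\sqrt{1-\tau_1^2}$. When $\tau_1=\tau_2=\tau$ these give the ordinary $\tau$-clasp curves, and then $X_1=X_2$, $Z_1=Z_2$. BOUNDING PLANES. In both configurations below, with the indicated $\tau_1,\tau_2$, put $n_\pm=(\pm\sqrt{1-\tau_1^2},0,-\tau_1)$ and $m_\pm=(0,\pm\sqrt{1-\tau_2^2},\tau_2)$.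 Each $\beta$ curve is extended at its two ends by straight segments in directions $n_\pm$ (sign according to the sign of $x_1$ at that end) until they meet the planes $n_\pm\cdot p=c_1$; each $\gamma$ curve is extended at its two ends by straight segments in directions $m_\pm$ (sign according to the sign of $x_2$) until they meet the planes $m_\pm\cdot p=c_2$. Each endpoint is constrained to the plane just named on which it lies. The obstacles are given by $g=c_1-n_\pm\cdot p$ and $g=c_2-m_\pm\cdot p$, so $L$ must stay in $\{n_\pm\cdot p\le c_1,\ m_\pm\cdot p\le c_2\}$; $c_1,c_2$ are fixed and large enough that the whole configuration lies in this region. CONFIGURATION $L^1(\tau)$. Take $\tau_1=\tau/2$, $\tau_2=\tau$. The curves $\beta_\pm$ lie in the parallel planes $x_2=\pm\tfrac12$ and have curved parts $\{(X_1(u),\pm\tfrac12,h-Z_1(u)):|u|\le\tau/2\}$. The curve $\gamma$ lies in the plane $x_1=0$; its central part is the union of $\{(0,X_2(u)+\tfrac12,Z_2(u)):0\le u\le\tau\}$, $\{(0,X_2(u)-\tfrac12,Z_2(u)):-\tau\le u\le0\}$ and the unit-length segment $\{(0,s,0):|s|\le\tfrac12\}$. Straight ends are attached: each of $\beta_+,\beta_-$ is extended at its two ends by straight segments in directions $n_\pm$ (sign according to the sign of $x_1$ at that end) until they meet the planes $n_\pm\cdot p=c_1$, and $\gamma$ is extended at its two ends by straight segments in directions $m_\pm$ (sign according to the sign of $x_2$ at that end) until they meet the planes $m_\pm\cdot p=c_2$. CONFIGURATION $L^2(\tau)$. Take $\tau_1=\tau_2=\tau$ and write $X=X_1=X_2$,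 $Z=Z_1=Z_2$. The curves $\beta_\pm$ lie in the planes $x_2=\pm\tfrac12$; their central parts are the unions of $\{(X(u)+\tfrac12,\pm\tfrac12,h-Z(u)):0\le u\le\tau\}$, $\{(X(u)-\tfrac12,\pm\tfrac12,h-Z(u)):-\tau\le u\le0\}$ and $\{(s,\pm\tfrac12,h):|s|\le\tfrac12\}$. The curves $\gamma_\pm$ lie in the planes $x_1=\pm\tfrac12$; their central parts are the unions of $\{(\pm\tfrac12,X(u)+\tfrac12,Z(u)):0\le u\le\tau\}$, $\{(\pm\tfrac12,X(u)-\tfrac12,Z(u)):-\tau\le u\le0\}$ and $\{(\pm\tfrac12,s,0):|s|\le\tfrac12\}$. Straight ends are attached: each of $\beta_+,\beta_-$ is extended at its two ends by straight segments in directions $n_\pm$ (sign according to the sign of $x_1$ at that end) until they meet the planes $n_\pm\cdot p=c_1$, and each of $\gamma_+,\gamma_-$ is extended at its two ends by straight segments in directions $m_\pm$ (sign according to the sign of $x_2$ at that end) until they meet the planes $m_\pm\cdot p=c_2$. *)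

(* Defs.v *)
From HB Require Import structures.
From mathcomp Require Import all_boot all_order all_algebra.
From mathcomp Require Import all_classical all_reals all_analysis.

Set Implicit Arguments.
Unset Strict Implicit.
Unset Printing Implicit Defensive.

Import Order.TTheory GRing.Theory Num.Theory.
Import numFieldNormedType.Exports.

Local Open Scope classical_set_scope.
Local Open Scope ring_scope.

Section Euclidean.
Variable R : realType.
Implicit Types (p q u v : 'rV[R]_3) (M : set 'rV[R]_3) (g : 'rV[R]_3 -> R).

Definition vec3 (x y z : R) : 'rV[R]_3 := \row_(k < 3) nth 0 [:: x; y; z] k.

Definition dot u v : R := (u *m v^T) 0 0.

(* The library norm `|u| on 'rV[R]_3 is the sup norm, hence these. *)
Definition enorm u : R := Num.sqrt (dot u u).
Definition edist p q : R := enorm (p - q).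
Definition direction p q : 'rV[R]_3 := (enorm (q - p))^-1 *: (q - p).

(* Over the reals, closure under lines characterizes affine subspaces. *)
Definition affine_subspace M : Prop :=
  M !=set0 /\ (forall p q (t : R), M p -> M q -> M (p + t *: (q - p))).

Definition affine_tangent M p v : Prop := M (p + v).

Definition gradient g p : 'rV[R]_3 := \row_(k < 3) 'D_(delta_mx 0 k) g p.

Definition C1 g : Prop :=
  (forall p, differentiable g p) /\ continuous (gradient g).

Definition regular_value g (c : R) : Prop :=
  forall p, g p = c -> gradient g p != 0.

End Euclidean.

Section RiemannStieltjes.
Variable R : realType.
Implicit Types (f g : R -> 'rV[R]_3) (a b : R) (s : seq R).

(* The k-th subinterval of the partition a :: s is
   [nth 0 (a :: s) k, nth 0 s k]. *)
Definition RS_sum f g a s (tag : nat -> R) : R :=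
  \sum_(k < size s) dot (f (tag k)) (g (nth 0 s k) - g (nth 0 (a :: s) k)).

(* The integral of f . dg over [a, b], as a limit over tagged partitions.
   It exists when f is continuous and g has bounded variation, and is
   then insensitive to the value of g at any given interior point. *)
Definition is_RS_integral f g a b (l : R) : Prop :=
  forall e : R, 0 < e -> exists2 d : R, 0 < d &
    forall s (tag : nat -> R), itv_partition a b s ->
      (forall k, (k < size s)%N ->
         nth 0 (a :: s) k <= tag k <= nth 0 s k /\
         nth 0 s k - nth 0 (a :: s) k < d) ->
      `|RS_sum f g a s tag - l| < e.

End RiemannStieltjes.

(* Component i is the image of [lo i, hi i] under curve i, with arbitrary
   parametrization. When i is an arc, anchor i false and anchor i true are the
   affine subspaces constraining its start and end; otherwise they are unused.
   The obstacles are the sets where gobs j < 0. *)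
Record glink (R : realType) := GLink {
  comp : finType;
  is_arc : comp -> bool;
  lo : comp -> R;
  hi : comp -> R;
  curve : comp -> R -> 'rV[R]_3;
  anchor : comp -> bool -> set 'rV[R]_3;
  obst : finType;
  gobs : obst -> 'rV[R]_3 -> R
}.

Section GeneralizedLinks.
Variables (R : realType) (L : glink R).
Implicit Types (i : comp L) (j : obst L) (e : bool) (t : R).
Implicit Type xi : comp L -> R -> 'rV[R]_3.

Definition dom i : set R := `[lo i, hi i].

Definition param_end i e : R := if e then hi i else lo i.

(* One-sided limits of secant directions. They do not depend on the
   parametrization, which may have vanishing or infinite speed. *)
Definition right_tangent i t : 'rV[R]_3 :=
  lim (direction (curve i t) (curve i s) @[s --> t^'+]).
Definition left_tangent i t : 'rV[R]_3 :=
  lim (direction (curve i s) (curve i t) @[s --> t^'-]).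

Definition tangent i t : 'rV[R]_3 :=
  if t < hi i then right_tangent i t else left_tangent i t.

Definition has_BV_unit_tangent i : Prop :=
  [/\ forall t, lo i <= t < hi i ->
        cvg (direction (curve i t) (curve i s) @[s --> t^'+]) /\
        enorm (right_tangent i t) = 1,
      forall t, lo i < t <= hi i ->
        cvg (direction (curve i s) (curve i t) @[s --> t^'-]) /\
        enorm (left_tangent i t) = 1 &
      forall k : 'I_3,
        bounded_variation (lo i) (hi i) (fun t => tangent i t 0 k)].

(* L lies in the region where min_j gobs j >= 0. *)
Definition in_region : Prop :=
  forall i t j, dom i t -> 0 <= gobs j (curve i t).

Definition is_generalized_link : Prop :=
  [/\ forall i, [/\ lo i < hi i,
        {within dom i, continuous (curve i)} & has_BV_unit_tangent i],
      forall i i' s t, i != i' -> dom i s -> dom i' t ->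
        curve i s <> curve i' t,
      forall i, if is_arc i then
          forall e, affine_subspace (anchor i e) /\
                    anchor i e (curve i (param_end i e))
        else curve i (lo i) = curve i (hi i),
      forall j, C1 (gobs j) /\ regular_value (gobs j) 0 &
      in_region].

Definition GThi : \bar R :=
  ereal_inf [set r | exists i i' s t,
    [/\ i != i', dom i s, dom i' t & r = (edist (curve i s) (curve i' t))%:E]].

(* A strut joins the point with parameter s on component i to the point with
   parameter t on component i'; each unordered pair occurs in both orders. *)
Definition gehring_strut i s i' t : Prop :=
  [/\ i != i', dom i s, dom i' t &
      (edist (curve i s) (curve i' t))%:E = GThi].

Definition wall_strut j i t : Prop := dom i t /\ gobs j (curve i t) = 0.

(* A vectorfield along L is a function of the parameter. *)
Definition compatible xi : Prop :=
  (forall i, {within dom i, continuous (xi i)}) /\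
  (forall i, if is_arc i then
       forall e, affine_tangent (anchor i e) (curve i (param_end i e))
                                (xi i (param_end i e))
     else xi i (lo i) = xi i (hi i)).

(* For a closed component xi agrees at both ends, so the boundary terms sum to
   minus the contribution of the jump of the tangent at the base point; the
   value is then the negative of the integral of xi . dT over the circle. *)
Definition is_comp_first_variation xi i (d : R) : Prop :=
  exists2 l : R, is_RS_integral (xi i) (tangent i) (lo i) (hi i) l &
    d = dot (tangent i (hi i)) (xi i (hi i))
        - dot (tangent i (lo i)) (xi i (lo i)) - l.

Definition is_length_variation xi (d : R) : Prop :=
  exists2 dd : comp L -> R,
    forall i, is_comp_first_variation xi i (dd i) & d = \sum_i dd i.

Definition GThi_variation xi : \bar R :=
  ereal_inf [set r | exists i s i' t, gehring_strut i s i' t /\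
    r = (dot (xi i s - xi i' t) (direction (curve i' t) (curve i s)))%:E].

Definition obstacle_variation xi : \bar R :=
  ereal_inf [set r | exists j i t, wall_strut j i t /\
    r = (dot (xi i t) (gradient (gobs j) (curve i t)))%:E].

(* Criticality for minimizing length when constrained by GThi. *)
Definition strongly_critical : Prop :=
  is_generalized_link /\
  exists2 eps : R, 0 < eps & forall xi,
    compatible xi -> is_length_variation xi (-1) ->
    (Order.min (GThi_variation xi) (obstacle_variation xi) <= (- eps)%:E)%E.

End GeneralizedLinks.

Section Clasps.
Variable R : realType.
Implicit Types (ti tj t w u c : R) (e : bool).

Definition sgb e : R := if e then 1 else -1.

(* X_i on [-ti, ti], extended to be odd. *)
Definition claspX ti tj u : R :=
  let v := tj * (1 - `|u| / ti) in
  Num.sg u * Num.sqrt (u ^+ 2 * (1 - v ^+ 2) / (1 - u ^+ 2 * v ^+ 2)).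

(* Z_i on [-ti, ti], extended to be even. The integrand is unbounded at
   s = 1, but Lebesgue integrable up to there. *)
Definition claspZ ti tj u : R :=
  \int[lebesgue_measure]_(s in `[0, `|u|])
    (s / Num.sqrt (1 - s ^+ 2) * derive1 (claspX ti tj) s).

(* The two coordinates of a planar curve, symmetric under reflection: a
   horizontal segment for |t| <= w, the two halves of the clasp curve (moved
   apart by w) for w <= |t| <= w + ti, with t -/+ w the clasp parameter u,
   and straight rays parametrized by arclength beyond. *)
Definition profileX ti tj w t : R :=
  if `|t| <= w then t
  else if `|t| <= w + ti then claspX ti tj (t - Num.sg t * w) + Num.sg t * w
  else Num.sg t * (claspX ti tj ti + w
                   + (`|t| - (w + ti)) * Num.sqrt (1 - ti ^+ 2)).

Definition profileZ ti tj w t : R :=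
  if `|t| <= w then 0
  else if `|t| <= w + ti then claspZ ti tj (t - Num.sg t * w)
  else claspZ ti tj ti + (`|t| - (w + ti)) * ti.

(* This equals claspZ t1 t2 t1 + Num.sqrt (1 - t1 ^+ 2). *)
Definition clasp_height t1 t2 : R :=
  claspZ t2 t1 t2 + Num.sqrt (1 - t2 ^+ 2).

(* beta lies in the plane x2 = y, and gamma in the plane x1 = x. *)
Definition beta t1 t2 w y t : 'rV[R]_3 :=
  vec3 (profileX t1 t2 w t) y (clasp_height t1 t2 - profileZ t1 t2 w t).
Definition gamma t1 t2 w x t : 'rV[R]_3 :=
  vec3 x (profileX t2 t1 w t) (profileZ t2 t1 w t).

(* n_e and m_e; both are unit vectors. *)
Definition beta_normal t1 e : 'rV[R]_3 :=
  vec3 (sgb e * Num.sqrt (1 - t1 ^+ 2)) 0 (- t1).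
Definition gamma_normal t2 e : 'rV[R]_3 :=
  vec3 0 (sgb e * Num.sqrt (1 - t2 ^+ 2)) t2.

Definition plane (n : 'rV[R]_3) c : set 'rV[R]_3 := [set p | dot n p = c].

(* Parameter at which the unit-speed straight end meets its bounding plane; by
   symmetry the other end does so at the opposite parameter. If the curved part
   already crosses the plane then Num.max applies, and the resulting link is
   not in_region. The value does not depend on the last argument 0 of beta
   and gamma. *)
Definition beta_hi t1 t2 w c1 : R :=
  w + t1 + Num.max 0 (c1 - dot (beta_normal t1 true) (beta t1 t2 w 0 (w + t1))).
Definition gamma_hi t1 t2 w c2 : R :=
  w + t2 +
  Num.max 0 (c2 - dot (gamma_normal t2 true) (gamma t1 t2 w 0 (w + t2))).

(* inl e is the wall of n_e, and inr e that of m_e. *)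
Definition clasp_wall t1 t2 c1 c2 (j : bool + bool) (p : 'rV[R]_3) : R :=
  match j with
  | inl e => c1 - dot (beta_normal t1 e) p
  | inr e => c2 - dot (gamma_normal t2 e) p
  end.

(* Components: inl e is beta_e, and inr tt is gamma. *)
Definition L1 (tau c1 c2 : R) : glink R :=
  let t1 := tau / 2 in let t2 := tau in
  let hi i := match i with
              | inl _ => beta_hi t1 t2 0 c1
              | inr _ => gamma_hi t1 t2 (1 / 2) c2
              end in
  {| comp := (bool + unit)%type;
     is_arc := fun=> true;
     lo := fun i => - hi i;
     hi := hi;
     curve := fun i => match i with
                       | inl e => beta t1 t2 0 (sgb e / 2)
                       | inr _ => gamma t1 t2 (1 / 2) 0
                       end;
     anchor := fun i e => match i with
                          | inl _ => plane (beta_normal t1 e) c1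
                          | inr _ => plane (gamma_normal t2 e) c2
                          end;
     obst := (bool + bool)%type;
     gobs := clasp_wall t1 t2 c1 c2 |}.

(* Components: inl e is beta_e, and inr e is gamma_e. *)
Definition L2 (tau c1 c2 : R) : glink R :=
  let hi i := match i with
              | inl _ => beta_hi tau tau (1 / 2) c1
              | inr _ => gamma_hi tau tau (1 / 2) c2
              end in
  {| comp := (bool + bool)%type;
     is_arc := fun=> true;
     lo := fun i => - hi i;
     hi := hi;
     curve := fun i => match i with
                       | inl e => beta tau tau (1 / 2) (sgb e / 2)
                       | inr e => gamma tau tau (1 / 2) (sgb e / 2)
                       end;
     anchor := fun i e => match i with
                          | inl _ => plane (beta_normal tau e) c1
                          | inr _ => plane (gamma_normal tau e) c2
                          end;
     obst := (bool + bool)%type;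
     gobs := clasp_wall tau tau c1 c2 |}.

End Clasps.

(* Main.v *)
From mathcomp Require Import all_boot all_order all_algebra.
From mathcomp Require Import all_classical all_reals all_analysis.
From mathcomp Require Import measurable_realfun ring lra.
Require Import Defs.

(** Both configurations are in equilibrium under a system of compressive
    struts, and strong criticality is the quantitative form of this balance.

    Describe a clasp curve by the sine [u] of its angle with the horizontal.
    The tangent is [co u] times the horizontal plus [u] times the vertical, so
    it turns at the rate [- slope u] horizontally and [1] vertically, where
    [slope u = u / co u].  The point [u] of a [beta] arc is joined to the point
    [v = partner t1 t2 u = t2 (1 - u / t1)] of each [gamma] arc, in every sign
    combination, by a strut of length 1.  Up to signs the strut vector is
    [H (slope u, slope v, 1)], with [H = strutH u v] ([strutH_slope],
    [strut_vector]).  Let the struts carry the force [du / H].  On [beta] the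
    components of this force in the plane of the arc cancel the turning of its
    tangent.  The component [slope v du] normal to that plane presses [beta_+]
    and [beta_-] towards each other, and is taken up by the struts
    [vec3 0 1 0] between equal parameters of the two arcs, which lie exactly
    one unit apart.  The situation on [gamma] is symmetric, except that
    [dv = t2 / t1 du] in absolute value: both sides of [gamma] balance after
    its turning is scaled by [t1 / t2].  For two arcs [gamma_+], [gamma_-] this
    factor is 1.  For a single arc [gamma], which meets the struts from both
    halves of each [beta], it is [1 / 2] for each of the two half systems, and
    their forces normal to its plane are opposite and cancel.

    At an end the tangent is the normal of the constraint plane, up to sign,
    hence orthogonal to a compatible field, and the boundary terms of the first
    variation vanish.  The derivative of length is thus the integral of the
    strut variations against the strut forces.  The total force is finite,
    because [1 / H <= 1 + slope u + slope v] and [slope] has the bounded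
    primitive [- co].  If no strut shrank at a rate of [1 / 100] or more, the
    length could not decrease at unit rate ([clasp_links_critical]).

    For [tau = 1] the force density is unbounded at the outer ends of the clasp
    curves.  The balance is therefore made on Riemann-Stieltjes sums.  All arcs
    are subdivided by the same grid of parameters [u], carried to [gamma] by
    [partner].  On a small cell the tag is chosen by the mean value theorem so
    that [slope] times the length of the cell is exactly the increment of [co]
    on the arc that may be singular there; on the other arc [slope] is
    Lipschitz, and the error is quadratic in the mesh ([strut_tag], [balance_step], [grid_balance]).

    The geometric part shows that the configurations are generalized links of
    thickness 1.  That the strut of parameter [u] has unit length rests on
    [strut_height], an identity between functions of [u] with equal
    derivatives.  No other points of a [beta] and a [gamma] are closer: if
    [S] is the vertical distance to the unit sphere around a fixed point of
    [beta], the clasp height plus [S] increases along [gamma] up to the strut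
    and decreases after it ([clasp_under]), and continuing a curve by its ray
    does not bring it closer ([ray_le]).  The tangents are obtained from
    chords: the chord between two points on the same side of the axis of
    symmetry has a direction between those of the tangents at its ends
    ([profile_chord]), which gives one-sided tangents everywhere, including
    where two pieces of the profile are joined. *)

Set Implicit Arguments.
Unset Strict Implicit.
Unset Printing Implicit Defensive.

Import Order.TTheory GRing.Theory Num.Theory.
Import numFieldNormedType.Exports.

Local Open Scope classical_set_scope.
Local Open Scope ring_scope.

(** * Differentiation rules and an integrability criterion *)

Section Calculus.
Variable R : realType.
Implicit Types (f g F dF : R -> R) (a b x : R).

Lemma is_derive1_mul f g x df dg : is_derive x 1 f df -> is_derive x 1 g dg ->
  is_derive x 1 (fun y => f y * g y) (df * g x + f x * dg).
Proof.
move=> hf hg; apply: is_derive_eq (is_deriveM hf hg) _.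
by rewrite /GRing.scale/= addrC [g x * _]mulrC.
Qed.

Lemma is_derive1_div f g x df dg : g x != 0 ->
  is_derive x 1 f df -> is_derive x 1 g dg ->
  is_derive x 1 (fun y => f y / g y) ((df * g x - f x * dg) / g x ^+ 2).
Proof.
move=> g0 hf hg; apply: is_derive_eq (is_derive1_mul hf (is_deriveV g0 hg)) _.
rewrite /GRing.scale/=; field; exact: g0.
Qed.

Lemma is_derive1_sqrt_comp f x df : 0 < f x -> is_derive x 1 f df ->
  is_derive x 1 (fun y => Num.sqrt (f y)) (df / (2 * Num.sqrt (f x))).
Proof.
move=> f0 hf; have h := is_derive1_sqrt f0.
by apply: is_derive_eq (is_derive1_comp h hf) _; rewrite /GRing.scale/= mulrC.
Qed.

(** The integrals of [f] over the compact subintervals increase to the integral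
    over [a, b], and each is at most an increment of [F], hence at most
    [2 * M].  This is how integrands that are unbounded at the ends are seen to
    be integrable. *)
Lemma integrable_le_derivative f F dF a b (M : R) : a < b ->
  {in `]a, b[, continuous f} -> {in `]a, b[, continuous dF} ->
  {in `]a, b[, forall x, is_derive x 1 F (dF x)} ->
  {in `]a, b[, forall x, 0 <= f x <= dF x} ->
  {in `]a, b[, forall x, `|F x| <= M} ->
  lebesgue_measure.-integrable `[a, b] (EFin \o f).
Proof.
move=> ab cf cdF hF hf bF.
have mf : measurable_fun `]a, b[ f.
  by apply: open_continuous_measurable_fun => // x /set_mem/cf.
have mfE : measurable_fun `]a, b[ (EFin \o f) by exact/measurable_EFinP.
apply/integrableP; split.
  by apply/measurable_EFinP; exact: measurable_fun_itv_cc mf.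
rewrite integral_itv_bndoo; last exact: measurableT_comp.
(* Dividing by at least 3 makes every subinterval nonempty. *)
pose d n : R := (b - a) / n.+3%:R.
pose A (n : nat) : set R := [set` `[a + d n, b - d n]].
have d0 n : 0 < d n by rewrite divr_gt0 ?subr_gt0// ltr0n.
have d2 n : a + d n < b - d n.
  rewrite -subr_gt0 (_ : _ - _ = (b - a) * (1 - 2 / n.+3%:R)); last first.
    by rewrite /d; ring.
  rewrite mulr_gt0 ?subr_gt0// ltr_pdivrMr ?ltr0n// mul1r ltr_nat//.
have dm m n : (m <= n)%N -> d n <= d m.
  by move=> mn; rewrite ler_pM2l ?subr_gt0// lef_pV2 ?posrE ?ltr0n// ler_nat.
have Asub n x : A n x -> x \in `]a, b[.
  rewrite /A/= !in_itv/= => /andP[ax xb]; apply/andP; split.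
    by apply: lt_le_trans ax; rewrite ltrDl.
  by apply: le_lt_trans xb _; rewrite gtrDl oppr_lt0.
have AU : `]a, b[%classic = \bigcup_n A n.
  apply/seteqP; split=> [x/=|x [n _]]; last by move/Asub.
  rewrite in_itv/= => /andP[ax xb].
  pose m := Num.min (x - a) (b - x).
  have m0 : 0 < m by rewrite lt_min !subr_gt0 ax.
  have q0 : 0 <= (b - a) / m by rewrite divr_ge0 ?subr_ge0// ltW.
  exists (Num.bound ((b - a) / m)) => //.
  have := archi_boundP q0; set n := Num.bound _ => hn.
  have : d n <= m.
    rewrite /d ler_pdivrMr ?ltr0n// mulrC -ler_pdivrMr//.
    by apply: le_trans (ltW hn) _; rewrite ler_nat -addn3 leq_addr.
  by rewrite le_min /A/= in_itv/= => /andP[h1 h2]; lra.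
have mA n : measurable (A n) by exact: measurable_itv.
have mfA n : measurable_fun (A n) (fun x => `|(EFin \o f) x|%E).
  apply: measurableT_comp => //; apply: measurable_funS mfE => // x /Asub.
  by [].
rewrite AU.
have ndA : nondecreasing_seq A.
  move=> m n mn; apply/subsetPset => x; rewrite /A/= !in_itv/=.
  by have := dm _ _ mn => h /andP[h1 h2]; lra.
have := @ge0_nondecreasing_set_cvg_integral _ (measurableTypeR R) R A (fun x => `|(EFin \o f) x|%E)
  (@lebesgue_measure R) ndA mA mfA (fun _ _ _ => abse_ge0 _) => h.
rewrite -(cvg_lim _ h)//.
apply: (@le_lt_trans _ _ (2 * M)%:E); last by rewrite ltry.
apply: lime_le; first by apply/cvg_ex; eexists; exact: h.
apply: nearW => n /=.
have cA g : {in `]a, b[, continuous g} -> {within A n, continuous g}.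
  move=> cg; apply: continuous_in_subspaceT => x /set_mem/Asub; exact: cg.
have cs x : x \in `[a + d n, b - d n] -> x \in `]a, b[ by exact: Asub.
have cs' x : x \in `]a + d n, b - d n[ -> x \in `]a, b[.
  move=> h'; apply: cs; exact: subset_itv_oo_cc h'.
apply: (@le_trans _ _ (\int[lebesgue_measure]_(x in A n) (dF x)%:E)%E).
  apply: ge0_le_integral => //.
  - exact: mA.
  - exact: mfA.
  - apply/measurable_EFinP; apply: subspace_continuous_measurable_fun => //.
    exact: cA.
  - move=> x /Asub/hf/andP[h1 h2]; rewrite /= ger0_norm// lee_fin.
rewrite (@continuous_FTC2 _ dF F)//.
- rewrite -EFinB lee_fin (le_trans (ler_norm _))// (le_trans (ler_normB _ _))//.
  have ha : `|F (a + d n)| <= M.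
    by apply/bF/cs; rewrite in_itv/= lexx (ltW (d2 n)).
  have hb : `|F (b - d n)| <= M.
    by apply/bF/cs; rewrite in_itv/= lexx (ltW (d2 n)).
  lra.
- exact: cA.
- have dx x : x \in `[a + d n, b - d n] -> is_derive x 1 F (dF x) by move=> /cs/hF.
  split.
  + by move=> x /cs'/hF[].
  + have hh : {within `[a + d n, b - d n], continuous F}.
      apply: derivable_within_continuous => x /dx[]//.
    by have [_ + _] := (continuous_within_itvP _ (d2 n)).1 hh.
  + have hh : {within `[a + d n, b - d n], continuous F}.
      apply: derivable_within_continuous => x /dx[]//.
    by have [_ _] := (continuous_within_itvP _ (d2 n)).1 hh.
- by move=> x /cs'/hF[_ <-]; rewrite derive1E.
Qed.
End Calculus.

(** * The unit circle *)

Section Circle.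
Variable R : realType.
Implicit Types (s t u v : R).

(** The cosine and the tangent of the angle with sine [u]. *)
Definition co u : R := Num.sqrt (1 - u ^+ 2).
Definition slope u : R := u / co u.

Lemma coE u : Num.sqrt (1 - u ^+ 2) = co u. Proof. by []. Qed.

Lemma co_ge0 u : 0 <= co u. Proof. exact: sqrtr_ge0. Qed.

Lemma coN u : co (- u) = co u. Proof. by rewrite /co sqrrN. Qed.

Lemma co0 : co 0 = 1. Proof. by rewrite /co expr0n subr0 sqrtr1. Qed.

Lemma sqr_co u : `|u| <= 1 -> co u ^+ 2 = 1 - u ^+ 2.
Proof.
move=> u1; rewrite /co sqr_sqrtr// subr_ge0 -real_normK ?num_real//.
by rewrite expr_le1.
Qed.

Lemma co_gt0 u : `|u| < 1 -> 0 < co u.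
Proof.
move=> u1; rewrite /co sqrtr_gt0 subr_gt0 -real_normK ?num_real//.
by rewrite expr_lt1.
Qed.

Lemma co_le1 u : co u <= 1.
Proof. by rewrite /co -[leRHS]sqrtr1 ler_wsqrtr// gerBl sqr_ge0. Qed.

Lemma co_le u v : 0 <= u -> u <= v -> co v <= co u.
Proof.
move=> u0 uv; rewrite ler_wsqrtr// lerD2l lerN2 ler_pXn2r// ?nnegrE//.
exact: le_trans uv.
Qed.

Lemma is_derive_co u : `|u| < 1 -> is_derive u 1 co (- slope u).
Proof.
move=> u1; have c0 := co_gt0 u1.
have f0 : 0 < 1 - u ^+ 2 by move: c0; rewrite /co sqrtr_gt0.
have h : is_derive u 1 (fun x : R => 1 - x ^+ 2) (- (u *+ 2)).
  by apply: is_derive_eq; rewrite /GRing.scale/=; ring.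
apply: is_derive_eq (@is_derive1_sqrt_comp _ (fun x => 1 - x ^+ 2) _ _ f0 h) _.
rewrite /slope -/(co u); field; exact: lt0r_neq0.
Qed.

Lemma continuous_co : continuous co.
Proof.
move=> u; apply: continuous_comp; last exact: sqrt_continuous.
apply: continuousB; first exact: cst_continuous.
exact: exprn_continuous.
Qed.

Lemma continuous_slope u : `|u| < 1 -> {for u, continuous slope}.
Proof.
move=> u1; apply: continuousM; first exact: cvg_id.
by apply: continuousV; [exact: lt0r_neq0 (co_gt0 u1)|exact: continuous_co].
Qed.

End Circle.

(** * Truncation and monotonicity *)

Section Monotonicity.
Variable R : realType.
Implicit Types (f df : R -> R) (a b x : R).

Definition clamp a b x : R := Num.min (Num.max x a) b.

Lemma clamp_itv a b x : a <= b -> a <= clamp a b x <= b.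
Proof. by move=> ab; rewrite /clamp ge_min lexx orbT andbT le_min le_max lexx orbT ab. Qed.

Lemma clamp_id a b x : a <= x <= b -> clamp a b x = x.
Proof. by move=> /andP[ax xb]; rewrite /clamp max_l// min_l. Qed.

Lemma continuous_clamp a b : continuous (clamp a b).
Proof.
move=> x; apply: (@continuous_min _ _ (fun x => Num.max x a) (cst b)); last exact: cvg_cst.
by apply: (@continuous_max _ _ id (cst a)); [exact: cvg_id|exact: cvg_cst].
Qed.

Lemma continuous_comp_clamp f a b : a <= b ->
  {within `[a, b], continuous f} -> continuous (fun x => f (clamp a b x)).
Proof.
move=> ab /subspace_continuousP cf x.
have h : `[a, b]%classic (clamp a b x) by rewrite /= in_itv/= clamp_itv.
apply: cvg_comp (cf _ h) => A /= wA; rewrite nbhs_simpl/=.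
have := @continuous_clamp a b x _ wA; rewrite nbhs_simpl/=.
apply: filterS => y /=; apply.
by rewrite /= in_itv/=; exact: clamp_itv.
Qed.

(** Continuity of [f] relative to its domain becomes plain continuity after
    precomposing with [clamp], which is the identity on the range of [g]. *)
Lemma within_comp (f g : R -> R) a b c d : c <= d ->
  {within `[a, b], continuous g} -> {within `[c, d], continuous f} ->
  (forall x, a <= x <= b -> c <= g x <= d) ->
  {within `[a, b], continuous (fun x => f (g x))}.
Proof.
move=> cd cg cf gm.
apply: (@subspace_eq_continuous _ _ _ ((fun y => f (clamp c d y)) \o g)).
  move=> x; rewrite inE/= in_itv/= => /gm h; by rewrite /= clamp_id.
apply: within_continuous_comp => // y _; exact: continuous_comp_clamp.
Qed.

Lemma MVT_le f df a b : a <= b ->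
  (forall x, a < x < b -> is_derive x 1 f (df x) /\ 0 <= df x) ->
  {within `[a, b], continuous f} -> f a <= f b.
Proof.
rewrite le_eqVlt => /predU1P[->//|ab] h cf.
have [|c] := @MVT R f df a b ab _ cf; first by move=> x; rewrite in_itv/= => /h[].
rewrite in_itv/= => /h[_ d0] e; rewrite -subr_ge0 e mulr_ge0// subr_ge0 ltW//.
Qed.

Lemma MVT_lt f df a b : a < b ->
  (forall x, a < x < b -> is_derive x 1 f (df x) /\ 0 < df x) ->
  {within `[a, b], continuous f} -> f a < f b.
Proof.
move=> ab h cf.
have [|c] := @MVT R f df a b ab _ cf; first by move=> x; rewrite in_itv/= => /h[].
rewrite in_itv/= => /h[_ d0] e; rewrite -subr_gt0 e mulr_gt0// subr_gt0 //.
Qed.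

Lemma MVT_eq f a b : a <= b ->
  (forall x, a < x < b -> is_derive x 1 f 0) ->
  {within `[a, b], continuous f} -> f a = f b.
Proof.
rewrite le_eqVlt => /predU1P[->//|ab] h cf.
have h' x : x \in `]a, b[ -> is_derive x 1 f (cst 0 x) by rewrite in_itv/= => /h.
by have [c _] := MVT ab h' cf; rewrite /= mul0r => /eqP; rewrite subr_eq0 => /eqP.
Qed.

End Monotonicity.

(** * The strut between two clasp curves *)

Section Strut.
Variable R : realType.
Implicit Types (u v : R).

(** The strut between the points of parameters [u] and [v = partner s t u] of
    two clasp curves of types [(s, t)] and [(t, s)] has horizontal extents
    [strutX s t u] and [strutX t s v], and vertical extent [strutH u v]. *)
Definition partner (s t u : R) : R := t * (1 - u / s).
Definition sden u v : R := Num.sqrt (1 - u ^+ 2 * v ^+ 2).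
Definition strutX (s t u : R) : R :=
  u * co (partner s t u) / sden u (partner s t u).
Definition strutH u v : R := co u * co v / sden u v.
Definition dstrutX (s t u : R) : R :=
  let v := partner s t u in
  (co v + t / s * u * v * co u ^+ 2 / co v) / sden u v ^+ 3.

Lemma sdenC u v : sden u v = sden v u.
Proof. by rewrite /sden mulrC. Qed.

Variables (s t : R).
Hypotheses (s0 : 0 < s) (s1 : s <= 1) (t0 : 0 < t) (t1 : t <= 1).

Lemma partnerK u : partner t s (partner s t u) = u.
Proof. by rewrite /partner; field; rewrite !gt_eqF. Qed.

Lemma partner0 : partner s t 0 = t.
Proof. by rewrite /partner mul0r subr0 mulr1. Qed.

Lemma partner_end : partner s t s = 0.
Proof. by rewrite /partner divff ?gt_eqF// subrr mulr0. Qed.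

Lemma partner_le u v : u <= v -> partner s t v <= partner s t u.
Proof. by move=> uv; rewrite /partner ler_pM2l// lerD2l lerN2 ler_pM2r// invr_gt0. Qed.

Lemma partner_lt u v : u < v -> partner s t v < partner s t u.
Proof. by move=> uv; rewrite /partner ltr_pM2l// ltrD2l ltrN2 ltr_pM2r// invr_gt0. Qed.

Lemma partner_itv u : 0 <= u <= s -> 0 <= partner s t u <= t.
Proof. by move=> /andP[/partner_le + /partner_le]; rewrite partner0 partner_end => -> ->. Qed.

Lemma partner_itvoo u : 0 < u < s -> 0 < partner s t u < t.
Proof. by move=> /andP[/partner_lt + /partner_lt]; rewrite partner0 partner_end => -> ->. Qed.

Lemma is_derive_partner u : is_derive u 1 (partner s t) (- (t / s)).
Proof. by apply: is_derive_eq; rewrite /GRing.scale/=; ring. Qed.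

(** As [u * partner s t u = s t (u / s) (1 - u / s)] is at most [1 / 4], the
    common denominator [sden] stays away from zero, even for [s = t = 1]. *)
Lemma sden2_ge u : 0 <= u <= s ->
  15 / 16 <= 1 - u ^+ 2 * partner s t u ^+ 2.
Proof.
move=> us; have /andP[v0 _] := partner_itv us; case/andP: us => u0 us.
suff : u * partner s t u <= 1 / 4.
  move=> h; have : 0 <= u * partner s t u by rewrite mulr_ge0.
  rewrite -exprMn; nra.
rewrite (_ : u * _ = (t * s) * (u / s) * (1 - u / s)); last first.
  by rewrite /partner; field; rewrite gt_eqF.
have x0 : 0 <= u / s by rewrite divr_ge0// ltW.
have x1 : u / s <= 1 by rewrite ler_pdivrMr// mul1r.
have ts : t * s <= 1 by rewrite mulr_ile1// ltW.
have ts0 : 0 <= t * s by rewrite mulr_ge0// ltW.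
have : (u / s) * (1 - u / s) <= 1 / 4 by have := sqr_ge0 (u / s - 1 / 2); nra.
have : 0 <= (u / s) * (1 - u / s) by rewrite mulr_ge0// subr_ge0.
rewrite -mulrA; nra.
Qed.

Lemma sden_gt0 u : 0 <= u <= s -> 0 < sden u (partner s t u).
Proof. by move=> /sden2_ge h; rewrite /sden sqrtr_gt0; lra. Qed.

Lemma sqr_sden u : 0 <= u <= s ->
  sden u (partner s t u) ^+ 2 = 1 - u ^+ 2 * partner s t u ^+ 2.
Proof. by move=> /sden2_ge h; rewrite /sden sqr_sqrtr//; lra. Qed.

Lemma claspX_strutX u : 0 <= u <= s -> claspX s t u = strutX s t u.
Proof.
move=> us; have d0 := sden2_ge us.
case/andP: us => u0 us; rewrite /claspX ger0_norm// -/(partner s t u).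
rewrite /strutX /sden; set v := partner s t u in d0 *.
move: u0; rewrite le_eqVlt => /predU1P[<-|u0]; first by rewrite sgr0 !mul0r.
rewrite gtr0_sg// mul1r -mulrA sqrtrM ?sqr_ge0// sqrtr_sqr gtr0_norm// -mulrA.
rewrite mulrC [in RHS]mulrC; congr (_ * _).
rewrite mulrC sqrtrM ?invr_ge0; last by lra.
by rewrite sqrtrV mulrC//; lra.
Qed.

Lemma abs_lt1 (w : R) : w <= 1 -> forall u, 0 < u < w -> `|u| < 1.
Proof. by move=> w1 u /andP[u0 us]; rewrite gtr0_norm// (lt_le_trans us). Qed.

Lemma abs_le1 (w : R) : w <= 1 -> forall u, 0 <= u <= w -> `|u| <= 1.
Proof. by move=> w1 u /andP[u0 us]; rewrite ger0_norm// (le_trans us). Qed.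

Lemma is_derive_sden u : 0 < u < s ->
  is_derive u 1 (fun u => sden u (partner s t u))
    (- (u * partner s t u ^+ 2 - u ^+ 2 * partner s t u * (t / s))
     / sden u (partner s t u)).
Proof.
move=> us; have us' : 0 <= u <= s by case/andP: us => *; rewrite !ltW.
have d0 := sden_gt0 us'; have dp := is_derive_partner u.
pose f x := 1 - x ^+ 2 * partner s t x ^+ 2.
have f0 : 0 < f u by move: (sden2_ge us'); rewrite /f; lra.
have hf : is_derive u 1 f (- (2 * u * partner s t u ^+ 2 + u ^+ 2 * (2 * partner s t u * - (t / s)))).
  have h1 : is_derive u 1 (fun x : R => x ^+ 2) (2 * u).
    by apply: is_derive_eq; rewrite /GRing.scale/=; ring.
  have h2 : is_derive u 1 (fun x : R => partner s t x ^+ 2) (2 * partner s t u * - (t / s)).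
    by apply: is_derive_eq; rewrite /GRing.scale/=; ring.
  have h3 := is_derive1_mul h1 h2.
  have h4 := is_deriveB (is_derive_cst (1 : R) u 1) h3.
  by rewrite -[X in is_derive _ _ _ X]sub0r.
apply: is_derive_eq (is_derive1_sqrt_comp f0 hf) _.
rewrite -[Num.sqrt (f u)]/(sden u (partner s t u)).
by field; rewrite !gt_eqF.
Qed.

Lemma is_derive_co_partner u : 0 < u < s ->
  is_derive u 1 (fun u => co (partner s t u)) (slope (partner s t u) * (t / s)).
Proof.
move=> us; have vt := partner_itvoo us.
have h := is_derive1_comp (is_derive_co (abs_lt1 t1 vt)) (is_derive_partner u).
by apply: is_derive_eq h _; rewrite /GRing.scale/= mulrNN.
Qed.

Lemma is_derive_strutX u : 0 < u < s -> is_derive u 1 (strutX s t) (dstrutX s t u).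
Proof.
move=> us; have us' : 0 <= u <= s by case/andP: us => *; rewrite !ltW.
have vt := partner_itvoo us; have := is_derive_sden us.
have := is_derive_co_partner us; have := sden_gt0 us'; have := sqr_sden us'.
have := sqr_co (abs_le1 s1 us'); have := sqr_co (ltW (abs_lt1 t1 vt)).
have := co_gt0 (abs_lt1 t1 vt).
move=> b0 eb ea ed d0 hb hd.
have h1 := is_derive1_mul (is_derive_id u 1) hb.
have h2 := @is_derive1_div _ _ (fun u => sden u (partner s t u)) u _ _ (lt0r_neq0 d0) h1 hd.
apply: is_derive_eq h2 _; rewrite /dstrutX /slope; set v := partner s t u in ed eb d0 b0 *.
apply/eqP; rewrite -subr_eq0; apply/eqP; rewrite ea.
(* The numerator is a combination of the relations between [sden], [co] and
   their squares, with the coefficients displayed. *)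
transitivity (((co v + u * (t / s) * v / co v) * (sden u v ^+ 2 - (1 - u ^+ 2 * v ^+ 2))
   - ((t / s) * u ^+ 3 * v / co v) * (co v ^+ 2 - (1 - v ^+ 2))) / sden u v ^+ 3).
  by field; rewrite !gt_eqF.
by rewrite eb ed !subrr !mulr0 subr0 mul0r.
Qed.

Lemma dstrutX_gt0 u : 0 < u < s -> 0 < dstrutX s t u.
Proof.
move=> us; have us' : 0 <= u <= s by case/andP: us => *; rewrite !ltW.
have vt := partner_itvoo us; have b0 := co_gt0 (abs_lt1 t1 vt).
rewrite /dstrutX divr_gt0 ?exprn_gt0 ?sden_gt0//.
move: vt b0; set v := partner s t u; clearbody v => /andP[v0 _] b0.
case/andP: us => u0 _; rewrite ltr_pwDl// divr_ge0 ?co_ge0// mulr_ge0 ?sqr_ge0//.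
by rewrite !mulr_ge0 ?invr_ge0 ?ltW//.
Qed.

(** The derivative is minus that of the sum of the two clasp heights at the
    ends of the strut, which expresses that the strut is orthogonal to both
    curves. *)
Lemma is_derive_strutH u : 0 < u < s ->
  is_derive u 1 (fun u => strutH u (partner s t u))
   (- (slope u * dstrutX s t u)
    + t / s * (slope (partner s t u) * dstrutX t s (partner s t u))).
Proof.
move=> us; have us' : 0 <= u <= s by case/andP: us => *; rewrite !ltW.
have vt := partner_itvoo us; have := is_derive_sden us.
have := is_derive_co_partner us; have := sden_gt0 us'; have := sqr_sden us'.
have := sqr_co (abs_le1 s1 us'); have := sqr_co (ltW (abs_lt1 t1 vt)).
have := co_gt0 (abs_lt1 t1 vt); have := co_gt0 (abs_lt1 s1 us).
move=> a0 b0 eb ea ed d0 hb hd.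
have h1 := is_derive1_mul (is_derive_co (abs_lt1 s1 us)) hb.
have h2 := @is_derive1_div _ _ (fun u => sden u (partner s t u)) u _ _ (lt0r_neq0 d0) h1 hd.
apply: is_derive_eq h2 _; rewrite /dstrutX partnerK /slope.
set v := partner s t u in ed eb d0 b0 *; rewrite [sden v u]sdenC.
apply/eqP; rewrite -subr_eq0; apply/eqP.
(* The numerator is a combination of the relations between [sden], [co] and
   their squares, with the coefficients displayed. *)
transitivity (((- u * co v / co u + co u * (t / s) * v / co v) * (sden u v ^+ 2 - (1 - u ^+ 2 * v ^+ 2))
   + u * co v / co u * v ^+ 2 * (co u ^+ 2 - (1 - u ^+ 2))
   - (co u * (t / s) * v / co v * u ^+ 2) * (co v ^+ 2 - (1 - v ^+ 2))) / sden u v ^+ 3).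
  by field; rewrite !gt_eqF.
by rewrite ea eb ed !subrr !mulr0 subr0 addr0 mul0r.
Qed.

Lemma continuous_sden_partner : continuous (fun u => sden u (partner s t u)).
Proof.
have cp u : {for u, continuous (partner s t)}.
  by have [/derivable1_diffP/differentiable_continuous] := is_derive_partner u.
move=> u; apply: continuous_comp; last exact: sqrt_continuous.
apply: continuousB; first exact: cvg_cst.
apply: continuousM; first exact: exprn_continuous.
apply: (@continuous_comp _ _ _ (partner s t) (fun x => x ^+ 2)); first exact: cp.
exact: exprn_continuous.
Qed.

Lemma continuous_co_partner : continuous (fun u => co (partner s t u)).
Proof.
have cp u : {for u, continuous (partner s t)}.
  by have [/derivable1_diffP/differentiable_continuous] := is_derive_partner u.
by move=> u; apply: (@continuous_comp _ _ _ (partner s t) (@co R)); [exact: cp|exact: continuous_co].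
Qed.

Lemma continuous_strutX u : 0 <= u <= s -> {for u, continuous (strutX s t)}.
Proof.
move=> us; apply: continuousM.
  by apply: continuousM; [exact: cvg_id|exact: continuous_co_partner].
apply: continuousV; first exact: lt0r_neq0 (sden_gt0 us).
exact: continuous_sden_partner.
Qed.

Lemma continuous_strutH u : 0 <= u <= s ->
  {for u, continuous (fun u => strutH u (partner s t u))}.
Proof.
move=> us; apply: continuousM.
  by apply: continuousM; [exact: continuous_co|exact: continuous_co_partner].
apply: continuousV; first exact: lt0r_neq0 (sden_gt0 us).
exact: continuous_sden_partner.
Qed.

Lemma continuous_dstrutX u : 0 < u < s -> {for u, continuous (dstrutX s t)}.
Proof.
move=> us; have us' : 0 <= u <= s by case/andP: us => *; rewrite !ltW.
have vt := partner_itvoo us; have b0 := co_gt0 (abs_lt1 t1 vt).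
have d0 := sden_gt0 us'.
have cp : {for u, continuous (partner s t)}.
  by have [/derivable1_diffP/differentiable_continuous] := is_derive_partner u.
apply: continuousM; last first.
  apply: continuousV; first by rewrite expf_neq0// lt0r_neq0.
  apply: (@continuous_comp _ _ _ (fun u => sden u (partner s t u)) (fun x => x ^+ 3)).
    exact: continuous_sden_partner.
  exact: exprn_continuous.
apply: continuousD; first exact: continuous_co_partner.
apply: continuousM; last first.
  by apply: continuousV; [exact: lt0r_neq0|exact: continuous_co_partner].
apply: continuousM; last first.
  apply: (@continuous_comp _ _ _ (@co R) (fun x => x ^+ 2)); first exact: continuous_co.
  exact: exprn_continuous.
apply: continuousM; last exact: cp.
by apply: continuousM; [exact: cvg_cst|exact: cvg_id].
Qed.

Lemma strutX0 : strutX s t 0 = 0.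
Proof. by rewrite /strutX !mul0r. Qed.

(** At the outer end of the curve the strut lies in the plane of the curve and
    is orthogonal to its tangent, whose angle has sine [s]. *)
Lemma strutX_end : strutX s t s = s.
Proof.
by rewrite /strutX /sden partner_end co0 expr0n mulr0 subr0 sqrtr1 mulr1 divr1.
Qed.

Lemma strutX_lt u v : 0 <= u -> u < v -> v <= s -> strutX s t u < strutX s t v.
Proof.
move=> u0 uv vs; apply: (@MVT_lt _ _ (dstrutX s t)) => //.
  move=> x /andP[ux xv]; have xs : 0 < x < s by lra.
  by split; [exact: is_derive_strutX|exact: dstrutX_gt0].
apply: continuous_in_subspaceT => x; rewrite inE/= in_itv/= => xx.
by apply: continuous_strutX; lra.
Qed.

Lemma strutX_le u v : 0 <= u -> u <= v -> v <= s -> strutX s t u <= strutX s t v.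
Proof.
by move=> u0; rewrite le_eqVlt => /predU1P[->//|uv] vs; rewrite ltW// strutX_lt.
Qed.

Lemma strut_unit u : 0 <= u <= s ->
  strutX s t u ^+ 2 + strutX t s (partner s t u) ^+ 2
  + strutH u (partner s t u) ^+ 2 = 1.
Proof.
move=> us; have vt := partner_itv us; have d0 := sden_gt0 us.
have := sqr_sden us; have := sqr_co (abs_le1 s1 us); have := sqr_co (abs_le1 t1 vt).
rewrite /strutX /strutH partnerK [sden (partner s t u) u]sdenC.
move: d0; set v := partner s t u; clearbody v => d0 eb ea ed.
rewrite !exprMn -!mulrDl ea eb exprVn ed.
rewrite (_ : _ + _ + _ = 1 - u ^+ 2 * v ^+ 2); last by ring.
by rewrite -ed divff// expf_neq0 ?gt_eqF.
Qed.

End Strut.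

(** * Heights along the clasp curves *)

Section Height.
Variable R : realType.
Implicit Types (u v : R).
Notation mu := (@lebesgue_measure R).

Section OneCurve.
Variables (s t : R).
Hypotheses (s0 : 0 < s) (s1 : s <= 1) (t0 : 0 < t) (t1 : t <= 1).

Let claspZ' r : R := r / Num.sqrt (1 - r ^+ 2) * derive1 (claspX s t) r.

Let claspZ'E r : 0 < r < s -> claspZ' r = slope r * dstrutX s t r.
Proof.
move=> rs; rewrite /claspZ' -/(slope r); congr (_ * _).
have h : is_derive r 1 (claspX s t) (dstrutX s t r).
  apply: near_eq_is_derive (is_derive_strutX s0 s1 t0 t1 rs).
  have rs' : r \in `]0, s[ by rewrite in_itv.
  near=> x; have : x \in `]0, s[ by near: x; exact: near_in_itvoo.
  rewrite in_itv/= => /andP[x0 xs]; rewrite claspX_strutX// !ltW//.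
by rewrite derive1E; apply: derive_val.
Unshelve. all: by end_near. Qed.

Let claspZ'_near r : 0 < r < s ->
  \near r, slope r * dstrutX s t r = claspZ' r.
Proof.
move=> rs; have rs' : r \in `]0, s[ by rewrite in_itv.
near=> x; rewrite claspZ'E//; have : x \in `]0, s[ by near: x; exact: near_in_itvoo.
by rewrite in_itv.
Unshelve. all: by end_near. Qed.

Let continuous_claspZ' r : 0 < r < s -> {for r, continuous claspZ'}.
Proof.
move=> rs; rewrite /prop_for /continuous_at claspZ'E//.
apply: cvg_trans (near_eq_cvg (claspZ'_near rs)) _.
apply: continuousM; last exact: continuous_dstrutX.
exact: continuous_slope (abs_lt1 s1 rs).
Qed.

Let bound r := 2 * (slope r + t / s * slope (partner s t r)).

(** The integrand may be unbounded, but [bound] has the bounded primitive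
    [2 * (co (partner s t r) - co r)].  The factor [2] is a bound for
    [sden ^- 3]. *)
Let claspZ'_le r : 0 < r < s -> 0 <= claspZ' r <= bound r.
Proof.
move=> rs; rewrite claspZ'E//.
have rs' : 0 <= r <= s by case/andP: rs => *; rewrite !ltW.
have vt := partner_itvoo s0 t0 rs.
have a0 := co_gt0 (abs_lt1 s1 rs); have b0 := co_gt0 (abs_lt1 t1 vt).
have sl0 : 0 <= slope r by rewrite /slope divr_ge0 ?ltW//; case/andP: rs.
have sv0 : 0 <= slope (partner s t r) by rewrite /slope divr_ge0 ?ltW//; case/andP: vt.
apply/andP; split; first by rewrite mulr_ge0// ltW// dstrutX_gt0.
have k0 : 0 < t / s by rewrite divr_gt0.
rewrite /dstrutX mulrA ler_pdivrMr ?exprn_gt0 ?sden_gt0//.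
have d2 := sden2_ge s0 s1 t0 t1 rs'.
have d0 := sden_gt0 s0 s1 t0 t1 rs'.
have ed := sqr_sden s0 s1 t0 t1 rs'.
have dle1 : sden r (partner s t r) <= 1.
  by rewrite /sden -[leRHS]sqrtr1 ler_wsqrtr// gerBl mulr_ge0// sqr_ge0.
have d3 : 1 / 2 <= sden r (partner s t r) ^+ 3.
  apply: (@le_trans _ _ (sden r (partner s t r) ^+ 4)).
    rewrite (exprM _ 2 2) ed.
    by have : 15 / 16 * (15 / 16) <= (1 - r ^+ 2 * partner s t r ^+ 2) ^+ 2 :> R; [rewrite expr2 ler_pM//; lra|lra].
  by rewrite exprS ler_piMl// exprn_ge0// ltW.
apply: (@le_trans _ _ (slope r + t / s * slope (partner s t r))); last first.
  have q0 : 0 <= slope r + t / s * slope (partner s t r).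
    by rewrite addr_ge0// mulr_ge0// ltW.
  rewrite /bound; move: q0 d3; set q := slope r + _; set e := sden _ _ ^+ 3.
  by move=> q0 d3; nra.
rewrite mulrDr lerD//.
  by rewrite ler_piMr// co_le1.
rewrite (_ : slope r * _ = t / s * slope (partner s t r) * (r ^+ 2 * co r)); last first.
  by rewrite /slope; move: (partner s t r) b0 => v b0; field; rewrite !gt_eqF.
rewrite ler_piMr//; first by rewrite mulr_ge0// ltW.
rewrite mulr_ile1 ?sqr_ge0 ?co_ge0 ?co_le1// expr_le1//; first by case/andP: rs' => _ /le_trans; apply.
by case/andP: rs'.
Qed.

Let integrable_claspZ' : mu.-integrable `[0, s] (EFin \o claspZ').
Proof.
apply: (@integrable_le_derivative _ claspZ'
  (fun r => 2 * (co (partner s t r) - co r)) bound 0 s 2) => //.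
- move=> r; rewrite in_itv/= => rs.
  have vt := partner_itvoo s0 t0 rs.
  have cp : {for r, continuous (partner s t)}.
    by have [/derivable1_diffP/differentiable_continuous] := is_derive_partner s t r.
  apply: cvgM; first exact: cvg_cst.
  apply: cvgD; first exact: continuous_slope (abs_lt1 s1 rs).
  apply: cvgM; first exact: cvg_cst.
  apply: (@continuous_comp _ _ _ (partner s t) (@slope R)); first exact: cp.
  exact: continuous_slope (abs_lt1 t1 vt).
- move=> r; rewrite in_itv/= => rs.
  have h1 := is_derive_co_partner s0 t0 t1 rs.
  have h2 := is_derive_co (abs_lt1 s1 rs).
  have h3 := is_derive1_mul (is_derive_cst (2 : R) r 1) (is_deriveB h1 h2).
  by apply: is_derive_eq h3 _; rewrite /bound; ring.
- move=> r _; rewrite normrM ger0_norm// -[leRHS]mulr1 ler_wpM2l//.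
  have c1 (x : R) : 0 <= co x <= 1.
    by rewrite co_ge0 co_le1.
  by have := c1 r; have := c1 (partner s t r); rewrite ler_norml; lra.
Qed.

Let claspZE u : 0 <= u -> claspZ s t u = parameterized_integral mu 0 u claspZ'.
Proof. by move=> u0; rewrite /claspZ ger0_norm. Qed.

Lemma claspZ0 : claspZ s t 0 = 0.
Proof. by rewrite claspZE// /parameterized_integral set_itv1 Rintegral_set1. Qed.

Lemma continuous_claspZ : {within `[0, s], continuous (claspZ s t)}.
Proof.
apply: subspace_eq_continuous (parameterized_integral_continuous (ltW s0) integrable_claspZ').
by move=> u; rewrite inE/= in_itv/= => /andP[u0 _]; rewrite /from_subspace/= claspZE.
Qed.

Lemma is_derive_claspZ u : 0 < u < s ->
  is_derive u 1 (claspZ s t) (slope u * dstrutX s t u).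
Proof.
move=> us; have us' : u \in `]0, s[ by rewrite in_itv.
have h : is_derive u 1 (fun x => parameterized_integral mu 0 x claspZ') (claspZ' u).
  have /andP[u0 us1] := us.
  have /= [h1 h2] := continuous_FTC1_closed us1 integrable_claspZ' u0 (continuous_claspZ' us).
  by apply: DeriveDef; [exact: h1|rewrite -derive1E; exact: h2].
rewrite -claspZ'E//; apply: near_eq_is_derive h.
near=> x; rewrite claspZE//; have : x \in `]0, s[ by near: x; exact: near_in_itvoo.
by rewrite in_itv/= => /andP[/ltW].
Unshelve. all: by end_near. Qed.

Lemma claspXN u : claspX s t (- u) = - claspX s t u.
Proof. by rewrite /claspX sgrN normrN sqrrN mulNr. Qed.

Lemma claspZN u : claspZ s t (- u) = claspZ s t u.
Proof. by rewrite /claspZ normrN. Qed.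

End OneCurve.

(** The left-hand side has derivative zero by [is_derive_strutH], and its value
    is found at [u = 0]. *)
Lemma strut_height (s t u : R) : 0 < s -> s <= 1 -> 0 < t -> t <= 1 ->
  0 <= u <= s ->
  claspZ s t u + claspZ t s (partner s t u) + strutH u (partner s t u)
  = clasp_height s t.
Proof.
move=> s0 s1 t0 t1 /andP[u0 us].
pose G x := claspZ s t x + claspZ t s (partner s t x) + strutH x (partner s t x).
have cG : {within `[0, s], continuous G}.
  apply: within_continuousD; last first.
    apply: continuous_in_subspaceT => x; rewrite inE/= in_itv/=.
    exact: continuous_strutH.
  apply: within_continuousD; first exact: continuous_claspZ.
  apply: (@within_comp _ _ _ _ _ 0 t (ltW t0)).
  - apply: continuous_subspaceT => x.
    by have [/derivable1_diffP/differentiable_continuous] := is_derive_partner s t x.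
  - exact: continuous_claspZ.
  - by move=> x; exact: partner_itv.
have -> : claspZ s t u + claspZ t s (partner s t u) + strutH u (partner s t u) = G 0.
  rewrite -/(G u); apply/esym/(MVT_eq u0); last first.
    by apply: continuous_subspaceW cG => x; rewrite /= !in_itv/=; lra.
  move=> x /andP[x0 xu]; have xs : 0 < x < s by lra.
  have xt := partner_itvoo s0 t0 xs.
  have h1 := is_derive_claspZ s0 s1 t0 t1 xs.
  have h2 := is_derive_claspZ t0 t1 s0 s1 xt.
  have h3 := is_derive1_comp h2 (is_derive_partner s t x).
  have h4 := is_deriveD (is_deriveD h1 h3) (is_derive_strutH s0 s1 t0 t1 xs).
  by apply: is_derive_eq h4 _; rewrite /GRing.scale/=; ring.
rewrite /G partner0 claspZ0 add0r /clasp_height /strutH /sden co0 mul1r.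
  by rewrite expr0n mul0r subr0 sqrtr1 divr1.
Qed.

(** The slope [dZ / dX] of a clasp curve at [u] is [slope u], which increases;
    a chord is therefore steeper than the tangent at its lower end and less
    steep than the tangent at its upper end.  The products with [co] avoid
    division, as the curve may end vertically. *)
Lemma chord_slope (s t a b : R) : 0 < s -> s <= 1 -> 0 < t -> t <= 1 ->
  0 <= a -> a <= b -> b <= s ->
  a * (strutX s t b - strutX s t a) <= (claspZ s t b - claspZ s t a) * co a /\
  (claspZ s t b - claspZ s t a) * co b <= b * (strutX s t b - strutX s t a).
Proof.
move=> s0 s1 t0 t1 a0 ab bs.
have cl (c d : R) : {within `[a, b], continuous (fun x => c * claspZ s t x + d * strutX s t x)}.
  apply: (@continuous_subspaceW _ _ _ `[0, s]%classic).
    by move=> x; rewrite /= !in_itv/=; lra.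
  apply: within_continuousD => x; apply: cvgM; [exact: cvg_cst| |exact: cvg_cst|].
    exact: continuous_claspZ.
  move: x; apply: continuous_in_subspaceT => x; rewrite inE/= in_itv/=.
  exact: continuous_strutX.
have dl (c d x : R) : a < x < b -> is_derive x 1 (fun x => c * claspZ s t x + d * strutX s t x)
   ((c * slope x + d) * dstrutX s t x).
  move=> xx; have xs : 0 < x < s by lra.
  have h1 := is_derive1_mul (is_derive_cst c x 1) (is_derive_claspZ s0 s1 t0 t1 xs).
  have h2 := is_derive1_mul (is_derive_cst d x 1) (is_derive_strutX s0 s1 t0 t1 xs).
  by apply: is_derive_eq (is_deriveD h1 h2) _; rewrite /cst; ring.
have hm x y : 0 <= x -> x <= y -> y <= 1 -> x * co y <= y * co x.
  move=> x0 xy y1; apply: ler_pM; rewrite ?co_ge0//.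
  exact: co_le.
have sl x : a < x < b -> 0 <= dstrutX s t x /\ slope x * co x = x.
  move=> xx; have xs : 0 < x < s by lra.
  split; first by rewrite ltW// dstrutX_gt0.
  by rewrite /slope divfK// gt_eqF// (co_gt0 (abs_lt1 s1 xs)).
split; rewrite -subr_ge0.
  have h x : a < x < b ->
      is_derive x 1 (fun x => co a * claspZ s t x + - a * strutX s t x)
        ((co a * slope x - a) * dstrutX s t x) /\
      0 <= (co a * slope x - a) * dstrutX s t x.
    move=> xx; split; first exact: dl.
    have [d0 e] := sl x xx; rewrite mulr_ge0// subr_ge0 mulrC.
    rewrite -(@ler_pM2r _ (co x)); last by rewrite co_gt0// (@abs_lt1 _ s)//; lra.
    by rewrite mulrAC e hm//; lra.
  by have := MVT_le ab h (cl _ _); lra.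
have h x : a < x < b ->
    is_derive x 1 (fun x => - co b * claspZ s t x + b * strutX s t x)
      ((- co b * slope x + b) * dstrutX s t x) /\
    0 <= (- co b * slope x + b) * dstrutX s t x.
  move=> xx; split; first exact: dl.
  have [d0 e] := sl x xx; rewrite mulr_ge0// mulNr addrC subr_ge0 mulrC.
  rewrite -(@ler_pM2r _ (co x)); last by rewrite co_gt0// (@abs_lt1 _ s)//; lra.
  by rewrite mulrAC e hm//; lra.
by have := MVT_le ab h (cl _ _); lra.
Qed.

(** The strut is [H] times the vector of slopes [(slope u, slope v, 1)].  Being
    a unit vector, it gives [1 / H ^+ 2 = 1 + slope u ^+ 2 + slope v ^+ 2]. *)
Lemma strutH_slope s t u : 0 < s -> s <= 1 -> 0 < t -> t <= 1 -> 0 < u < s ->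
  let v := partner s t u in
  [/\ 0 < strutH u v, strutX s t u = slope u * strutH u v,
    strutX t s v = slope v * strutH u v & (strutH u v)^-1 <= 1 + slope u + slope v].
Proof.
move=> s0 s1 t0 t1 us v; have us' : 0 <= u <= s by lra.
have vt : 0 < v < t := partner_itvoo s0 t0 us.
have a0 := co_gt0 (abs_lt1 s1 us); have b0 := co_gt0 (abs_lt1 t1 vt).
have d0 : 0 < sden u v := sden_gt0 s0 s1 t0 t1 us'.
have H0 : 0 < strutH u v by rewrite /strutH divr_gt0// mulr_gt0.
have e1 : strutX s t u = slope u * strutH u v.
  by rewrite /strutX /slope /strutH -/v; field; rewrite !gt_eqF.
have e2 : strutX t s v = slope v * strutH u v.
  by rewrite /strutX /slope /strutH partnerK// (sdenC v); field; rewrite !gt_eqF.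
split=> //.
have := strut_unit s0 s1 t0 t1 us'; rewrite -/v e1 e2.
have p0 : 0 <= slope u by rewrite /slope divr_ge0 ?ltW//; lra.
have q0 : 0 <= slope v by rewrite /slope divr_ge0 ?ltW//; lra.
move: (slope u) (slope v) (strutH u v) p0 q0 H0 => p q H p0 q0 H0 hu.
rewrite -[leLHS]mul1r ler_pdivrMr//.
rewrite -(@ler_pXn2r _ 2) ?nnegrE//; last by rewrite mulr_ge0 ?(ltW H0)//; lra.
have : 0 <= H ^+ 2 * (p + q + p * q) by rewrite mulr_ge0 ?sqr_ge0// addr_ge0 ?mulr_ge0//; lra.
rewrite expr1n; nra.
Qed.

End Height.

(** * Distance between two clasp arms *)

Section StrutRatio.
Variable R : realType.
Implicit Types (s t u v w x y : R).

Lemma strutX_sqr s t u : 0 < s -> s <= 1 -> 0 < t -> t <= 1 -> 0 <= u <= s ->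
  strutX s t u ^+ 2 = u ^+ 2 * (1 - partner s t u ^+ 2) /
                      (1 - u ^+ 2 * partner s t u ^+ 2).
Proof.
move=> s0 s1 t0 t1 us; have vt := partner_itv s0 t0 us.
by rewrite /strutX expr_div_n exprMn sqr_sden// sqr_co// (abs_le1 t1 vt).
Qed.

Lemma co_strutX_sqr s t u : 0 < s -> s <= 1 -> 0 < t -> t <= 1 -> 0 <= u <= s ->
  1 - strutX s t u ^+ 2 = (1 - u ^+ 2) / (1 - u ^+ 2 * partner s t u ^+ 2).
Proof.
move=> s0 s1 t0 t1 us; rewrite strutX_sqr//; have := sden2_ge s0 s1 t0 t1 us.
by move: (partner s t u) => v d0; field; apply/eqP => e; lra.
Qed.

Lemma ratio_le (p q x y : R) : 0 <= p <= 1 -> 0 <= q <= 1 -> 0 <= x <= 1 -> 0 <= y <= 1 ->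
  p <= q -> y <= x -> p * x < 1 -> q * y < 1 ->
  (1 - q) / (1 - q * y) <= (1 - p) / (1 - p * x).
Proof.
move=> p01 q01 x01 y01 pq yx px qy.
rewrite ler_pdivrMr ?subr_gt0// mulrAC ler_pdivlMr ?subr_gt0// -subr_ge0.
have -> : (1 - p) * (1 - q * y) - (1 - q) * (1 - p * x) =
  (q - p) * (1 - y) + p * (x - y) * (1 - q) by ring.
by rewrite addr_ge0 ?mulr_ge0 ?subr_ge0//; lra.
Qed.

(** In disguise this compares the slope of the curve at [w] with that of the
    unit sphere around the point [u] of the other curve.  They agree at the
    partner of [u], and differ as stated on either side of it because
    [(1 - p) / (1 - p * x)] decreases in [p] and increases in [x], while
    [partner] is decreasing. *)
Lemma strutX_ratio s t u w : 0 < s -> s <= 1 -> 0 < t -> t <= 1 ->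
  0 <= u <= s -> 0 <= w <= t ->
  (w <= partner s t u -> strutX t s w ^+ 2 <= w ^+ 2 * (1 - strutX s t u ^+ 2)) /\
  (partner s t u <= w -> w ^+ 2 * (1 - strutX s t u ^+ 2) <= strutX t s w ^+ 2).
Proof.
move=> s0 s1 t0 t1 us wt.
have vt := partner_itv s0 t0 us; have ws := partner_itv t0 s0 wt.
have du := sden2_ge s0 s1 t0 t1 us; have dw := sden2_ge t0 t1 s0 s1 wt.
rewrite (@strutX_sqr t s w)// co_strutX_sqr// -mulrA.
have sq (c x : R) : 0 <= x <= c -> c <= 1 -> 0 <= x ^+ 2 <= 1.
  by move=> /andP[x0 xc] c1; rewrite sqr_ge0 expr_le1// (le_trans xc).
have sqle (x y : R) : 0 <= x -> x <= y -> x ^+ 2 <= y ^+ 2.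
  by move=> x0 xy; rewrite ler_pXn2r// ?nnegrE// (le_trans x0).
have [u0 _] := andP us; have [w0 _] := andP wt.
have [pu0 _] := andP vt; have [pw0 _] := andP ws.
split=> h; have := partner_le t0 s0 h; rewrite partnerK// => h';
  rewrite ler_wpM2l ?sqr_ge0// [w ^+ 2 * _]mulrC.
- by apply: ratio_le; [exact: sq us s1|exact: sq ws s1|exact: sq vt t1|exact: sq wt t1
    |exact: sqle|exact: sqle|lra|lra].
- by apply: ratio_le; [exact: sq ws s1|exact: sq us s1|exact: sq wt t1|exact: sq vt t1
    |exact: sqle|exact: sqle|lra|lra].
Qed.

Lemma strutH_ge0 u v : 0 <= strutH u v.
Proof. by rewrite /strutH divr_ge0 ?mulr_ge0 ?co_ge0 ?sqrtr_ge0. Qed.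

End StrutRatio.

Local Opaque claspX claspZ clasp_height strutX strutH co.

Section Distance.
Variable R : realType.
Implicit Types (s t u v a b c r x y : R).

(** One half of a profile: the clasp curve up to the parameter [s], followed by
    the straight ray in the final direction; [0] for negative [a]. *)
Definition armX s t a : R := strutX s t (clamp 0 s a) + Num.max (a - s) 0 * co s.
Definition armZ s t a : R := claspZ s t (clamp 0 s a) + Num.max (a - s) 0 * s.

(** With [u] fixed, the left-hand side as a function of [v] has derivative
    [dX * (slope v - X / S)], with [S] the square root; by [strutX_ratio] it is
    nonnegative up to the partner of [u] and nonpositive beyond, and at the
    partner [strut_height] gives equality. *)
Lemma clasp_under s t u v : 0 < s -> s <= 1 -> 0 < t -> t <= 1 ->
  0 <= u <= s -> 0 <= v <= t ->
  strutX s t u ^+ 2 + strutX t s v ^+ 2 < 1 ->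
  claspZ s t u + claspZ t s v
    + Num.sqrt (1 - strutX s t u ^+ 2 - strutX t s v ^+ 2) <= clasp_height s t.
Proof.
move=> s0 s1 t0 t1 us vt xy.
set x := strutX s t u in xy *; set v' := partner s t u.
have vt' : 0 <= v' <= t := partner_itv s0 t0 us.
pose S w := Num.sqrt (1 - x ^+ 2 - strutX t s w ^+ 2).
pose G w := claspZ t s w + S w.
have X0 w : 0 <= w <= t -> 0 <= strutX t s w.
  by move=> /andP[w0 wt]; rewrite -(strutX0 t s) strutX_le.
have xy' : x ^+ 2 + strutX t s v' ^+ 2 <= 1.
  by have := strut_unit s0 s1 t0 t1 us; have := sqr_ge0 (strutH u v'); rewrite -/x -/v'; lra.
have G' : claspZ s t u + G v' = clasp_height s t.
  rewrite -(strut_height s0 s1 t0 t1 us) /G addrA; congr (_ + _).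
  rewrite /S; have <- : strutH u v' ^+ 2 = 1 - x ^+ 2 - strutX t s v' ^+ 2.
    by have := strut_unit s0 s1 t0 t1 us; rewrite -/x -/v'; lra.
  by rewrite sqrtr_sqr ger0_norm// strutH_ge0.
have -> : claspZ s t u + claspZ t s v + Num.sqrt (1 - x ^+ 2 - strutX t s v ^+ 2)
  = claspZ s t u + G v by rewrite /G /S addrA.
rewrite -G' lerD2l.
have cG a b : 0 <= a -> b <= t -> {within `[a, b], continuous G}.
  move=> a0 bt; apply: (@continuous_subspaceW _ _ _ `[0, t]%classic).
    by move=> w; rewrite /= !in_itv/=; lra.
  apply: within_continuousD; first exact: continuous_claspZ.
  apply: continuous_in_subspaceT => w; rewrite inE/= in_itv/= => wt.
  apply: (@continuous_comp _ _ _ (fun w => 1 - x ^+ 2 - strutX t s w ^+ 2) Num.sqrt); last exact: sqrt_continuous.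
  apply: cvgB; first exact: cvg_cst.
  apply: (@continuous_comp _ _ _ (strutX t s) (fun x => x ^+ 2)); last exact: exprn_continuous.
  exact: continuous_strutX.
pose dG w := dstrutX t s w * (slope w - strutX t s w / S w).
have hG w : 0 < w < t -> 0 < 1 - x ^+ 2 - strutX t s w ^+ 2 -> is_derive w 1 G (dG w).
  move=> wt p0.
  have h1 := is_derive_claspZ t0 t1 s0 s1 wt.
  have hX := is_derive_strutX t0 t1 s0 s1 wt.
  have h2 : is_derive w 1 (fun w => 1 - x ^+ 2 - strutX t s w ^+ 2) (- (2 * strutX t s w * dstrutX t s w)).
    have h3 := is_deriveB (is_derive_cst (1 - x ^+ 2) w 1) (is_derive1_mul hX hX).
    by apply: is_derive_eq h3 _; ring.
  have h4 := @is_derive1_sqrt_comp _ (fun w => 1 - x ^+ 2 - strutX t s w ^+ 2) w _ p0 h2.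
  apply: is_derive_eq (is_deriveD h1 h4) _; rewrite /dG /S.
  have q0 : 0 < Num.sqrt (1 - x ^+ 2 - strutX t s w ^+ 2) by rewrite sqrtr_gt0.
  move: (Num.sqrt _) (slope w) q0 => q sl q0; field; exact: lt0r_neq0.
have sgn w : 0 < w < t -> 0 < 1 - x ^+ 2 - strutX t s w ^+ 2 ->
    (w <= v' -> 0 <= dG w) /\ (v' <= w -> dG w <= 0).
  move=> wt p0; have wt' : 0 <= w <= t by lra.
  have S0 : 0 < S w by rewrite sqrtr_gt0.
  have c0 := co_gt0 (abs_lt1 t1 wt).
  have ec := sqr_co (abs_le1 t1 wt').
  have eS : S w ^+ 2 = 1 - x ^+ 2 - strutX t s w ^+ 2 by rewrite sqr_sqrtr// ltW.
  have d0 := dstrutX_gt0 t0 t1 s0 s1 wt.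
  have xw0 := X0 w wt'; have [w0 _] := andP wt'.
  have [k1 k2] := strutX_ratio s0 s1 t0 t1 us wt'.
  have e : slope w - strutX t s w / S w = (w * S w - strutX t s w * co w) / (co w * S w).
    by rewrite /slope; field; rewrite !gt_eqF.
  rewrite /dG e.
  move: (S w) S0 eS => q q0 eq; move: (dstrutX t s w) d0 => d d0.
  rewrite -/x in k1 k2; move: (strutX t s w) xw0 eq k1 k2 => X X0' eq k1 k2.
  move: (co w) c0 ec => c c0 ec.
  split=> hw.
    rewrite mulr_ge0// ?(ltW d0)// divr_ge0//; last by rewrite mulr_ge0// ltW.
    rewrite subr_ge0 -(@ler_pXn2r _ 2)// ?nnegrE; try by rewrite mulr_ge0// ltW.
    by rewrite !exprMn eq ec; have := k1 hw; nra.
  rewrite mulr_ge0_le0// ?(ltW d0)// mulr_le0_ge0//; last by rewrite invr_ge0 mulr_ge0// ltW.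
  rewrite subr_le0 -(@ler_pXn2r _ 2)// ?nnegrE; try by rewrite mulr_ge0// ltW.
  by rewrite !exprMn eq ec; have := k2 hw; nra.
have sqlt (p q : R) : 0 <= p -> p < q -> p ^+ 2 < q ^+ 2.
  by move=> p0 pq; rewrite ltr_pXn2r// ?nnegrE// (le_trans p0)// ltW.
have [v0 vt1] := andP vt; have [v0' vt1'] := andP vt'.
have [vv|vv] := leP v v'.
  apply: (@MVT_le _ _ dG) => //; last exact: cG.
  move=> w /andP[vw wv]; have wt : 0 < w < t by lra.
  have p0 : 0 < 1 - x ^+ 2 - strutX t s w ^+ 2.
    have : strutX t s w ^+ 2 < strutX t s v' ^+ 2.
      by apply: sqlt; [apply: X0; lra|apply: strutX_lt => //; lra].
    by lra.
  by split; [exact: hG|apply: (sgn w wt p0).1; lra].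
rewrite -lerN2; apply: (@MVT_le _ (fun w => - G w) (fun w => - dG w)); first exact: ltW.
  move=> w /andP[vw wv]; have wt : 0 < w < t by lra.
  have p0 : 0 < 1 - x ^+ 2 - strutX t s w ^+ 2.
    have : strutX t s w ^+ 2 < strutX t s v ^+ 2.
      by apply: sqlt; [apply: X0; lra|apply: strutX_lt => //; lra].
    by lra.
  split; first exact: is_deriveN (hG w wt p0).
  by rewrite oppr_ge0; apply: (sgn w wt p0).2; lra.
by move=> w; apply: cvgN; exact: cG.
Qed.

(** Along the ray the height grows by [r * c], which is at most the drop of the
    unit hemisphere.  For [y = 0] the ray is tangent to the unit circle, and a
    tangent line stays outside the disc; for other [y] the drop is larger. *)
Lemma ray_le (c r y : R) : 0 < c -> c <= 1 -> 0 <= r ->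
  (c + r * co c) ^+ 2 + y ^+ 2 < 1 ->
  r * c + Num.sqrt (1 - (c + r * co c) ^+ 2 - y ^+ 2)
  <= Num.sqrt (1 - c ^+ 2 - y ^+ 2).
Proof.
move=> c0 c1 r0 xy.
have k0 := co_ge0 c; have ek : co c ^+ 2 = 1 - c ^+ 2.
  by apply: sqr_co; rewrite gtr0_norm.
move: (co c) k0 ek xy => k k0 ek xy.
set S := Num.sqrt (1 - (c + r * k) ^+ 2 - y ^+ 2).
have S0 : 0 <= S := sqrtr_ge0 _.
have eS : S ^+ 2 = 1 - (c + r * k) ^+ 2 - y ^+ 2 by rewrite sqr_sqrtr//; lra.
have rk : 0 <= r * k by rewrite mulr_ge0.
have x1 : c + r * k < 1.
  by have := sqr_ge0 y; nra.
have kp : 0 < k.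
  rewrite lt_neqAle k0 andbT; apply/eqP => e; move: ek x1; rewrite -e; nra.
have rc : r * c <= k.
  rewrite -(@ler_pM2r _ k)//; have : r * k * c <= (1 - c) * c by nra.
  by nra.
have SS : S <= k - r * c.
  rewrite -(@ler_pXn2r _ 2)// ?nnegrE ?subr_ge0// eS; have := sqr_ge0 y; nra.
rewrite -[leLHS]ger0_norm ?addr_ge0// ?mulr_ge0 ?(ltW c0)// -sqrtr_sqr ler_wsqrtr//.
have : r * c * S <= r * c * (k - r * c) by rewrite ler_wpM2l// mulr_ge0// ltW.
have : 0 <= (r * k) ^+ 2 + (r * c) ^+ 2 by rewrite addr_ge0 ?sqr_ge0.
rewrite !expr2 in eS ek *; nra.
Qed.

Lemma arm_ray_le c r x y : 0 < c -> c <= 1 -> 0 <= r -> (r == 0) || (x == c) ->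
  (x + r * co c) ^+ 2 + y ^+ 2 < 1 ->
  r * c + Num.sqrt (1 - (x + r * co c) ^+ 2 - y ^+ 2)
  <= Num.sqrt (1 - x ^+ 2 - y ^+ 2).
Proof.
move=> c0 c1 r0 /orP[] /eqP -> xy; last exact: ray_le.
by rewrite !mul0r add0r addr0.
Qed.

(** Either the point is on the clasp part and [r = 0], or it is on the ray and
    the clasp parameter is truncated to [s]. *)
Lemma arm_cases s t a : 0 < s ->
  exists r, [/\ 0 <= r, (r == 0) || (strutX s t (clamp 0 s a) == s),
    armX s t a = strutX s t (clamp 0 s a) + r * co s &
    armZ s t a = claspZ s t (clamp 0 s a) + r * s].
Proof.
move=> s0; exists (Num.max (a - s) 0); split=> //; first by rewrite le_max lexx orbT.
have [as_|sa] := leP a s; first by rewrite max_r ?eqxx// subr_le0.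
have -> : clamp 0 s a = s by rewrite /clamp max_l ?min_r// ltW// (lt_trans s0).
by rewrite strutX_end// eqxx orbT.
Qed.

(** If the horizontal distance is less than 1, the vertical one is at least the
    height of the hemisphere: this is [clasp_under] for the truncated
    parameters, followed by [ray_le] along each of the two rays. *)
Lemma clasp_distance s t a b : 0 < s -> s <= 1 -> 0 < t -> t <= 1 ->
  1 <= armX s t a ^+ 2 + armX t s b ^+ 2
       + (clasp_height s t - armZ s t a - armZ t s b) ^+ 2.
Proof.
move=> s0 s1 t0 t1.
have [ra [ra0 hra -> ->]] := arm_cases t a s0.
have [rb [rb0 hrb -> ->]] := arm_cases s b t0.
have us := clamp_itv a (ltW s0); have vt := clamp_itv b (ltW t0).
move: (clamp 0 s a) (clamp 0 t b) us vt hra hrb => u v us vt hra hrb.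
have x0 : 0 <= strutX s t u by rewrite -(strutX0 s t) strutX_le//; case/andP: us.
have y0 : 0 <= strutX t s v by rewrite -(strutX0 t s) strutX_le//; case/andP: vt.
set x := strutX s t u + _; set y := strutX t s v + _.
have xx : strutX s t u <= x by rewrite lerDl mulr_ge0 ?co_ge0.
have yy : strutX t s v <= y by rewrite lerDl mulr_ge0 ?co_ge0.
have [|xy] := leP 1 (x ^+ 2 + y ^+ 2).
  by move=> h; apply: le_trans h _; rewrite lerDl sqr_ge0.
have sqle (p q : R) : 0 <= p -> p <= q -> p ^+ 2 <= q ^+ 2.
  by move=> p0 pq; rewrite ler_pXn2r// ?nnegrE// (le_trans p0).
have x2 := sqle _ _ x0 xx; have y2 := sqle _ _ y0 yy.
have hx : ra * s + Num.sqrt (1 - x ^+ 2 - y ^+ 2) <= Num.sqrt (1 - strutX s t u ^+ 2 - y ^+ 2).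
  exact: arm_ray_le.
have hy : rb * t + Num.sqrt (1 - strutX s t u ^+ 2 - y ^+ 2)
    <= Num.sqrt (1 - strutX s t u ^+ 2 - strutX t s v ^+ 2).
  rewrite ![_ - strutX s t u ^+ 2 - _]addrAC; apply: arm_ray_le => //.
  by rewrite -/y; lra.
have := @clasp_under s t u v s0 s1 t0 t1 us vt _.
have h0 : strutX s t u ^+ 2 + strutX t s v ^+ 2 < 1 by lra.
move=> /(_ h0) h.
set d := clasp_height s t - _ - _.
have hd : Num.sqrt (1 - x ^+ 2 - y ^+ 2) <= d.
  rewrite /d; move: (claspZ s t u) (claspZ t s v) (clasp_height s t) h hx hy.
  do 3 (let q := fresh in set q := Num.sqrt _); move=> zs zt hh; lra.
move: xy hd; clear -sqle; clearbody x y d => xy hd.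
by have := sqle _ _ (sqrtr_ge0 _) hd; rewrite sqr_sqrtr; lra.
Qed.

End Distance.

(** * Vectors in space *)

Section Vectors.
Variable R : realType.
Implicit Types (p q u v : 'rV[R]_3) (a b c x y z : R).

Lemma dotE u v : dot u v = u 0 0 * v 0 0 + u 0 1 * v 0 1 + u 0 2 * v 0 2.
Proof.
rewrite /dot mxE !big_ord_recr/= big_ord0 add0r !mxE.
by congr (u 0 _ * v 0 _ + u 0 _ * v 0 _ + u 0 _ * v 0 _); apply/val_inj.
Qed.

Lemma vec3E x y z : ((vec3 x y z 0 0 = x) * (vec3 x y z 0 1 = y) * (vec3 x y z 0 2 = z))%type.
Proof. by rewrite !mxE. Qed.

Lemma row3P u v : u 0 0 = v 0 0 -> u 0 1 = v 0 1 -> u 0 2 = v 0 2 -> u = v.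
Proof.
move=> h0 h1 h2; apply/rowP => -[[|[|[|//]]] hk].
- by rewrite (_ : Ordinal hk = 0)//; apply/val_inj.
- by rewrite (_ : Ordinal hk = 1)//; apply/val_inj.
- by rewrite (_ : Ordinal hk = 2)//; apply/val_inj.
Qed.

Lemma dotC u v : dot u v = dot v u.
Proof. by rewrite !dotE; ring. Qed.

Lemma dotDl u v p : dot (u + v) p = dot u p + dot v p.
Proof. by rewrite !dotE !mxE; ring. Qed.

Lemma dotZl a u v : dot (a *: u) v = a * dot u v.
Proof. by rewrite !dotE !mxE; ring. Qed.

Lemma dotDr u v p : dot p (u + v) = dot p u + dot p v.
Proof. by rewrite !(dotC p) dotDl. Qed.

Lemma dotZr a u v : dot u (a *: v) = a * dot u v.
Proof. by rewrite !(dotC u) dotZl. Qed.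

Lemma dotNl u v : dot (- u) v = - dot u v.
Proof. by rewrite -scaleN1r dotZl mulN1r. Qed.

Lemma dotBl u v p : dot (u - v) p = dot u p - dot v p.
Proof. by rewrite dotDl dotNl. Qed.

Lemma dotBr u v p : dot p (u - v) = dot p u - dot p v.
Proof. by rewrite !(dotC p) dotBl. Qed.

Lemma dot0l u : dot 0 u = 0. Proof. by rewrite !dotE !mxE; ring. Qed.
Lemma dot0r u : dot u 0 = 0. Proof. by rewrite dotC dot0l. Qed.

Lemma edistC p q : edist p q = edist q p.
Proof. by rewrite /edist /enorm -opprB dotNl dotC dotNl opprK. Qed.

End Vectors.

(** * Profiles and their chords *)

Section Turning.
Variable R : realType.
Implicit Types (s t w x y a b : R).

Lemma clamp_le s t a b : a <= b -> clamp s t a <= clamp s t b.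
Proof.
move=> ab; rewrite /clamp le_min ge_min ge_max !le_max ab lexx ge_min lexx !orbT/=.
by [].
Qed.

Lemma clampL a b x : a <= b -> x <= a -> clamp a b x = a.
Proof. by move=> ab xa; rewrite /clamp max_r// min_l. Qed.

Lemma clampR a b x : a <= b -> b <= x -> clamp a b x = b.
Proof. by move=> ab bx; rewrite /clamp max_l ?min_r// (le_trans ab). Qed.

Lemma clampN w x : 0 <= w -> clamp (- w) w (- x) = - clamp (- w) w x.
Proof.
move=> w0; have [h1|h1] := leP x (- w); first by rewrite clampR ?clampL ?opprK//; lra.
have [h2|h2] := leP w x; first by rewrite clampL ?clampR//; lra.
by rewrite !clamp_id//; lra.
Qed.

Lemma armX_neg s t a : 0 <= s -> a <= 0 -> armX s t a = 0.
Proof.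
move=> s0 a0; rewrite /armX clampL// strutX0 add0r max_r ?mul0r//.
by rewrite subr_le0 (le_trans a0).
Qed.

Lemma armX_clasp s t a : 0 <= a <= s -> armX s t a = strutX s t a.
Proof.
by move=> h; rewrite /armX clamp_id// max_r ?mul0r ?addr0// subr_le0; case/andP: h.
Qed.

Lemma armX_ray s t a : 0 < s -> s <= a -> armX s t a = s + (a - s) * co s.
Proof.
by move=> s0 sa; rewrite /armX clampR ?strutX_end// ?max_l ?subr_ge0// ltW.
Qed.

(** The signed sine of the angle of the profile with the horizontal: [0] on the
    middle segment, the clasp parameter on the clasp parts (negative on the
    left), and [s] or [- s] on the rays. *)
Definition turn s w x : R := clamp 0 s (x - w) - clamp 0 s (- x - w).

Lemma turnN s w x : turn s w (- x) = - turn s w x.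
Proof. by rewrite /turn opprK opprB. Qed.

Lemma turn_ge0 s w x : 0 <= s -> 0 <= w -> 0 <= x -> turn s w x = clamp 0 s (x - w).
Proof. by move=> s0 w0 x0; rewrite /turn (@clampL _ _ (- x - w)) ?subr0//; lra. Qed.

Lemma turn_le s w x y : x <= y -> turn s w x <= turn s w y.
Proof.
move=> xy; rewrite /turn lerB//; first by apply: clamp_le; lra.
by apply: clamp_le; lra.
Qed.

Lemma turn_itv s w x : 0 <= s -> - s <= turn s w x <= s.
Proof.
move=> s0; have := clamp_itv (x - w) s0; have := clamp_itv (- x - w) s0.
by rewrite /turn; lra.
Qed.

Lemma continuous_turn s w : continuous (turn s w).
Proof.
move=> x; apply: cvgB.
  apply: (@continuous_comp _ _ _ (fun x => x - w) (clamp 0 s)); last exact: continuous_clamp.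
  by apply: cvgB; [exact: cvg_id|exact: cvg_cst].
apply: (@continuous_comp _ _ _ (fun x => - x - w) (clamp 0 s)); last exact: continuous_clamp.
by apply: cvgB; [apply: cvgN; exact: cvg_id|exact: cvg_cst].
Qed.

Section Arm.
Variables (s t : R).
Hypotheses (s0 : 0 < s) (s1 : s <= 1) (t0 : 0 < t) (t1 : t <= 1).

Lemma armZ_neg a : a <= 0 -> armZ s t a = 0.
Proof.
move=> a0; rewrite /armZ clampL ?(ltW s0)// claspZ0// add0r max_r ?mul0r//.
by rewrite subr_le0 (le_trans a0) ?ltW.
Qed.

Lemma armZ_clasp a : 0 <= a <= s -> armZ s t a = claspZ s t a.
Proof.
by move=> h; rewrite /armZ clamp_id// max_r ?mul0r ?addr0// subr_le0; case/andP: h.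
Qed.

Lemma armZ_ray a : s <= a -> armZ s t a = claspZ s t s + (a - s) * s.
Proof.
by move=> sa; rewrite /armZ clampR ?max_l ?subr_ge0// ltW.
Qed.

Lemma profileXE w x : 0 <= w ->
  profileX s t w x = clamp (- w) w x + armX s t (x - w) - armX s t (- x - w).
Proof.
have ss : 0 <= s <= s by rewrite lexx ltW.
move=> w0; rewrite /profileX; have [|wx] := leP `|x| w.
  rewrite ler_norml => h; rewrite clamp_id// !armX_neg ?subrr ?addr0 ?subr0 ?(ltW s0)//; lra.
have [x0|x0] := leP 0 x.
  rewrite (ger0_norm x0) in wx *; rewrite gtr0_sg ?mul1r; last exact: le_lt_trans wx.
  rewrite (@armX_neg _ _ (- x - w)) ?(ltW s0)// ?subr0; last by lra.
  have -> : clamp (- w) w x = w by rewrite /clamp max_l ?min_r//; lra.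
  have [xs|xs] := leP x (w + s).
    rewrite armX_clasp; last by lra.
    by rewrite (addrC w); congr (_ + w); apply: claspX_strutX => //; lra.
  rewrite armX_ray//; last by lra.
  by rewrite (claspX_strutX s0 s1 t0 t1 ss) strutX_end// coE; ring.
rewrite (ltr0_norm x0) in wx *; rewrite ltr0_sg// !mulN1r.
rewrite (@armX_neg _ _ (x - w)) ?(ltW s0)// ?addr0; last by lra.
have -> : clamp (- w) w x = - w by rewrite /clamp max_r ?min_l//; lra.
have [xs|xs] := leP (- x) (w + s).
  rewrite armX_clasp ?opprK; last by lra.
  have -> : x + w = - (- x - w) by ring.
  by rewrite claspXN claspX_strutX//; [ring|lra].
rewrite armX_ray//; last by lra.
by rewrite (claspX_strutX s0 s1 t0 t1 ss) strutX_end// coE; ring.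
Qed.

Lemma profileZE w x : 0 <= w ->
  profileZ s t w x = armZ s t (x - w) + armZ s t (- x - w).
Proof.
move=> w0; rewrite /profileZ; have [|wx] := leP `|x| w.
  by rewrite ler_norml => h; rewrite !armZ_neg ?addr0//; lra.
have [x0|x0] := leP 0 x.
  rewrite (ger0_norm x0) in wx *; rewrite gtr0_sg ?mul1r; last exact: le_lt_trans wx.
  rewrite (@armZ_neg (- x - w)) ?addr0; last by lra.
  have [xs|xs] := leP x (w + s); first by rewrite armZ_clasp//; lra.
  by rewrite armZ_ray; [ring|lra].
rewrite (ltr0_norm x0) in wx *; rewrite ltr0_sg// !mulN1r.
rewrite (@armZ_neg (x - w)) ?add0r; last by lra.
have [xs|xs] := leP (- x) (w + s).
  rewrite armZ_clasp ?opprK; last by lra.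
  by rewrite -claspZN opprD.
by rewrite armZ_ray; [ring|lra].
Qed.

Lemma profileXN w x : 0 <= w -> profileX s t w (- x) = - profileX s t w x.
Proof.
move=> w0; rewrite !profileXE// opprK.
rewrite clampN//; by ring.
Qed.

Lemma profileZN w x : 0 <= w -> profileZ s t w (- x) = profileZ s t w x.
Proof. by move=> w0; rewrite !profileZE// opprK addrC. Qed.

(** [chord_slope] extended by the ray: beyond the clasp part a chord gains a
    multiple of the final direction [(co s, s)], which is the steepest one. *)
Lemma armX_chord a b : a <= b ->
  let u := clamp 0 s a in let v := clamp 0 s b in
  let dX := armX s t b - armX s t a in let dZ := armZ s t b - armZ s t a in
  [/\ 0 <= dX, 0 <= dZ, u * dX <= dZ * co u & dZ * co v <= v * dX].
Proof.
move=> ab /=; have uv := clamp_le 0 s ab.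
have := clamp_itv a (ltW s0); have := clamp_itv b (ltW s0).
have ra : a <= s -> Num.max (a - s) 0 = 0 by move=> h; rewrite max_r// subr_le0.
have vs : Num.max (b - s) 0 = Num.max (a - s) 0 \/ clamp 0 s b = s.
  have [bs|sb] := leP b s.
    by left; rewrite !max_r// subr_le0// (le_trans ab).
  by right; rewrite clampR// ltW.
have dr : 0 <= Num.max (b - s) 0 - Num.max (a - s) 0.
  by rewrite subr_ge0 ge_max !le_max lexx orbT/= andbT lerD2r ab.
rewrite /armX /armZ; move: (clamp 0 s a) (clamp 0 s b) uv vs => u v uv vs /andP[v0 vs'] /andP[u0 us].
move: (Num.max (a - s) 0) (Num.max (b - s) 0) dr vs => ra' rb' dr vs.
have [h1 h2] := chord_slope s0 s1 t0 t1 u0 uv vs'.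
have hX := strutX_le s0 s1 t0 t1 u0 uv vs'.
have hu := co_ge0 u; have hv := co_ge0 v; have hs := co_ge0 s.
have hus : u * co s <= s * co u.
  by apply: ler_pM => //; exact: co_le.
have hZ : 0 <= claspZ s t v - claspZ s t u.
  move: uv; rewrite le_eqVlt => /predU1P[->|uv]; first by rewrite subrr.
  have cu : 0 < co u.
    by apply: co_gt0; rewrite ger0_norm// (lt_le_trans uv)// (le_trans vs').
  rewrite -(@pmulr_lge0 _ (co u))//; apply: le_trans h1.
  by rewrite mulr_ge0// subr_ge0.
move: (claspZ s t v) (claspZ s t u) (strutX s t v) (strutX s t u) h1 h2 hX hZ => zv zu xv xu h1 h2 hX hZ.
have e1 : xv + rb' * co s - (xu + ra' * co s) = (xv - xu) + (rb' - ra') * co s by ring.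
have e2 : zv + rb' * s - (zu + ra' * s) = (zv - zu) + (rb' - ra') * s by ring.
have vs2 : rb' - ra' = 0 \/ v = s by case: vs => [->|->]; [left; ring|right].
rewrite e1 e2; move: (rb' - ra') dr vs2 => r r0 vs2.
split.
- by rewrite addr_ge0 ?mulr_ge0 ?subr_ge0.
- by have : 0 <= r * s; [rewrite mulr_ge0// ltW|lra].
- have : r * (u * co s) <= r * (s * co u) by rewrite ler_wpM2l.
  by lra.
- by case: vs2 => [->|e]; [lra|subst v; lra].
Qed.

Lemma armX_chord_neq a b : 0 <= a -> a < b ->
  0 < (armX s t b - armX s t a) + (armZ s t b - armZ s t a).
Proof.
move=> a0 ab; have [dX dZ _ _] := armX_chord (ltW ab).
have [as_|sa] := ltP a s.
  have : 0 < armX s t b - armX s t a; last by lra.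
  rewrite subr_gt0 armX_clasp; last by lra.
  have [bs|sb] := leP b s; first by rewrite armX_clasp ?strutX_lt//; lra.
  rewrite armX_ray ?(ltW sb)// (lt_le_trans (strutX_lt s0 s1 t0 t1 a0 as_ _))//.
  by rewrite strutX_end// lerDl mulr_ge0 ?co_ge0// subr_ge0 ltW.
have : 0 < armZ s t b - armZ s t a; last by lra.
rewrite !armZ_ray//; last by rewrite (le_trans sa)// ltW.
have : 0 < (b - a) * s by rewrite mulr_gt0// subr_gt0.
by lra.
Qed.

Lemma continuous_armX : continuous (armX s t).
Proof.
move=> x; apply: cvgD.
  apply: (@continuous_comp_clamp _ (strutX s t) 0 s (ltW s0)).
  apply: continuous_in_subspaceT => y; rewrite inE/= in_itv/=.
  exact: continuous_strutX.
apply: cvgM; last exact: cvg_cst.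
apply: (@continuous_max _ _ (fun x => x - s) (cst 0)); last exact: cvg_cst.
by apply: cvgB; [exact: cvg_id|exact: cvg_cst].
Qed.

Lemma continuous_armZ : continuous (armZ s t).
Proof.
move=> x; apply: cvgD.
  by apply: (@continuous_comp_clamp _ (claspZ s t) 0 s (ltW s0)); exact: continuous_claspZ.
apply: cvgM; last exact: cvg_cst.
apply: (@continuous_max _ _ (fun x => x - s) (cst 0)); last exact: cvg_cst.
by apply: cvgB; [exact: cvg_id|exact: cvg_cst].
Qed.

Lemma continuous_profileX w : 0 <= w -> continuous (profileX s t w).
Proof.
move=> w0; have -> : profileX s t w =
    (fun x => clamp (- w) w x + armX s t (x - w) - armX s t (- x - w)).
  by apply/funext => x; rewrite profileXE.
move=> x; apply: cvgB; first apply: cvgD; first exact: continuous_clamp.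
  apply: (@continuous_comp _ _ _ (fun x => x - w) (armX s t)); last exact: continuous_armX.
  by apply: cvgB; [exact: cvg_id|exact: cvg_cst].
apply: (@continuous_comp _ _ _ (fun x => - x - w) (armX s t)); last exact: continuous_armX.
by apply: cvgB; [apply: cvgN; exact: cvg_id|exact: cvg_cst].
Qed.

Lemma continuous_profileZ w : 0 <= w -> continuous (profileZ s t w).
Proof.
move=> w0; have -> : profileZ s t w =
    (fun x => armZ s t (x - w) + armZ s t (- x - w)).
  by apply/funext => x; rewrite profileZE.
move=> x; apply: cvgD.
  apply: (@continuous_comp _ _ _ (fun x => x - w) (armZ s t)); last exact: continuous_armZ.
  by apply: cvgB; [exact: cvg_id|exact: cvg_cst].
apply: (@continuous_comp _ _ _ (fun x => - x - w) (armZ s t)); last exact: continuous_armZ.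
by apply: cvgB; [apply: cvgN; exact: cvg_id|exact: cvg_cst].
Qed.

(** Here [N] is the length of the chord and [b] the sine of its angle. *)
Lemma profile_chord_ge0 w x y : 0 <= w -> 0 <= x -> x < y ->
  exists N b, [/\ 0 < N, turn s w x <= b <= turn s w y,
    profileX s t w y - profileX s t w x = N * co b &
    profileZ s t w y - profileZ s t w x = N * b].
Proof.
move=> w0 x0 xy; have y0 : 0 <= y by lra.
rewrite !turn_ge0 ?(ltW s0)//.
set dX := profileX s t w y - _; set dZ := profileZ s t w y - _.
have hab : x - w <= y - w by lra.
have [aX aZ h1 h2] := armX_chord hab.
have eX : dX = (clamp (- w) w y - clamp (- w) w x) + (armX s t (y - w) - armX s t (x - w)).
  rewrite /dX !profileXE// (@armX_neg _ _ (- x - w)) ?(@armX_neg _ _ (- y - w)) ?(ltW s0)//; [ring|lra|lra].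
have eZ : dZ = armZ s t (y - w) - armZ s t (x - w).
  by rewrite /dZ !profileZE// (@armZ_neg (- x - w)) ?(@armZ_neg (- y - w)) ?addr0//; lra.
have cc : 0 <= clamp (- w) w y - clamp (- w) w x by rewrite subr_ge0 clamp_le// ltW.
have c0 : clamp 0 s (x - w) * (clamp (- w) w y - clamp (- w) w x) = 0.
  have [xw|wx] := leP x w; first by rewrite clampL ?mul0r ?(ltW s0)//; lra.
  rewrite (@clampR (- w) w x) ?(@clampR (- w) w y) ?subrr ?mulr0//; lra.
have cu := clamp_itv (x - w) (ltW s0); have cv := clamp_itv (y - w) (ltW s0).
have pos : 0 < dX + dZ.
  have [xw|wx] := ltP x w.
    have : 0 < clamp (- w) w y - clamp (- w) w x; last by rewrite eX eZ; lra.
    by rewrite subr_gt0 /clamp !max_l ?lt_min ?gt_min ?xw ?xy ?orbT//; lra.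
  have := @armX_chord_neq (x - w) (y - w); rewrite eX eZ; lra.
have dX0 : 0 <= dX by rewrite eX; lra.
have dZ0 : 0 <= dZ by rewrite eZ.
have k1 : clamp 0 s (x - w) * dX <= dZ * co (clamp 0 s (x - w)) by rewrite eX eZ mulrDr c0 add0r.
have k2 : dZ * co (clamp 0 s (y - w)) <= clamp 0 s (y - w) * dX.
  rewrite eX eZ mulrDr (le_trans h2)// lerDr mulr_ge0//; by case/andP: cv.
move: k1 k2 cu cv; move: (clamp 0 s (x - w)) (clamp 0 s (y - w)) => u v k1 k2 cu cv.
clear -pos dX0 dZ0 k1 k2 cu cv s1; clearbody dX dZ.
have sq0 : 0 < dX ^+ 2 + dZ ^+ 2.
  by have := mulr_gt0 pos pos; have := sqr_ge0 (dX - dZ); nra.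
pose N := Num.sqrt (dX ^+ 2 + dZ ^+ 2).
have N0 : 0 < N by rewrite sqrtr_gt0.
have eN : N ^+ 2 = dX ^+ 2 + dZ ^+ 2 by rewrite sqr_sqrtr// ltW.
have eb : co (dZ / N) = dX / N.
  rewrite -coE -[RHS]ger0_norm ?divr_ge0// ?(ltW N0)// -sqrtr_sqr; congr Num.sqrt.
  rewrite !exprMn !exprVn eN; field; lra.
exists N, (dZ / N); split=> //; last by rewrite mulrC divfK// gt_eqF.
  have [[u0 us] [v0 vs]] := (andP cu, andP cv).
  have hu : co u ^+ 2 = 1 - u ^+ 2 by rewrite sqr_co// ger0_norm// (le_trans us).
  have hv : co v ^+ 2 = 1 - v ^+ 2 by rewrite sqr_co// ger0_norm// (le_trans vs).
  have cu0 := co_ge0 u; have cv0 := co_ge0 v.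
  rewrite ler_pdivlMr// ler_pdivrMr//; apply/andP; split.
    rewrite -(@ler_pXn2r _ 2) ?nnegrE//; last by rewrite mulr_ge0// ltW.
    have : (u * dX) ^+ 2 <= (dZ * co u) ^+ 2.
      by rewrite ler_pXn2r// ?nnegrE mulr_ge0.
    by rewrite !exprMn hu eN; lra.
  rewrite -(@ler_pXn2r _ 2) ?nnegrE//; last by rewrite mulr_ge0// ltW.
  have : (dZ * co v) ^+ 2 <= (v * dX) ^+ 2.
    by rewrite ler_pXn2r// ?nnegrE mulr_ge0.
  by rewrite !exprMn hv eN; lra.
by rewrite eb mulrC divfK// gt_eqF.
Qed.

(** Both ends must lie on the same side of the axis of symmetry because
    [armX_chord] is applied to a single arm. *)
Lemma profile_chord w x y : 0 <= w -> x < y -> 0 <= x \/ y <= 0 ->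
  exists N b, [/\ 0 < N, turn s w x <= b <= turn s w y,
    profileX s t w y - profileX s t w x = N * co b &
    profileZ s t w y - profileZ s t w x = N * b].
Proof.
move=> w0 xy [x0|y0]; first exact: profile_chord_ge0.
have h1 : 0 <= - y by lra.
have h2 : - y < - x by lra.
have [N [b [N0 hb eX eZ]]] := profile_chord_ge0 w0 h1 h2.
exists N, (- b); rewrite coN; split=> //.
- by move: hb; rewrite !turnN; lra.
- by rewrite -eX !profileXN//; ring.
- by rewrite mulrN -eZ !profileZN//; ring.
Qed.

End Arm.
End Turning.

(** * Tangents of a planar curve with a clasp profile *)

Section Planar.
Variable R : realType.
Implicit Types (x y a b : R).

Lemma bounded_variation_scale_nondecreasing (lo hi c : R) (f : R -> R) :
  {homo f : x y / x <= y} -> bounded_variation lo hi (fun x => c * f x).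
Proof.
move=> fm; have [c0|c0] := leP 0 c.
  by apply: nondecreasing_bounded_variation => x y _ _ xy; rewrite ler_wpM2l// fm.
have -> : (fun x => c * f x) = \- (fun x => - c * f x).
  by apply/funext => x /=; rewrite mulNr opprK.
apply: bounded_variationN; apply: nondecreasing_bounded_variation => x y _ _ xy.
by rewrite ler_wpM2l// ?oppr_ge0 ?(ltW c0)// fm.
Qed.

Variables (base e1 e2 : 'rV[R]_3) (s t w : R).
Hypotheses (s0 : 0 < s) (s1 : s <= 1) (t0 : 0 < t) (t1 : t <= 1) (w0 : 0 <= w).

Ltac hlra := move: (s0) (w0) => *; lra.

Definition planar x : 'rV[R]_3 :=
  base + profileX s t w x *: e1 + profileZ s t w x *: e2.
(** For orthonormal [e1] and [e2], the unit vector at an angle with sine [b] from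
    [e1] towards [e2]. *)
Definition heading b : 'rV[R]_3 := co b *: e1 + b *: e2.

Lemma continuous_planar : continuous planar.
Proof.
move=> x; apply: cvgD; first apply: cvgD; first exact: cvg_cst.
  by apply: cvgZr_tmp; exact: continuous_profileX.
by apply: cvgZr_tmp; exact: continuous_profileZ.
Qed.

Lemma continuous_heading : continuous heading.
Proof.
move=> x; apply: cvgD; first by apply: cvgZr_tmp; exact: continuous_co.
by apply: cvgZr_tmp; exact: cvg_id.
Qed.

Lemma turn_norm x : `|turn s w x| <= 1.
Proof. by have := turn_itv w x (ltW s0); rewrite ler_norml; move: (s1) => *; lra. Qed.

Lemma turn_between x y b : turn s w x <= b <= turn s w y -> `|b| <= 1.
Proof.
by have := turn_itv w x (ltW s0); have := turn_itv w y (ltW s0); rewrite ler_norml; move: (s1) => *; lra.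
Qed.

(** The sine [turn] is monotone, while its cosine is a sum of two monotone
    functions, one for each half of the curve. *)
Lemma heading_bounded_variation lo hi (k : 'I_3) : lo < hi ->
  bounded_variation lo hi (fun x => heading (turn s w x) 0 k).
Proof.
move=> lohi; pose up x := clamp 0 s (x - w); pose dn x := clamp 0 s (- x - w).
have updn x : co (turn s w x) = co (up x) + co (dn x) - 1.
  rewrite /turn -/(up x) -/(dn x); have [x0|x0] := leP 0 x.
    by rewrite /dn clampL ?subr0 ?co0 ?addrK ?(ltW s0)//; hlra.
  by rewrite /up clampL ?sub0r ?coN ?co0 ?(ltW s0)//; [ring|hlra].
have -> : (fun x => heading (turn s w x) 0 k) =
    ((fun x => (- e1 0 k) * (- co (up x))) \+ (fun x => e1 0 k * co (dn x)))
    \+ (fun x => e2 0 k * (turn s w x - 0)) \+ (fun x => (- e1 0 k) * 1).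
  by apply/funext => x /=; rewrite !mxE updn; ring.
apply: bounded_variationD => //; first apply: bounded_variationD => //; first apply: bounded_variationD => //;
  apply: bounded_variation_scale_nondecreasing => x y xy.
- rewrite lerN2; apply: co_le; first by case/andP: (clamp_itv (x - w) (ltW s0)).
  by apply: clamp_le; hlra.
- apply: co_le; first by case/andP: (clamp_itv (- y - w) (ltW s0)).
  by apply: clamp_le; hlra.
- by rewrite !subr0 turn_le.
- by [].
Qed.

Lemma turn_flat x : - w <= x <= w -> turn s w x = 0.
Proof. by move=> h; rewrite /turn !clampL ?subrr ?(ltW s0)//; hlra. Qed.

Lemma turn_clasp u : 0 <= u <= s -> turn s w (w + u) = u.
Proof.
move=> h; rewrite turn_ge0 ?(ltW s0)//; last by hlra.
by rewrite (addrC w) addrK clamp_id.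
Qed.

Lemma turn_ray x : w + s <= x -> turn s w x = s.
Proof.
move=> h; rewrite turn_ge0 ?(ltW s0)//; last by hlra.
by rewrite clampR ?(ltW s0)//; hlra.
Qed.

Hypotheses (d11 : dot e1 e1 = 1) (d22 : dot e2 e2 = 1) (d12 : dot e1 e2 = 0).

Lemma enormZ_heading (N b : R) : 0 <= N -> `|b| <= 1 -> enorm (N *: heading b) = N.
Proof.
move=> N0 b1; rewrite /enorm /heading dotZl dotZr dotDl !dotDr !dotZl !dotZr.
rewrite d11 d22 (dotC e2) d12 !mulr0 addr0 add0r !mulr1 -!expr2 sqr_co// subrK mulr1.
by rewrite -expr2 sqrtr_sqr ger0_norm.
Qed.

Lemma direction_planar x y : x < y -> 0 <= x \/ y <= 0 ->
  exists2 b, turn s w x <= b <= turn s w y & direction (planar x) (planar y) = heading b.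
Proof.
move=> xy h; have [N [b [N0 hb eX eZ]]] := profile_chord s0 s1 t0 t1 w0 xy h.
exists b => //; have e : planar y - planar x = N *: heading b.
  rewrite /planar /heading scalerDr !scalerA -eX -eZ !scalerBl.
  by apply: row3P; rewrite !mxE; ring.
have b1 := turn_between hb.
by rewrite /direction e enormZ_heading ?(ltW N0)// scalerA mulVf ?scale1r// gt_eqF.
Qed.

(** The direction of the chord is [heading b] with [b] squeezed between
    [turn s w x] and [turn s w y]. *)
Lemma cvg_right_direction x :
  direction (planar x) (planar y) @[y --> x^'+] --> heading (turn s w x).
Proof.
have /choice[b hb] : forall y, exists b, x < y -> 0 <= x \/ y <= 0 ->
    turn s w x <= b <= turn s w y /\ direction (planar x) (planar y) = heading b.
  move=> y; have [xy|yx] := ltP x y; last by exists 0.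
  have [h|h] := pselect (0 <= x \/ y <= 0); last by exists 0.
  by have [b hb e] := direction_planar xy h; exists b.
have nb : \forall y \near x^'+, 0 <= x \/ y <= 0.
  have [x0|x0] := leP 0 x; first by near=> y; left.
  by near=> y; right; apply: ltW; near: y; exact: nbhs_right_lt.
have cb : b y @[y --> x^'+] --> turn s w x.
  apply: (@squeeze_cvgr _ _ _ _ (cst (turn s w x)) (turn s w)).
  - near=> y; have xy : x < y by near: y; exact: nbhs_right_gt.
    have hn : 0 <= x \/ y <= 0 by near: y.
    by have [] := hb y xy hn.
  - exact: cvg_cst.
  - by apply: cvg_at_right_filter; exact: continuous_turn.
apply: (@cvg_trans _ (heading (b y) @[y --> x^'+])).
  apply: near_eq_cvg; near=> y; have xy : x < y by near: y; exact: nbhs_right_gt.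
    have hn : 0 <= x \/ y <= 0 by near: y.
  by have [_ ->] := hb y xy hn.
by apply: continuous_cvg cb; exact: continuous_heading.
Unshelve. all: by end_near. Qed.

Lemma cvg_left_direction x :
  direction (planar y) (planar x) @[y --> x^'-] --> heading (turn s w x).
Proof.
have /choice[b hb] : forall y, exists b, y < x -> 0 <= y \/ x <= 0 ->
    turn s w y <= b <= turn s w x /\ direction (planar y) (planar x) = heading b.
  move=> y; have [xy|yx] := ltP y x; last by exists 0.
  have [h|h] := pselect (0 <= y \/ x <= 0); last by exists 0.
  by have [b hb e] := direction_planar xy h; exists b.
have nb : \forall y \near x^'-, 0 <= y \/ x <= 0.
  have [x0|x0] := leP x 0; first by near=> y; right.
  by near=> y; left; apply: ltW; near: y; exact: nbhs_left_gt.
have cb : b y @[y --> x^'-] --> turn s w x.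
  apply: (@squeeze_cvgr _ _ _ _ (turn s w) (cst (turn s w x))).
  - near=> y; have xy : y < x by near: y; exact: nbhs_left_lt.
    have hn : 0 <= y \/ x <= 0 by near: y.
    by have [] := hb y xy hn.
  - by apply: cvg_at_left_filter; exact: continuous_turn.
  - exact: cvg_cst.
apply: (@cvg_trans _ (heading (b y) @[y --> x^'-])).
  apply: near_eq_cvg; near=> y; have xy : y < x by near: y; exact: nbhs_left_lt.
    have hn : 0 <= y \/ x <= 0 by near: y.
  by have [_ ->] := hb y xy hn.
by apply: continuous_cvg cb; exact: continuous_heading.
Unshelve. all: by end_near. Qed.

Variables (L : glink R) (i : comp L).
Hypotheses (curvei : @curve R L i =1 planar) (lohi : @lo R L i < @hi R L i).

Let curveE : @curve R L i = planar. Proof. exact/funext. Qed.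

Lemma right_tangent_planar x : right_tangent i x = heading (turn s w x).
Proof. by rewrite /right_tangent curveE; apply/cvg_lim => //; exact: cvg_right_direction. Qed.

Lemma left_tangent_planar x : left_tangent i x = heading (turn s w x).
Proof. by rewrite /left_tangent curveE; apply/cvg_lim => //; exact: cvg_left_direction. Qed.

Lemma tangent_planar x : tangent i x = heading (turn s w x).
Proof. by rewrite /tangent right_tangent_planar left_tangent_planar if_same. Qed.

Lemma planar_has_BV_unit_tangent : has_BV_unit_tangent i.
Proof.
have en x : enorm (heading (turn s w x)) = 1.
  by rewrite -[heading _]scale1r enormZ_heading// turn_norm.
split=> [x _|x _|k].
- split; last by rewrite right_tangent_planar.
  by rewrite curveE; apply/cvg_ex; eexists; exact: cvg_right_direction.
- split; last by rewrite left_tangent_planar.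
  by rewrite curveE; apply/cvg_ex; eexists; exact: cvg_left_direction.
- have -> : (fun x => tangent i x 0 k) = (fun x => heading (turn s w x) 0 k).
    by apply/funext => x; rewrite tangent_planar.
  exact: heading_bounded_variation.
Qed.

End Planar.

(** * Distances in the clasped links *)

Section LinkGeometry.
Variable R : realType.
Implicit Types (x y a b u : R) (e : bool).

Lemma sgb2 e : sgb R e * sgb R e = 1.
Proof. by case: e; rewrite /sgb ?mulr1// mulrNN mulr1. Qed.

Lemma betaE t1 t2 w y x : beta t1 t2 w y x =
  planar (vec3 0 y (clasp_height t1 t2)) (vec3 1 0 0) (vec3 0 0 (-1)) t1 t2 w x.
Proof. by apply: row3P; rewrite !mxE/=; ring. Qed.

Lemma gammaE t1 t2 w y x : gamma t1 t2 w y x =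
  planar (vec3 y 0 0) (vec3 0 1 0) (vec3 0 0 1) t2 t1 w x.
Proof. by apply: row3P; rewrite !mxE/=; ring. Qed.

Lemma vec3_orthonormal : [/\ dot (vec3 1 0 0 : 'rV[R]_3) (vec3 1 0 0) = 1,
   dot (vec3 0 0 (-1) : 'rV[R]_3) (vec3 0 0 (-1)) = 1,
   dot (vec3 1 0 0 : 'rV[R]_3) (vec3 0 0 (-1)) = 0 &
   [/\ dot (vec3 0 1 0 : 'rV[R]_3) (vec3 0 1 0) = 1,
   dot (vec3 0 0 1 : 'rV[R]_3) (vec3 0 0 1) = 1 &
   dot (vec3 0 1 0 : 'rV[R]_3) (vec3 0 0 1) = 0]].
Proof. by split; [| | |split]; rewrite dotE !vec3E; ring. Qed.

Lemma enorm_vec3 x y z : enorm (vec3 x y z) = Num.sqrt (x ^+ 2 + y ^+ 2 + z ^+ 2).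
Proof. by rewrite /enorm dotE !vec3E -!expr2. Qed.

Section Profiles.
Variables (s t : R).
Hypotheses (s0 : 0 < s) (s1 : s <= 1) (t0 : 0 < t) (t1 : t <= 1).

Lemma profileZ_norm w x : 0 <= w -> profileZ s t w x = armZ s t (`|x| - w).
Proof.
have az a : a <= 0 -> armZ s t a = 0 by move=> ?; exact: armZ_neg.
move=> w0; rewrite profileZE//; have [x0|x0] := leP 0 x.
  by rewrite ger0_norm// (az (- x - w)) ?addr0//; lra.
by rewrite ltr0_norm// (az (x - w)) ?add0r//; lra.
Qed.

Lemma armX_ge0 a : 0 <= armX s t a.
Proof.
have [a0|a0] := leP a 0; first by rewrite armX_neg// ltW.
have [] := armX_chord s0 s1 t0 t1 (ltW a0).
by rewrite (@armX_neg _ _ _ 0) ?subr0// ltW.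
Qed.

(** One of the two arms of the profile starts at [sgb R e * w].  A point on the
    other arm is even farther from there than from the start of its own arm. *)
Lemma profileX_offset w x e : 0 <= w ->
  armX s t (`|x| - w) ^+ 2 <= (profileX s t w x - sgb R e * w) ^+ 2.
Proof.
move=> w0.
wlog x0 : x e / 0 <= x => [hw|].
  have [x0|x0] := leP 0 x; first exact: hw.
  have := hw (- x) (~~ e); rewrite normrN profileXN// => /(_ _).
  have -> : (- profileX s t w x - sgb R (~~ e) * w) ^+ 2 = (profileX s t w x - sgb R e * w) ^+ 2.
    by case: e; rewrite /sgb/=; ring.
  by apply; lra.
have xw0 : - x - w <= 0 by lra.
rewrite profileXE// (@armX_neg _ _ _ (- x - w)) ?(ltW s0)// subr0 ger0_norm//.
have p0 := armX_ge0 (x - w).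
have [xw|wx] := leP x w.
  by rewrite (@armX_neg _ _ _ (x - w)) ?(ltW s0)// ?expr0n ?sqr_ge0//; lra.
rewrite clampR; [|lra|lra].
move: (armX s t (x - w)) p0 => p p0; case: e; rewrite /sgb; nra.
Qed.

Lemma profileX_clasp w u e : 0 <= w -> 0 <= u <= s ->
  profileX s t w (sgb R e * (w + u)) = sgb R e * (strutX s t u + w).
Proof.
move=> w0 us; have h : profileX s t w (w + u) = strutX s t u + w.
  rewrite profileXE// (@armX_neg _ _ _ (- (w + u) - w)) ?(ltW s0)//; last by lra.
  rewrite (addrC w u) addrK armX_clasp// clampR; [ring|lra|lra].
by case: e; rewrite /sgb ?mul1r// mulN1r profileXN// h mulN1r.
Qed.

Lemma profileZ_clasp w u e : 0 <= w -> 0 <= u <= s ->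
  profileZ s t w (sgb R e * (w + u)) = claspZ s t u.
Proof.
move=> w0 us; rewrite profileZ_norm// normrM.
have -> : `|sgb R e| = 1 by case: e; rewrite /sgb ?normrN normr1.
rewrite mul1r ger0_norm; last by lra.
by rewrite (addrC w u) addrK armZ_clasp.
Qed.

End Profiles.

Section Distances.
Variables (t1 t2 w1 w2 : R).
Hypotheses (t1_gt0 : 0 < t1) (t1_le1 : t1 <= 1) (t2_gt0 : 0 < t2) (t2_le1 : t2 <= 1).
Hypotheses (w1_ge0 : 0 <= w1) (w2_ge0 : 0 <= w2).

(** The plane of each arc crosses the other arc where one of its arms starts, so
    that [profileX_offset] reduces the estimate to [clasp_distance]. *)
Lemma beta_gamma_edist_ge1 (e1 e2 : bool) a b :
  1 <= edist (beta t1 t2 w1 (sgb R e2 * w2) a) (gamma t1 t2 w2 (sgb R e1 * w1) b).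
Proof.
have -> : edist (beta t1 t2 w1 (sgb R e2 * w2) a) (gamma t1 t2 w2 (sgb R e1 * w1) b) =
    enorm (vec3 (profileX t1 t2 w1 a - sgb R e1 * w1) (- (profileX t2 t1 w2 b - sgb R e2 * w2))
     (clasp_height t1 t2 - profileZ t1 t2 w1 a - profileZ t2 t1 w2 b)).
  by congr enorm; apply: row3P; rewrite !mxE/=; ring.
rewrite enorm_vec3 -[leLHS]sqrtr1 ler_wsqrtr//.
rewrite !profileZ_norm// sqrrN.
apply: le_trans (clasp_distance (`|a| - w1) (`|b| - w2) t1_gt0 t1_le1 t2_gt0 t2_le1) _.
by rewrite lerD2r lerD// profileX_offset.
Qed.

(** The half [e1] of the arc [beta_e2] is clasped with the half [e2] of the arc
    [gamma_e1]. *)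
Lemma strut_vector (e1 e2 : bool) u : 0 <= u <= t1 ->
  beta t1 t2 w1 (sgb R e2 * w2) (sgb R e1 * (w1 + u))
  - gamma t1 t2 w2 (sgb R e1 * w1) (sgb R e2 * (w2 + partner t1 t2 u))
  = vec3 (sgb R e1 * strutX t1 t2 u) (- (sgb R e2 * strutX t2 t1 (partner t1 t2 u)))
      (strutH u (partner t1 t2 u)).
Proof.
move=> us; have vt := partner_itv t1_gt0 t2_gt0 us.
have h := strut_height t1_gt0 t1_le1 t2_gt0 t2_le1 us.
rewrite /beta /gamma !profileX_clasp// !profileZ_clasp// -h.
move: (claspZ t1 t2 u) (claspZ t2 t1 _) (strutX t1 t2 u) (strutX t2 t1 _) (strutH _ _).
by move=> a b c d e; apply: row3P; rewrite !mxE/=; ring.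
Qed.

Lemma strut_edist (e1 e2 : bool) u : 0 <= u <= t1 ->
  edist (beta t1 t2 w1 (sgb R e2 * w2) (sgb R e1 * (w1 + u)))
   (gamma t1 t2 w2 (sgb R e1 * w1) (sgb R e2 * (w2 + partner t1 t2 u))) = 1.
Proof.
move=> us; rewrite /edist strut_vector// enorm_vec3 sqrrN.
have := strut_unit t1_gt0 t1_le1 t2_gt0 t2_le1 us.
move: (strutX t1 t2 u) (strutX t2 t1 _) (strutH _ _) => a b c h.
by rewrite !exprMn ![sgb R _ ^+ 2]expr2 !sgb2 !mul1r h sqrtr1.
Qed.

Lemma beta_beta_edist_ge1 w a b : 1 <= edist (beta t1 t2 w (1 / 2) a) (beta t1 t2 w (- 1 / 2) b).
Proof.
rewrite (_ : edist _ _ = enorm (vec3 (profileX t1 t2 w a - profileX t1 t2 w b) 1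
   (profileZ t1 t2 w b - profileZ t1 t2 w a))); last first.
  by congr enorm; apply: row3P; rewrite !mxE/=; field.
by rewrite enorm_vec3 -[leLHS]sqrtr1 ler_wsqrtr// expr1n -addrA addrCA lerDl addr_ge0 ?sqr_ge0.
Qed.

Lemma gamma_gamma_edist_ge1 w a b : 1 <= edist (gamma t1 t2 w (1 / 2) a) (gamma t1 t2 w (- 1 / 2) b).
Proof.
rewrite (_ : edist _ _ = enorm (vec3 1 (profileX t2 t1 w a - profileX t2 t1 w b)
   (profileZ t2 t1 w a - profileZ t2 t1 w b))); last first.
  by congr enorm; apply: row3P; rewrite !mxE/=; field.
by rewrite enorm_vec3 -[leLHS]sqrtr1 ler_wsqrtr// expr1n -addrA lerDl addr_ge0 ?sqr_ge0.
Qed.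

End Distances.
End LinkGeometry.

(** * Riemann-Stieltjes sums *)

Section RiemannStieltjesSums.
Variable R : realType.
Variables (f g : R -> 'rV[R]_3).
Implicit Types (a b c d x S : R).

(** [fine_sum d a b S] says that [S] is a Riemann-Stieltjes sum over a tagged
    partition of [a, b] of mesh less than [d].  As a relation it can be
    concatenated, which is awkward for explicit lists of points and tags. *)
Inductive fine_sum d : R -> R -> R -> Prop :=
| FineNil a : fine_sum d a a 0
| FineCons a b c x S : a < b -> b - a < d -> a <= x <= b -> fine_sum d b c S ->
    fine_sum d a c (dot (f x) (g b - g a) + S).

Lemma fine_sum_RS_sum d a b S : fine_sum d a b S ->
  exists s (tag : nat -> R), [/\ itv_partition a b s,
    forall k, (k < size s)%N -> nth 0 (a :: s) k <= tag k <= nth 0 s k /\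
       nth 0 s k - nth 0 (a :: s) k < d & RS_sum f g a s tag = S].
Proof.
elim=> {a b S} [a|a b c x S ab bad xab _ [s [tag [[ps ls] ht <-]]]].
  by exists [::], (fun=> 0); split=> //; rewrite /RS_sum big_ord0.
exists (b :: s), (fun k => if k is k'.+1 then tag k' else x); split.
- by split; rewrite /= ?ab.
- by case=> [_|k] /=; [|rewrite ltnS => /ht].
- by rewrite /RS_sum /= big_ord_recl.
Qed.

Lemma is_RS_integral_fine_sum a b l (e : R) : is_RS_integral f g a b l -> 0 < e ->
  exists2 d, 0 < d & forall S, fine_sum d a b S -> `|S - l| < e.
Proof.
move=> h e0; have [d d0 hd] := h e e0; exists d => // S /fine_sum_RS_sum[s [tag [ps ht <-]]].
exact: hd.
Qed.

Lemma fine_sum_cat d a b c S S' : fine_sum d a b S -> fine_sum d b c S' ->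
  fine_sum d a c (S + S').
Proof.
elim=> {a b S} [a|a b b' x S ab bad xab _ ih] h; first by rewrite add0r.
by rewrite -addrA; apply: (FineCons ab bad xab); exact: ih.
Qed.

Lemma fine_sum1 d a b x : a < b -> b - a < d -> a <= x <= b ->
  fine_sum d a b (dot (f x) (g b - g a)).
Proof. by move=> ab bad xab; rewrite -[dot _ _]addr0; apply: FineCons xab (FineNil _ _). Qed.

Lemma fine_sum_increasing d (p x : nat -> R) n :
  (forall k, (k < n)%N -> [/\ p k < p k.+1, p k.+1 - p k < d & p k <= x k <= p k.+1]) ->
  fine_sum d (p 0%N) (p n) (\sum_(k < n) dot (f (x k)) (g (p k.+1) - g (p k))).
Proof.
elim: n => [_|n ih h]; first by rewrite big_ord0; exact: FineNil.
rewrite big_ord_recr/=; apply: fine_sum_cat.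
  by apply: ih => k kn; apply: h; exact: ltnW.
by have [] := h n (ltnSn n); exact: fine_sum1.
Qed.

Lemma fine_sum_decreasing d (p x : nat -> R) n :
  (forall k, (k < n)%N -> [/\ p k.+1 < p k, p k - p k.+1 < d & p k.+1 <= x k <= p k]) ->
  fine_sum d (p n) (p 0%N) (\sum_(k < n) dot (f (x k)) (g (p k) - g (p k.+1))).
Proof.
elim: n => [_|n ih h]; first by rewrite big_ord0; exact: FineNil.
rewrite big_ord_recr/= addrC; have [h1 h2 h3] := h n (ltnSn n).
apply: FineCons h1 h2 h3 _.
by apply: ih => k kn; apply: h; exact: ltnW.
Qed.

Lemma mesh_exists d a : 0 < d -> 0 <= a -> exists n : nat, forall m, (n <= m)%N -> a / m.+1%:R < d.
Proof.
move=> d0 a0; exists (Num.bound (a / d)) => m hm.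
have := archi_boundP (divr_ge0 a0 (ltW d0)); set n := Num.bound _ => hn.
rewrite ltr_pdivrMr ?ltr0n// mulrC -ltr_pdivrMr//.
by apply: lt_le_trans hn _; rewrite ler_nat leqW.
Qed.

(** Any fine partition will do, as all increments of [g] vanish. *)
Lemma fine_sum_flat d a b (v : 'rV[R]_3) : 0 < d -> a <= b ->
  (forall x, a <= x <= b -> g x = v) -> fine_sum d a b 0.
Proof.
move=> d0; rewrite le_eqVlt => /predU1P[-> _|ab gv]; first exact: FineNil.
have ba0 : 0 <= b - a by rewrite subr_ge0 ltW.
have [n /(_ n (leqnn n)) hn] := mesh_exists d0 ba0.
pose p k : R := a + (b - a) * (k%:R / n.+1%:R).
have p0 : p 0%N = a by rewrite /p mul0r mulr0 addr0.
have pn : p n.+1 = b by rewrite /p divff ?pnatr_eq0// mulr1 subrKC.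
have ps k : p k.+1 - p k = (b - a) / n.+1%:R.
  have m0 : n.+1%:R != 0 :> R by rewrite pnatr_eq0.
  by rewrite /p -[k.+1%:R]natr1; move: (n.+1%:R) m0 => m m0; field.
have q0 : 0 < (b - a) / n.+1%:R by rewrite divr_gt0 ?ltr0n// subr_gt0.
have := @fine_sum_increasing d p p n.+1; rewrite p0 pn => /(_ _).
rewrite big1; last first.
  move=> k _; have pab i : (i <= n.+1)%N -> a <= p i <= b.
    move=> ni; have c0 : 0 <= (i%:R / n.+1%:R : R) <= 1.
      by rewrite divr_ge0//= ler_pdivrMr ?ltr0n// mul1r ler_nat.
    rewrite /p; have : (b - a) * (i%:R / n.+1%:R) <= b - a by rewrite ler_piMr//; case/andP: c0.
    have : 0 <= (b - a) * (i%:R / n.+1%:R) by rewrite mulr_ge0//; case/andP: c0.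
    by move: (_ * (_ / _)) => z z0 z1; lra.
  rewrite !gv ?subrr ?dot0r//; [exact/pab/ltnW|exact: pab].
apply=> k _; split; first by rewrite -subr_gt0 ps.
  by rewrite ps.
by rewrite lexx -subr_ge0 ps ltW.
Qed.

End RiemannStieltjesSums.

(** * Riemann-Stieltjes sums along a clasp curve *)

Section ClaspSums.
Variable R : realType.
Variables (f : R -> 'rV[R]_3) (e1 e2 : 'rV[R]_3) (s w hi d : R).
Hypotheses (s0 : 0 < s) (w0 : 0 <= w) (whi : w + s <= hi) (d0 : 0 < d).

Let g x := heading e1 e2 (turn s w x).

Let g_left u : 0 <= u <= s -> g (- (w + u)) = heading e1 e2 (- u).
Proof. by move=> us; rewrite /g turnN turn_clasp. Qed.

Let g_right u : 0 <= u <= s -> g (w + u) = heading e1 e2 u.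
Proof. by move=> us; rewrite /g turn_clasp. Qed.

(** The tangent turns on the two clasp parts only. *)
Lemma clasp_fine_sum (S S' : R) :
  fine_sum f g d (- (w + s)) (- w) S -> fine_sum f g d w (w + s) S' ->
  fine_sum f g d (- hi) hi (S + S').
Proof.
move=> hS hS'; have s1 := ltW s0.
have ss : 0 <= s <= s by rewrite lexx andbT.
rewrite -[S + S']addr0 -[S + S']add0r addrA.
apply: (@fine_sum_cat _ _ _ _ _ (w + s)); last first.
  apply: (@fine_sum_flat _ _ _ _ _ _ (heading e1 e2 s)) => // x /andP[x1 _].
  by rewrite /g turn_ray.
apply: fine_sum_cat hS'; rewrite -[0 + S]addr0.
apply: (@fine_sum_cat _ _ _ _ _ (- w)); last first.
  apply: (@fine_sum_flat _ _ _ _ _ _ (heading e1 e2 0)) => //.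
    by move: (w0) => *; lra.
  by move=> x xw; rewrite /g turn_flat.
apply: fine_sum_cat hS.
apply: (@fine_sum_flat _ _ _ _ _ _ (heading e1 e2 (- s))) => //.
  by rewrite lerN2.
move=> x /andP[_ x1]; rewrite /g -[x]opprK turnN turn_ray//; lra.
Qed.

(** The increment of the tangent on the half [e] over a cell on which the sine of
    its angle increases by [b], and its cosine changes by [A] in absolute
    value: it falls on the right half and rises on the left. *)
Definition turning_increment (e : bool) (A b : R) : 'rV[R]_3 :=
  (- (sgb R e * A)) *: e1 + b *: e2.

(** The grid runs outwards, as it does on [beta]; the two halves of the curve
    share grid and tags. *)
Lemma clasp_fine_sum_increasing (p x : nat -> R) n : p 0%N = 0 -> p n = s ->
  (forall k, (k < n)%N -> [/\ 0 <= p k, p k.+1 <= s, p k < p k.+1, p k.+1 - p k < d & p k <= x k <= p k.+1]) ->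
  fine_sum f g d (- hi) hi (\sum_(e : bool) \sum_(k < n)
    dot (f (sgb R e * (w + x k))) (turning_increment e (co (p k) - co (p k.+1)) (p k.+1 - p k))).
Proof.
move=> p0 pn h; rewrite big_bool -[X in fine_sum _ _ _ _ _ X]/(_ + _) addrC; apply: clasp_fine_sum.
  have := @fine_sum_decreasing _ f g d (fun k => - (w + p k)) (fun k => - (w + x k)) n.
  rewrite p0 pn addr0 => /(_ _).
  rewrite (eq_bigr (fun k : 'I_n => dot (f (sgb R false * (w + x k)))
     (turning_increment false (co (p k) - co (p k.+1)) (p k.+1 - p k)))).
    by apply=> k /h[h1 h2 h3 h4 h5]; split; lra.
  move=> k _; have [h1 h2 h3 _ _] := h k (ltn_ord k).
  rewrite !g_left; [|lra|lra].
  rewrite mulN1r; congr dot; rewrite /heading /turning_increment !coN.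
  by apply: row3P; rewrite !mxE /sgb; ring.
have := @fine_sum_increasing _ f g d (fun k => w + p k) (fun k => w + x k) n.
rewrite p0 pn addr0 => /(_ _).
rewrite (eq_bigr (fun k : 'I_n => dot (f (sgb R true * (w + x k)))
   (turning_increment true (co (p k) - co (p k.+1)) (p k.+1 - p k)))).
  by apply=> k /h[h1 h2 h3 h4 h5]; split; lra.
move=> k _; have [h1 h2 h3 _ _] := h k (ltn_ord k).
rewrite !g_right; [|lra|lra].
rewrite mul1r; congr dot; rewrite /heading /turning_increment.
by apply: row3P; rewrite !mxE /sgb; ring.
Qed.

(** The partners of a grid that runs outwards on one curve run inwards on the
    other. *)
Lemma clasp_fine_sum_decreasing (p x : nat -> R) n : p 0%N = s -> p n = 0 ->
  (forall k, (k < n)%N -> [/\ 0 <= p k.+1, p k <= s, p k.+1 < p k, p k - p k.+1 < d & p k.+1 <= x k <= p k]) ->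
  fine_sum f g d (- hi) hi (\sum_(e : bool) \sum_(k < n)
    dot (f (sgb R e * (w + x k))) (turning_increment e (co (p k.+1) - co (p k)) (p k - p k.+1))).
Proof.
move=> p0 pn h; rewrite big_bool -[X in fine_sum _ _ _ _ _ X]/(_ + _) addrC; apply: clasp_fine_sum.
  have := @fine_sum_increasing _ f g d (fun k => - (w + p k)) (fun k => - (w + x k)) n.
  rewrite p0 pn addr0 => /(_ _).
  rewrite (eq_bigr (fun k : 'I_n => dot (f (sgb R false * (w + x k)))
     (turning_increment false (co (p k.+1) - co (p k)) (p k - p k.+1)))).
    by apply=> k /h[h1 h2 h3 h4 h5]; split; lra.
  move=> k _; have [h1 h2 h3 _ _] := h k (ltn_ord k).
  rewrite !g_left; [|lra|lra].
  rewrite mulN1r; congr dot; rewrite /heading /turning_increment !coN.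
  by apply: row3P; rewrite !mxE /sgb; ring.
have := @fine_sum_decreasing _ f g d (fun k => w + p k) (fun k => w + x k) n.
rewrite p0 pn addr0 => /(_ _).
rewrite (eq_bigr (fun k : 'I_n => dot (f (sgb R true * (w + x k)))
   (turning_increment true (co (p k.+1) - co (p k)) (p k - p k.+1)))).
  by apply=> k /h[h1 h2 h3 h4 h5]; split; lra.
move=> k _; have [h1 h2 h3 _ _] := h k (ltn_ord k).
rewrite !g_right; [|lra|lra].
rewrite mul1r; congr dot; rewrite /heading /turning_increment.
by apply: row3P; rewrite !mxE /sgb; ring.
Qed.

End ClaspSums.

(** * Balance of forces on a cell of the grid *)

Section Balance.
Variable R : realType.
Implicit Types (a b u v c : R).

(** The derivative of [slope] is [co x ^- 3], which is at most [5] for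
    [x <= 3 / 4]. *)
Lemma slope_lipschitz a b : 0 <= a -> a <= b -> b <= 3 / 4 ->
  `|slope b - slope a| <= 5 * (b - a).
Proof.
move=> a0 ab b34.
have hc (x : R) : 0 <= x -> x <= 3 / 4 -> 1 / 2 <= co x.
  move=> x0 x34; rewrite -(@ler_pXn2r _ 2) ?nnegrE ?co_ge0//.
  by rewrite sqr_co ?ger0_norm//; nra.
have dc x : a < x < b -> is_derive x 1 (@slope R) ((co x + x * slope x) / co x ^+ 2).
  move=> xab; have x1 : `|x| < 1 by rewrite ger0_norm; lra.
  have h := @is_derive1_div _ id (@co R) x 1 _ (lt0r_neq0 (co_gt0 x1)) (is_derive_id x 1) (is_derive_co x1).
  by apply: is_derive_eq h _; rewrite mul1r mulrN opprK.
have cs : {within `[a, b], continuous (@slope R)}.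
  apply: continuous_in_subspaceT => x; rewrite inE/= in_itv/= => xab.
  by apply: continuous_slope; rewrite ger0_norm; lra.
have h1 : slope a <= slope b.
  have h x : a < x < b -> is_derive x 1 (@slope R) ((co x + x * slope x) / co x ^+ 2) /\
      0 <= (co x + x * slope x) / co x ^+ 2.
    move=> xab; split; first exact: dc.
    by rewrite divr_ge0 ?sqr_ge0// addr_ge0 ?co_ge0// /slope !mulr_ge0 ?invr_ge0 ?co_ge0//; lra.
  exact: MVT_le ab h cs.
have h2 : 5 * a - slope a <= 5 * b - slope b.
  have h x : a < x < b -> is_derive x 1 (fun x => 5 * x - slope x)
      (5 - (co x + x * slope x) / co x ^+ 2) /\ 0 <= 5 - (co x + x * slope x) / co x ^+ 2.
    move=> xab; split.
      have h := is_deriveB (is_derive1_mul (is_derive_cst (5 : R) x 1) (is_derive_id x 1)) (dc x xab).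
      by apply: is_derive_eq h _; rewrite /cst mul0r add0r mulr1.
    have c0 : 1 / 2 <= co x by apply: hc; lra.
    have cp : 0 < co x by lra.
    have ec : co x ^+ 2 = 1 - x ^+ 2 by rewrite sqr_co// ger0_norm; lra.
    rewrite subr_ge0 ler_pdivrMr ?exprn_gt0// -(@ler_pM2r _ (co x))//.
    rewrite mulrDl /slope -(mulrA x) divfK ?gt_eqF// -!expr2 ec.
    have : (1 - x ^+ 2) * (1 / 2) <= (1 - x ^+ 2) * co x.
      by rewrite ler_wpM2l// -ec sqr_ge0.
    by move: (co x) => c; nra.
  apply: (MVT_le ab h); apply: within_continuousB => //; apply: continuous_subspaceT => x.
  by apply: cvgM; [exact: cvg_cst|exact: cvg_id].
by rewrite ger0_norm ?subr_ge0//; lra.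
Qed.

Lemma co_MVT a b : 0 <= a -> a < b -> b <= 1 ->
  exists2 c, a < c < b & co a - co b = slope c * (b - a).
Proof.
move=> a0 ab b1.
have [|c] := @MVT R (@co R) (fun x => - slope x) a b ab _ (continuous_subspaceT (@continuous_co R)).
  by move=> x; rewrite in_itv/= => xab; apply: is_derive_co; rewrite ger0_norm; lra.
rewrite in_itv/= => cab e; exists c => //; lra.
Qed.

(** Only one of the two curves can be close to its outer end: if [u >= s / 2]
    then [v <= t / 2], and otherwise [u' <= 3 / 4].  The mean value theorem for
    [co] on that curve gives the tag, and [slope] is Lipschitz on the other. *)
Lemma strut_tag s t u u' : 0 < s -> s <= 1 -> 0 < t -> t <= 1 ->
  0 <= u -> u < u' -> u' <= s -> u' - u <= s / 4 ->
  let v := partner s t u in let v' := partner s t u' in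
  exists2 c, u < c < u' &
   `|slope c * (u' - u) - (co u - co u')| <= 5 * (u' - u) ^+ 2 /\
   `|slope (partner s t c) * (v - v') - (co v' - co v)| <= 5 * (v - v') ^+ 2.
Proof.
move=> s0 s1 t0 t1 u0 uu us du v v'.
have v'v : v' < v := partner_lt s0 t0 uu.
have /andP[v'0 _] : 0 <= v' <= t by apply: partner_itv => //; lra.
have /andP[_ vt] : 0 <= v <= t by apply: partner_itv => //; lra.
have lip a a' c c' : 0 <= a -> a' <= 3 / 4 -> a < c < a' -> a < c' < a' ->
    `|slope c * (a' - a) - slope c' * (a' - a)| <= 5 * (a' - a) ^+ 2.
  move=> a0 a34 ca ca'; rewrite -mulrBl normrM [`|a' - a|]ger0_norm; last by lra.
  rewrite expr2 mulrA ler_wpM2r//; first by lra.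
  have [cc|cc] := leP c c'.
    by rewrite distrC (le_trans (slope_lipschitz _ cc _))//; lra.
  by rewrite (le_trans (slope_lipschitz _ (ltW cc) _))//; lra.
have [us2|us2] := leP (s / 2) u.
  have [c cu ec] := co_MVT u0 uu (le_trans us s1).
  have [c' cv' ec'] := co_MVT v'0 v'v (le_trans vt t1).
  exists c => //; rewrite ec subrr normr0 ec'; split; first by rewrite mulr_ge0// sqr_ge0.
  apply: lip => //.
    have : v <= partner s t (s / 2) := partner_le s0 t0 us2.
    rewrite (_ : partner s t (s / 2) = t / 2); first by lra.
    by rewrite /partner; field; rewrite gt_eqF.
  by case/andP: cu => cu1 cu2; rewrite /v /v' !partner_lt.
have [c cu ec] := co_MVT u0 uu (le_trans us s1).
have [c' cv' ec'] := co_MVT v'0 v'v (le_trans vt t1).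
exists (partner t s c').
  have := partner_lt t0 s0 (proj1 (andP cv')); have := partner_lt t0 s0 (proj2 (andP cv')).
  by rewrite /v /v' !partnerK// => -> ->.
rewrite partnerK// ec ec' subrr normr0; split; last by rewrite mulr_ge0// sqr_ge0.
apply: lip => //; first by lra.
have := partner_lt t0 s0 (proj1 (andP cv')); have := partner_lt t0 s0 (proj2 (andP cv')).
by rewrite /v /v' !partnerK// => -> ->.
Qed.

(** The claimed sum is, up to the errors [al] and [be], a combination of the
    strut inequalities with nonnegative coefficients: [a / H] for each of the
    four struts between [beta] and [gamma] arcs, [q a] for each of the two
    between [beta_+] and [beta_-], and [p a] for each of the two between
    [gamma_+] and [gamma_-].  The total
    coefficient is bounded by means of [1 / H <= 1 + p + q]. *)
Lemma balance_step (x y : bool -> bool -> 'rV[R]_3) (M eps a A B p q H al be : R) :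
  0 <= a -> 0 < H -> 0 <= p -> 0 <= q -> 0 <= eps ->
  `|p * a - A| <= al -> `|q * a - B| <= be -> H^-1 <= 1 + p + q ->
  (forall e1 e2 k, `|x e1 e2 0 k| <= M) -> (forall e1 e2 k, `|y e1 e2 0 k| <= M) ->
  (forall e1 e2, - eps <= dot (x e2 e1 - y e1 e2)
     (vec3 (sgb R e1 * (p * H)) (- (sgb R e2 * (q * H))) H)) ->
  (forall e1, - eps <= (x true e1 - x false e1) 0 1) ->
  (forall e2, - eps <= (y true e2 - y false e2) 0 0) ->
  \sum_(e1 : bool) \sum_(e2 : bool)
    (dot (x e2 e1) (vec3 (- (sgb R e1 * A)) 0 (- a)) + dot (y e1 e2) (vec3 0 (- (sgb R e2 * B)) a))
  <= eps * (4 * a + 6 * (A + B + al + be)) + 4 * M * (al + be).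
Proof.
move=> a0 H0 p0 q0 eps0 hA hB hH xM yM hs hx hy.
have hs' e1 e2 : 0 <= a * (dot (x e2 e1 - y e1 e2) (vec3 (sgb R e1 * p) (- (sgb R e2 * q)) 1) + eps * (1 + p + q)).
  rewrite mulr_ge0//; have := hs e1 e2.
  have -> : vec3 (sgb R e1 * (p * H)) (- (sgb R e2 * (q * H))) H =
      H *: vec3 (sgb R e1 * p) (- (sgb R e2 * q)) 1.
    by apply: row3P; rewrite !mxE/=; ring.
  rewrite dotZr; set D := dot _ _ => hD.
  have : eps * H^-1 <= eps * (1 + p + q) by rewrite ler_wpM2l.
  have : - eps / H <= D by rewrite ler_pdivrMr// mulrC.
  by lra.
have hx' e1 : 0 <= q * a * ((x true e1 - x false e1) 0 1 + eps).
  by rewrite mulr_ge0 ?mulr_ge0//; have := hx e1; lra.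
have hy' e2 : 0 <= p * a * ((y true e2 - y false e2) 0 0 + eps).
  by rewrite mulr_ge0 ?mulr_ge0//; have := hy e2; lra.
have M0 : 0 <= M by apply: le_trans (xM true true 0).
have xe e1 e2 : - (M * al) <= x e1 e2 0 0 * (p * a - A) <= M * al.
  by rewrite -ler_norml normrM ler_pM.
have ye e1 e2 : - (M * be) <= y e1 e2 0 1 * (q * a - B) <= M * be.
  by rewrite -ler_norml normrM ler_pM.
have hA' : p * a <= A + al by move: hA; rewrite ler_norml; lra.
have hB' : q * a <= B + be by move: hB; rewrite ler_norml; lra.
have hA2 : eps * (p * a) <= eps * (A + al) by rewrite ler_wpM2l.
have hB2 : eps * (q * a) <= eps * (B + be) by rewrite ler_wpM2l.
rewrite !big_bool/= !dotE !vec3E.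
have s1 := hs' true true; have s2 := hs' true false; have s3 := hs' false true; have s4 := hs' false false.
have x1 := hx' true; have x2 := hx' false; have y1 := hy' true; have y2 := hy' false.
have xe1 := xe true true; have xe2 := xe true false; have xe3 := xe false true; have xe4 := xe false false.
have ye1 := ye true true; have ye2 := ye true false; have ye3 := ye false true; have ye4 := ye false false.
rewrite !dotE !vec3E !mxE /sgb in s1 s2 s3 s4 x1 x2 y1 y2.
rewrite /sgb.
clear hs hx hy hs' hx' hy' xe ye xM yM hA hB hA' hB' hH.
lra.
Qed.

End Balance.

Section GridBalance.
Variable R : realType.

(** The main terms of [balance_step] telescope, since [A] and [B] are
    increments of [co]; the [n] errors are of order [n ^- 2] each. *)
Lemma grid_balance (s t eps M : R) (x y : bool -> bool -> R -> 'rV[R]_3) (n : nat) :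
  0 < s -> s <= 1 -> 0 < t -> t <= 1 -> s <= t -> t <= 2 * s -> 0 <= eps ->
  (4 <= n)%N ->
  (forall e1 e2 k u, 0 <= u <= s -> `|x e2 e1 u 0 k| <= M) ->
  (forall e1 e2 k u, 0 <= u <= s -> `|y e1 e2 (partner s t u) 0 k| <= M) ->
  (forall e1 e2 u, 0 <= u <= s ->
     - eps <= dot (x e2 e1 u - y e1 e2 (partner s t u))
       (vec3 (sgb R e1 * strutX s t u) (- (sgb R e2 * strutX t s (partner s t u)))
         (strutH u (partner s t u)))) ->
  (forall e1 u, 0 <= u <= s -> - eps <= (x true e1 u - x false e1 u) 0 1) ->
  (forall e2 u, 0 <= u <= s ->
     - eps <= (y true e2 (partner s t u) - y false e2 (partner s t u)) 0 0) ->
  let p k : R := s * (k%:R / n%:R) in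
  let v k := partner s t (p k) in
  exists2 tag : nat -> R, (forall k, (k < n)%N -> p k < tag k < p k.+1) &
   \sum_(e1 : bool) \sum_(e2 : bool)
    (\sum_(k < n) dot (x e2 e1 (tag k))
        (vec3 (- (sgb R e1 * (co (p k) - co (p k.+1)))) 0 (- (s / n%:R)))
     + \sum_(k < n) dot (y e1 e2 (partner s t (tag k)))
        (vec3 0 (- (sgb R e2 * (s / t * (co (v k.+1) - co (v k))))) (s / n%:R)))
   <= 16 * eps + (90 * eps + 60 * M) / n%:R.
Proof.
move=> s0 s1 t0 t1 st ts eps0 n4 xM yM hs hx hy p v.
have n0 : 0 < n%:R :> R by rewrite ltr0n (leq_trans _ n4).
have M0 : 0 <= M.
  by apply: le_trans (normr_ge0 _) (xM true true 0 0 _); rewrite lexx ltW.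
set a := s / n%:R.
have a0 : 0 < a by rewrite divr_gt0.
have pS k : p k.+1 - p k = a.
  by rewrite /p /a -[k.+1%:R]natr1; move: (n%:R) n0 => m m0; field; rewrite gt_eqF.
have p0 : p 0%N = 0 by rewrite /p mul0r mulr0.
have pn : p n = s by rewrite /p divff ?gt_eqF// mulr1.
have pk k : 0 <= p k by rewrite /p mulr_ge0 ?divr_ge0//; exact: ltW.
have pks k : (k <= n)%N -> p k <= s.
  by move=> kn; rewrite /p ler_piMr ?(ltW s0)// ler_pdivrMr// mul1r ler_nat.
have a4 : a <= s / 4.
  by rewrite /a ler_pM2l// lef_pV2 ?posrE// ler_nat.
have vS k : v k - v k.+1 = t / s * a.
  have := pS k; rewrite /v /partner => <-; field; rewrite gt_eqF//.
have ts2 : t / s <= 2 by rewrite ler_pdivrMr.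
have ts0 : 0 < t / s by rewrite divr_gt0.
have st0 : 0 < s / t by rewrite divr_gt0.
have st1 : s / t <= 1 by rewrite ler_pdivrMr// mul1r.
have stts : s / t * (t / s) = 1 by field; rewrite !gt_eqF.
have tags k : exists c, (k < n)%N -> p k < c < p k.+1 /\
   `|slope c * a - (co (p k) - co (p k.+1))| <= 5 * a ^+ 2 /\
   `|slope (partner s t c) * a - s / t * (co (v k.+1) - co (v k))| <= 10 * a ^+ 2.
  have [kn|kn] := ltnP k n; last by exists 0.
  have h1 : p k < p k.+1 by rewrite -subr_gt0 pS.
  have h2 : p k.+1 - p k <= s / 4 by rewrite pS.
  have [c cp []] := strut_tag s0 s1 t0 t1 (pk k) h1 (pks _ kn) h2.
  rewrite -/(v k) -/(v k.+1) pS vS => hA hB; exists c => _; split=> //; split=> //.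
  rewrite (_ : slope _ * a = s / t * (slope (partner s t c) * (t / s * a))); last first.
    rewrite (_ : _ * (_ * _) = s / t * (t / s) * (slope (partner s t c) * a)); last by ring.
    by rewrite stts mul1r.
  rewrite -mulrBr normrM [`|s / t|]gtr0_norm//.
  have : s / t * `|slope (partner s t c) * (t / s * a) - (co (v k.+1) - co (v k))| <=
    s / t * (5 * (t / s * a) ^+ 2) by rewrite ler_pM2l.
  move=> /le_trans; apply.
  have -> : s / t * (5 * (t / s * a) ^+ 2) = (s / t * (t / s)) * (5 * (t / s) * a ^+ 2) by ring.
  by rewrite stts mul1r ler_wpM2r ?sqr_ge0//; lra.
have [tag htag] := choice tags.
exists tag; first by move=> k /htag[].
rewrite (_ : \sum_(e1 : bool) _ = \sum_(k < n) \sum_(e1 : bool) \sum_(e2 : bool)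
  (dot (x e2 e1 (tag k)) (vec3 (- (sgb R e1 * (co (p k) - co (p k.+1)))) 0 (- a))
   + dot (y e1 e2 (partner s t (tag k)))
        (vec3 0 (- (sgb R e2 * (s / t * (co (v k.+1) - co (v k))))) a))); last first.
  rewrite [RHS]exchange_big/=; apply: eq_bigr => e1 _.
  rewrite [RHS]exchange_big/=; apply: eq_bigr => e2 _.
  by rewrite big_split.
pose F k := eps * (4 * a + 6 * ((co (p k) - co (p k.+1)) + s / t * (co (v k.+1) - co (v k)) + 5 * a ^+ 2 + 10 * a ^+ 2))
   + 4 * M * (5 * a ^+ 2 + 10 * a ^+ 2).
apply: (@le_trans _ _ (\sum_(k < n) F k)).
  apply: ler_sum => k _; have [/andP[ct1 ct2] [hA hB]] := htag k (ltn_ord k).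
  have cs : 0 < tag k < s by have := pk k; have := pks _ (ltn_ord k); lra.
  have cs' : 0 <= tag k <= s by lra.
  have [H0 eX eY hH] := strutH_slope s0 s1 t0 t1 cs.
  have vt := partner_itvoo s0 t0 cs.
  apply: (@balance_step _ (fun e2 e1 => x e2 e1 (tag k)) (fun e1 e2 => y e1 e2 (partner s t (tag k))) M eps a
     (co (p k) - co (p k.+1)) (s / t * (co (v k.+1) - co (v k))) (slope (tag k)) (slope (partner s t (tag k)))
     (strutH (tag k) (partner s t (tag k))) (5 * a ^+ 2) (10 * a ^+ 2)) => //.
  - exact: ltW.
  - by rewrite /slope divr_ge0 ?co_ge0//; lra.
  - by rewrite /slope divr_ge0 ?co_ge0//; lra.
  - by move=> e1 e2 k'; exact: xM.
  - by move=> e1 e2 k'; exact: yM.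
  - by move=> e1 e2; have := hs e1 e2 _ cs'; rewrite -eX -eY.
  - by move=> e1; exact: hx.
  - by move=> e2; exact: hy.
have -> : \sum_(k < n) F k = eps * (4 * s + 6 * ((co 0 - co s) + s / t * (co 0 - co t)))
    + (90 * eps + 60 * M) * (a * s).
  transitivity (\sum_(k < n) ((4 * eps * a + (90 * eps + 60 * M) * a ^+ 2)
     + (6 * eps * (s / t) * (co (v k.+1) - co (v k)) - 6 * eps * (co (p k.+1) - co (p k))))).
    by apply: eq_bigr => k _; rewrite /F; ring.
  rewrite big_split/= sumr_const card_ord sumrB -!mulr_sumr.
  have tel (f : nat -> R) : \sum_(k < n) (f k.+1 - f k) = f n - f 0%N.
    by rewrite -(big_mkord xpredT (fun k => f k.+1 - f k)) telescope_sumr.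
  rewrite (tel (fun k => co (v k))) (tel (fun k => co (p k))) /v pn p0 partner_end// partner0.
  have -> : (4 * eps * a + (90 * eps + 60 * M) * a ^+ 2) *+ n
     = 4 * eps * s + (90 * eps + 60 * M) * (a * s).
    by rewrite -[LHS]mulr_natr /a; field; rewrite gt_eqF.
  by ring.
rewrite co0; apply: lerD.
  rewrite (_ : 16 * eps = eps * 16); last by ring.
  rewrite ler_wpM2l//; have c1 := co_ge0 s; have c2 := co_ge0 t.
  have : s / t * (1 - co t) <= 1 * 1.
    by rewrite ler_pM ?(ltW st0)// ?subr_ge0 ?co_le1// gerBl.
  by lra.
rewrite ler_wpM2l//; first by rewrite addr_ge0// mulr_ge0.
rewrite /a mulrAC ler_pdivrMr// mulVf ?gt_eqF// -[leRHS]mulr1 ler_pM// ltW//.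
Qed.

End GridBalance.

(** * First variation of the length of the links *)

Section Links.
Variable R : realType.

Lemma within_row_bounded (f : R -> 'rV[R]_3) (a b : R) : a <= b ->
  {within `[a, b], continuous f} ->
  exists M : R, forall x k, a <= x <= b -> `|f x 0 k| <= M.
Proof.
move=> ab cf.
have ck (k : 'I_3) : {within `[a, b], continuous (fun x => `|f x 0 k|)}.
  apply: (@within_continuous_comp _ _ _ _ f (fun v : 'rV[R]_3 => `|v 0 k|)) => // v _.
  apply: (@continuous_comp _ _ _ (fun v : 'rV[R]_3 => v 0 k) (fun r : R => `|r|)).
    exact: coord_continuous.
  exact: norm_continuous.
have /choice[M hM] (k : 'I_3) : exists M : R, forall x, a <= x <= b -> `|f x 0 k| <= M.
  have [c cab hc] := EVT_max ab (ck k).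
  by exists `|f c 0 k| => x xab; apply: hc; rewrite in_itv.
exists (\sum_k `|M k|) => x k xab; apply: le_trans (hM k x xab) _.
rewrite (bigD1 k)//=; apply: le_trans (ler_norm _) _.
by rewrite lerDl sumr_ge0.
Qed.

Lemma turning_increment_beta (e : bool) (A b : R) :
  turning_increment (vec3 1 0 0) (vec3 0 0 (-1)) e A b = vec3 (- (sgb R e * A)) 0 (- b).
Proof. by apply: row3P; rewrite !mxE/=; ring. Qed.

Lemma turning_increment_gamma (e : bool) (A b : R) :
  turning_increment (vec3 0 1 0) (vec3 0 0 1) e A b = vec3 0 (- (sgb R e * A)) b.
Proof. by apply: row3P; rewrite !mxE/=; ring. Qed.

(** Common to both configurations: [b] and [c] enumerate the [beta] and the
    [gamma] arcs, and [c] is constant when there is only one [gamma].  The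
    factor [t1 / t2] makes up for counting that arc twice. *)
Lemma clasp_links_critical (L : glink R) (b c : bool -> comp L)
    (t1 t2 w c1 c2 hb hc : R) :
  0 < t1 -> t1 <= 1 -> 0 < t2 -> t2 <= 1 -> t1 <= t2 -> t2 <= 2 * t1 -> 0 <= w ->
  w + t1 <= hb -> 1 / 2 + t2 <= hc ->
  (forall e, [/\ curve (b e) =1 beta t1 t2 w (sgb R e * (1 / 2)),
     lo (b e) = - hb, hi (b e) = hb & is_arc (b e)]) ->
  (forall e, [/\ curve (c e) =1 gamma t1 t2 (1 / 2) (sgb R e * w),
     lo (c e) = - hc, hi (c e) = hc & is_arc (c e)]) ->
  (forall e e', anchor (b e) e' = plane (beta_normal t1 e') c1 /\
      anchor (b e) e' (curve (b e) (param_end (b e) e'))) ->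
  (forall e e', anchor (c e) e' = plane (gamma_normal t2 e') c2 /\
      anchor (c e) e' (curve (c e) (param_end (c e) e'))) ->
  (forall e e', b e != c e') -> b true != b false ->
  c true = c false \/ (c true != c false /\ w = 1 / 2) ->
  GThi L = 1%:E ->
  (forall dd : comp L -> R,
     \sum_i dd i = \sum_(e : bool) dd (b e) + t1 / t2 * \sum_(e : bool) dd (c e)) ->
  exists2 eps : R, 0 < eps & forall xi,
    compatible xi -> @is_length_variation _ L xi (-1) ->
    (Order.min (GThi_variation xi) (obstacle_variation xi) <= (- eps)%:E)%E.
Proof.
move=> t10 t11 t20 t21 t12 t212 w0 whb whc hB hC aB aC bc bb cc thi hsum.
(* The total force is at most 16.  The Riemann sums of the four arcs are within
   1 / 20 of their limits and the balance within 1 / 10, which leaves room for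
   eps with 16 * eps + 1 / 10 + 4 / 20 < 1. *)
pose eps : R := 1 / 100; have eps0 : 0 < eps by rewrite divr_gt0.
exists eps => // xi [cxi bxi] [dd hdd sdd].
rewrite leNgt lt_min; apply/negP => /andP[hvar _].
have [k11 k22 k12 [m11 m22 m12]] := vec3_orthonormal R.
have TB e : tangent (b e) = (fun x => heading (vec3 1 0 0) (vec3 0 0 (-1)) (turn t1 w x)).
  apply/funext => x; have [cu lo_ hi_ _] := hB e.
  apply: (@tangent_planar _ (vec3 0 (sgb R e * (1 / 2)) (clasp_height t1 t2)) _ _ _ t2) => //.
  by move=> z; rewrite cu betaE.
have TC e : tangent (c e) = (fun x => heading (vec3 0 1 0) (vec3 0 0 1) (turn t2 (1 / 2) x)).
  apply/funext => x; have [cu lo_ hi_ _] := hC e.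
  apply: (@tangent_planar _ (vec3 (sgb R e * w) 0 0) _ _ _ t1) => //.
  by move=> z; rewrite cu gammaE.
have endpt (i : comp L) e' (n : 'rV[R]_3) k : is_arc i -> anchor i e' = plane n k ->
    anchor i e' (curve i (param_end i e')) -> dot n (xi i (param_end i e')) = 0.
  move=> ai an hn; have := bxi i; rewrite ai => /(_ e').
  by rewrite /affine_tangent; move: hn; rewrite an /plane/= dotDr => ->; lra.
have RB e : is_RS_integral (xi (b e)) (tangent (b e)) (- hb) hb (- dd (b e)).
  have [cu lo_ hi_ ar] := hB e; have [l] := hdd (b e); rewrite lo_ hi_ => hl ->.
  have z e' : dot (tangent (b e) (param_end (b e) e')) (xi (b e) (param_end (b e) e')) = 0.
    have [an hn] := aB e e'; have := endpt _ _ _ _ ar an hn.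
    have -> : tangent (b e) (param_end (b e) e') = sgb R e' *: beta_normal t1 e'.
      rewrite TB /param_end hi_ lo_; case: e' {an hn} => /=; rewrite ?turnN turn_ray//.
        by apply: row3P; rewrite !mxE/= -?coE; ring.
      by apply: row3P; rewrite !mxE/= ?coN -?coE; ring.
    by rewrite dotZl => ->; rewrite mulr0.
  have zt := z true; have zf := z false; rewrite /param_end hi_ in zt; rewrite /param_end lo_ in zf.
  by rewrite zt zf subrr sub0r opprK.
have RC e : is_RS_integral (xi (c e)) (tangent (c e)) (- hc) hc (- dd (c e)).
  have [cu lo_ hi_ ar] := hC e; have [l] := hdd (c e); rewrite lo_ hi_ => hl ->.
  have z e' : dot (tangent (c e) (param_end (c e) e')) (xi (c e) (param_end (c e) e')) = 0.
    have [an hn] := aC e e'; have := endpt _ _ _ _ ar an hn.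
    have -> : tangent (c e) (param_end (c e) e') = sgb R e' *: gamma_normal t2 e'.
      rewrite TC /param_end hi_ lo_; case: e' {an hn} => /=; rewrite ?turnN turn_ray//.
        by apply: row3P; rewrite !mxE/= -?coE; ring.
      by apply: row3P; rewrite !mxE/= ?coN -?coE; ring.
    by rewrite dotZl => ->; rewrite mulr0.
  have zt := z true; have zf := z false; rewrite /param_end hi_ in zt; rewrite /param_end lo_ in zf.
  by rewrite zt zf subrr sub0r opprK.
have /choice[Mi hMi] i : exists M : R, forall x k, dom i x -> `|xi i x 0 k| <= M.
  have [lh|lh] := leP (lo i) (hi i).
    have [M hM] := within_row_bounded lh (cxi i).
    by exists M => x k; rewrite /dom/= in_itv/=; exact: hM.
  by exists 0 => x k; rewrite /dom/= in_itv/= => /andP[h1 h2]; have := le_trans h1 h2; rewrite leNgt lh.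
pose M := \sum_i `|Mi i|.
have hM i x k : dom i x -> `|xi i x 0 k| <= M.
  move=> ix; apply: le_trans (hMi i x k ix) _; rewrite /M (bigD1 i)//=.
  by apply: le_trans (ler_norm _) _; rewrite lerDl sumr_ge0.
have M0 : 0 <= M by rewrite sumr_ge0.
have hstrut i x i' x' : gehring_strut i x i' x' ->
    - eps <= dot (xi i x - xi i' x') (direction (curve i' x') (curve i x)).
  move=> hs; have := lt_le_trans hvar (ereal_inf_lbound (ex_intro _ i (ex_intro _ x (ex_intro _ i' (ex_intro _ x' (conj hs erefl)))))).
  by rewrite lte_fin => /ltW.
have domB e e1 u : 0 <= u <= t1 -> dom (b e) (sgb R e1 * (w + u)).
  have [_ lo_ hi_ _] := hB e; move=> us; rewrite /dom/= in_itv/= lo_ hi_.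
  by case: e1; rewrite /sgb; lra.
have domC e e1 u : 0 <= u <= t2 -> dom (c e) (sgb R e1 * (1 / 2 + u)).
  have [_ lo_ hi_ _] := hC e; move=> us; rewrite /dom/= in_itv/= lo_ hi_.
  by case: e1; rewrite /sgb; lra.
have eq20 : 0 < 1 / 20 :> R by rewrite divr_gt0.
have /choice[db hdb] e : exists d : R, 0 < d /\ forall S,
    fine_sum (xi (b e)) (tangent (b e)) d (- hb) hb S -> `|S + dd (b e)| < 1 / 20.
  have [d d0 hd] := is_RS_integral_fine_sum (RB e) eq20.
  by exists d; split=> // S /hd; rewrite opprK.
have /choice[dc hdc] e : exists d : R, 0 < d /\ forall S,
    fine_sum (xi (c e)) (tangent (c e)) d (- hc) hc S -> `|S + dd (c e)| < 1 / 20.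
  have [d d0 hd] := is_RS_integral_fine_sum (RC e) eq20.
  by exists d; split=> // S /hd; rewrite opprK.
pose D := Num.min (Num.min (db true) (db false)) (Num.min (dc true) (dc false)).
have D0 : 0 < D by rewrite !lt_min (hdb true).1 (hdb false).1 (hdc true).1 (hdc false).1.
have [n1 hn1] := mesh_exists D0 (ltW t20).
have q0 : 0 <= 90 * eps + 60 * M by rewrite addr_ge0 ?mulr_ge0// ltW.
have eq10 : 0 < 1 / 10 :> R by rewrite divr_gt0.
have [n2 hn2] := mesh_exists eq10 q0.
pose n := (maxn (maxn n1 n2) 4).+1.
have nn1 : t2 / n%:R < D by apply: hn1; rewrite leq_max leq_maxl.
have nn2 : (90 * eps + 60 * M) / n%:R < 1 / 10 by apply: hn2; rewrite leq_max leq_maxr.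
have n4 : (4 <= n)%N by rewrite leqW// leq_maxr.
have ngt0 : 0 < n%:R :> R by rewrite ltr0n.
pose x e2 e1 u := xi (b e2) (sgb R e1 * (w + u)).
pose y e1 e2 v := xi (c e1) (sgb R e2 * (1 / 2 + v)).
have [|||||tag htag] := @grid_balance _ t1 t2 eps M x y n t10 t11 t20 t21 t12 t212 (ltW eps0) n4.
- by move=> e1 e2 k u us; apply: hM; exact: domB.
- by move=> e1 e2 k u us; apply: hM; apply: domC; exact: partner_itv.
- move=> e1 e2 u us; have vt := partner_itv t10 t20 us.
  have [cb _ _ _] := hB e2; have [cc' _ _ _] := hC e1.
  have w20 : 0 <= 1 / 2 :> R by rewrite divr_ge0.
  have ed := strut_edist t10 t11 t20 t21 w0 w20 e1 e2 us.
  have := hstrut (b e2) (sgb R e1 * (w + u)) (c e1) (sgb R e2 * (1 / 2 + partner t1 t2 u)).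
  rewrite /direction cb cc' -/(edist _ _) ed invr1 scale1r strut_vector//; apply.
  split; [exact: bc|exact: domB|exact: domC|].
  by rewrite cb cc' ed thi.
- move=> e1 u us; have [cb _ _ _] := hB true; have [cb' _ _ _] := hB false.
  have e : beta t1 t2 w (sgb R true * (1 / 2)) (sgb R e1 * (w + u))
     - beta t1 t2 w (sgb R false * (1 / 2)) (sgb R e1 * (w + u)) = vec3 0 1 0.
    by apply: row3P; rewrite !mxE/=; field.
  have ed : enorm (vec3 0 1 0 : 'rV[R]_3) = 1.
    by rewrite enorm_vec3 expr0n expr1n/= add0r addr0 sqrtr1.
  have := hstrut (b true) (sgb R e1 * (w + u)) (b false) (sgb R e1 * (w + u)).
  rewrite /direction cb cb' e ed invr1 scale1r.
  have -> : dot (xi (b true) (sgb R e1 * (w + u)) - xi (b false) (sgb R e1 * (w + u))) (vec3 0 1 0)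
     = (x true e1 u - x false e1 u) 0 1.
    by rewrite dotE !vec3E mulr0 mulr0 mulr1 add0r addr0.
  apply; split; [exact: bb|exact: domB|exact: domB|].
  by rewrite cb cb' /edist e ed thi.
- move=> e2 u us; have vt := partner_itv t10 t20 us.
  have [ce|[cne w12]] := cc.
    by rewrite /y ce subrr mxE oppr_le0 ltW.
  have [cb _ _ _] := hC true; have [cb' _ _ _] := hC false.
  set v := partner t1 t2 u in vt *.
  have e : gamma t1 t2 (1 / 2) (sgb R true * w) (sgb R e2 * (1 / 2 + v))
     - gamma t1 t2 (1 / 2) (sgb R false * w) (sgb R e2 * (1 / 2 + v)) = vec3 1 0 0.
    by rewrite w12; apply: row3P; rewrite !mxE/=; field.
  have ed : enorm (vec3 1 0 0 : 'rV[R]_3) = 1.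
    by rewrite enorm_vec3 expr0n expr1n/= !addr0 sqrtr1.
  have := hstrut (c true) (sgb R e2 * (1 / 2 + v)) (c false) (sgb R e2 * (1 / 2 + v)).
  rewrite /direction cb cb' e ed invr1 scale1r.
  have -> : dot (xi (c true) (sgb R e2 * (1 / 2 + v)) - xi (c false) (sgb R e2 * (1 / 2 + v))) (vec3 1 0 0)
     = (y true e2 v - y false e2 v) 0 0.
    by rewrite dotE !vec3E mulr0 mulr0 mulr1 !addr0.
  apply; split; [exact: cne|exact: domC|exact: domC|].
  by rewrite cb cb' /edist e ed thi.
set p := fun k : nat => t1 * (k%:R / n%:R).
set v := fun k => partner t1 t2 (p k).
have pS k : p k.+1 - p k = t1 / n%:R.
  by rewrite /p -[k.+1%:R]natr1; move: (n%:R) ngt0 => m m0; field; rewrite gt_eqF.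
have pk k : 0 <= p k by rewrite /p mulr_ge0 ?divr_ge0//; exact: ltW.
have pks k : (k <= n)%N -> p k <= t1.
  by move=> kn; rewrite /p ler_piMr ?(ltW t10)// ler_pdivrMr// mul1r ler_nat.
have vS k : v k - v k.+1 = t2 / n%:R.
  rewrite /v /partner /p -[k.+1%:R]natr1; move: (n%:R) ngt0 => m m0; field.
  by rewrite !gt_eqF.
have t1n : t1 / n%:R <= t2 / n%:R by rewrite ler_pM2r ?invr_gt0.
have a1 : 0 < t1 / n%:R by rewrite divr_gt0.
have a2 : 0 < t2 / n%:R by rewrite divr_gt0.
have Ddb e : D <= db e by case: e; rewrite /D !ge_min lexx ?orbT.
have Ddc e : D <= dc e by case: e; rewrite /D !ge_min lexx ?orbT.
move=> bal.
have SB e2 : `|\sum_(e1 : bool) \sum_(k < n) dot (x e2 e1 (tag k))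
        (vec3 (- (sgb R e1 * (co (p k) - co (p k.+1)))) 0 (- (t1 / n%:R))) + dd (b e2)| < 1 / 20.
  apply: (hdb e2).2; rewrite TB.
  have -> : \sum_(e1 : bool) \sum_(k < n) dot (x e2 e1 (tag k))
        (vec3 (- (sgb R e1 * (co (p k) - co (p k.+1)))) 0 (- (t1 / n%:R))) =
     \sum_(e1 : bool) \sum_(k < n) dot (xi (b e2) (sgb R e1 * (w + tag k)))
      (turning_increment (vec3 1 0 0) (vec3 0 0 (-1)) e1 (co (p k) - co (p k.+1)) (p k.+1 - p k)).
    by apply: eq_bigr => e1 _; apply: eq_bigr => k _; rewrite pS turning_increment_beta.
  apply: clasp_fine_sum_increasing => //; first exact: (hdb e2).1.
  - by rewrite /p mul0r mulr0.
  - by rewrite /p divff ?gt_eqF// mulr1.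
  - move=> k kn; have := htag k kn; rewrite -/(p k) -/(p k.+1) => tk.
    case/andP: tk => tk1 tk2; split; [exact: pk|exact: pks|by rewrite -subr_gt0 pS| |by rewrite !ltW].
    by rewrite pS (le_lt_trans t1n)// (lt_le_trans nn1).
have SC e1 : `|\sum_(e2 : bool) \sum_(k < n) dot (y e1 e2 (partner t1 t2 (tag k)))
        (vec3 0 (- (sgb R e2 * (co (v k.+1) - co (v k)))) (t2 / n%:R)) + dd (c e1)| < 1 / 20.
  apply: (hdc e1).2; rewrite TC.
  have -> : \sum_(e2 : bool) \sum_(k < n) dot (y e1 e2 (partner t1 t2 (tag k)))
        (vec3 0 (- (sgb R e2 * (co (v k.+1) - co (v k)))) (t2 / n%:R)) =
     \sum_(e2 : bool) \sum_(k < n) dot (xi (c e1) (sgb R e2 * (1 / 2 + partner t1 t2 (tag k))))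
      (turning_increment (vec3 0 1 0) (vec3 0 0 1) e2 (co (v k.+1) - co (v k)) (v k - v k.+1)).
    by apply: eq_bigr => e2 _; apply: eq_bigr => k _; rewrite vS turning_increment_gamma.
  apply: (@clasp_fine_sum_decreasing _ _ _ _ _ _ _ _ _ _ _ _ v (fun k => partner t1 t2 (tag k))) => //; first exact: (hdc e1).1.
  - by rewrite /v /p mul0r mulr0 partner0.
  - by rewrite /v /p divff ?gt_eqF// mulr1 partner_end.
  - move=> k kn; have := htag k kn; rewrite -/(p k) -/(p k.+1) => /andP[tk1 tk2].
    have vk i : (i <= n)%N -> 0 <= v i <= t2 by move=> ni; apply: partner_itv => //; rewrite pk pks.
    have /andP[vk1 _] := vk _ kn; have /andP[_ vk2] := vk _ (ltnW kn).
    have tv1 := partner_lt t10 t20 tk1; have tv2 := partner_lt t10 t20 tk2.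
    split=> //; [by rewrite -subr_gt0 vS| |by rewrite !ltW].
    by rewrite vS (lt_le_trans nn1).
have rho0 : 0 < t1 / t2 by rewrite divr_gt0.
have rho1 : t1 / t2 <= 1 by rewrite ler_pdivrMr// mul1r.
have scal e1 e2 : \sum_(k < n) dot (y e1 e2 (partner t1 t2 (tag k)))
        (vec3 0 (- (sgb R e2 * (t1 / t2 * (co (v k.+1) - co (v k))))) (t1 / n%:R)) =
  t1 / t2 * \sum_(k < n) dot (y e1 e2 (partner t1 t2 (tag k)))
        (vec3 0 (- (sgb R e2 * (co (v k.+1) - co (v k)))) (t2 / n%:R)).
  rewrite mulr_sumr; apply: eq_bigr => k _; rewrite -dotZr; congr dot.
  by apply: row3P; rewrite !mxE/=; field; rewrite ?gt_eqF.
have SC' e1 : 0 <= t1 / t2 * (\sum_(e2 : bool) \sum_(k < n) dot (y e1 e2 (partner t1 t2 (tag k)))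
        (vec3 0 (- (sgb R e2 * (co (v k.+1) - co (v k)))) (t2 / n%:R)) + dd (c e1) + 1 / 20).
  rewrite mulr_ge0 ?(ltW rho0)// -lerBlDr sub0r ltW//.
  by have := SC e1; rewrite ltr_norml => /andP[].
have SB' e2 : - (1 / 20) < \sum_(e1 : bool) \sum_(k < n) dot (x e2 e1 (tag k))
        (vec3 (- (sgb R e1 * (co (p k) - co (p k.+1)))) 0 (- (t1 / n%:R))) + dd (b e2).
  by have := SB e2; rewrite ltr_norml => /andP[].
move: bal nn2 (SB' true) (SB' false) (SC' true) (SC' false) (hsum dd) rho1.
rewrite -sdd !big_bool/= !scal.
move: (t1 / t2) ((90 * eps + 60 * M) / n%:R) => r q.
rewrite /eps; clear; do 8 (let z := fresh "z" in set z := \sum_(k < n) dot _ _).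
move: z z0 z1 z2 z3 z4 z5 z6 (dd (b true)) (dd (b false)) (dd (c true)) (dd (c false)).
clear; move=> *; lra.
Qed.
End Links.

(** * Walls, ends and conclusion *)

Section Walls.
Variable R : realType.
Implicit Types (n p v : 'rV[R]_3) (k : R).

Lemma derive_affine k n p v : 'D_v (fun q => k - dot n q) p = - dot n v.
Proof.
rewrite /derive; apply/cvg_lim => //.
apply: (@cvg_trans _ ((fun=> - dot n v) @ (0:R)^')); last exact: cvg_cst.
apply: near_eq_cvg; near=> h => /=.
have h0 : h != 0 by near: h; exact: nbhs_dnbhs_neq.
by rewrite dotDr dotZr /GRing.scale/=; field.
Unshelve. all: by end_near. Qed.

Lemma gradient_affine k n : gradient (fun q => k - dot n q) = fun=> - n.
Proof.
apply/funext => p; apply/rowP => i; rewrite /gradient !mxE derive_affine; congr (- _).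
rewrite /dot mxE (bigD1 i)//= big1 ?addr0 => [|j ji]; first by rewrite !mxE !eqxx mulr1.
by rewrite !mxE (negbTE ji) andbF mulr0.
Qed.

Lemma C1_affine k n : C1 (fun q => k - dot n q).
Proof.
split; last by rewrite gradient_affine; exact: cst_continuous.
have -> : (fun q => k - dot n q) =
    (fun q => k - (n 0 0 * q 0 0 + n 0 1 * q 0 1 + n 0 2 * q 0 2)).
  by apply/funext => q; rewrite dotE.
move=> p; apply: differentiableB; first exact: differentiable_cst.
have d i : differentiable (fun q : 'rV[R]_3 => n 0 i * q 0 i) p.
  apply: differentiableM; first exact: differentiable_cst.
  exact: differentiable_coord.
exact: (differentiableD (differentiableD (d 0) (d 1)) (d 2)).
Qed.

Lemma regular_value_affine k n : dot n n = 1 -> regular_value (fun q => k - dot n q) 0.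
Proof.
move=> n1 p _; rewrite gradient_affine oppr_eq0; apply/eqP => n0.
by move: n1; rewrite n0 dot0l => /esym/eqP; rewrite oner_eq0.
Qed.

Lemma affine_subspace_plane n k : dot n n = 1 -> affine_subspace (plane n k).
Proof.
move=> n1; split; first by exists (k *: n); rewrite /plane/= dotZr n1 mulr1.
by move=> p q r; rewrite /plane/= dotDr dotZr dotBr => -> ->; ring.
Qed.

Lemma beta_normal_unit t e : 0 < t -> t <= 1 -> dot (beta_normal t e) (beta_normal t e) = 1 :> R.
Proof.
move=> t0 t1; rewrite dotE !vec3E coE.
have := @sqr_co R t; rewrite gtr0_norm// => /(_ t1) h.
by case: e; rewrite /sgb; lra.
Qed.

Lemma gamma_normal_unit t e : 0 < t -> t <= 1 -> dot (gamma_normal t e) (gamma_normal t e) = 1 :> R.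
Proof.
move=> t0 t1; rewrite dotE !vec3E coE.
have := @sqr_co R t; rewrite gtr0_norm// => /(_ t1) h.
by case: e; rewrite /sgb; lra.
Qed.

End Walls.

Section Ends.
Variable R : realType.
Variables (t1 t2 : R).
Hypotheses (t10 : 0 < t1) (t11 : t1 <= 1) (t20 : 0 < t2) (t21 : t2 <= 1).

Lemma profileX_ray w r e : 0 <= w -> 0 <= r ->
  profileX t1 t2 w (sgb R e * (w + t1 + r)) = sgb R e * (w + t1 + r * co t1).
Proof.
move=> w0 r0; have t0 := t10.
have h : profileX t1 t2 w (w + t1 + r) = w + t1 + r * co t1.
  rewrite profileXE// (@armX_neg _ _ _ (- (w + t1 + r) - w)) ?(ltW t10)//; last by lra.
  rewrite armX_ray//; last by lra.
  rewrite clampR; [ring|lra|lra].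
by case: e; rewrite /sgb ?mul1r// mulN1r profileXN// h mulN1r.
Qed.

Lemma profileZ_ray w r e : 0 <= w -> 0 <= r ->
  profileZ t1 t2 w (sgb R e * (w + t1 + r)) = claspZ t1 t2 t1 + r * t1.
Proof.
move=> w0 r0; have t0 := t10; rewrite profileZ_norm// normrM.
have -> : `|sgb R e| = 1 by case: e; rewrite /sgb ?normrN normr1.
rewrite mul1r ger0_norm; last by lra.
by rewrite armZ_ray//; [ring|lra].
Qed.

End Ends.

Section Reach.
Variable R : realType.
Variables (t1 t2 : R).
Hypotheses (t10 : 0 < t1) (t11 : t1 <= 1) (t20 : 0 < t2) (t21 : t2 <= 1).

(** On the rays, which have unit speed and are normal to their bounding planes,
    the level of the plane grows at unit rate; and by symmetry it does not
    depend on the side [e] nor on the coordinate [y]. *)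
Lemma beta_reach w y r e : 0 <= w -> 0 <= r ->
  dot (beta_normal t1 e) (beta t1 t2 w y (sgb R e * (w + t1 + r))) =
  dot (beta_normal t1 true) (beta t1 t2 w 0 (w + t1)) + r.
Proof.
move=> w0 r0; have h : w + t1 = sgb R true * (w + t1 + 0) by rewrite /sgb mul1r addr0.
rewrite [in RHS]h /beta !profileX_ray// !profileZ_ray// !dotE !vec3E !coE.
have := @sqr_co R t1; rewrite gtr0_norm// => /(_ t11) hc.
move: (clasp_height t1 t2) (claspZ t1 t2 t1) (co t1) hc => H Z k hc.
have -> : sgb R e * k * (sgb R e * (w + t1 + r * k)) = k * (w + t1) + r * k ^+ 2.
  by case: e; rewrite /sgb; ring.
by rewrite hc /sgb; ring.
Qed.

Lemma gamma_reach w x r e : 0 <= w -> 0 <= r ->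
  dot (gamma_normal t2 e) (gamma t1 t2 w x (sgb R e * (w + t2 + r))) =
  dot (gamma_normal t2 true) (gamma t1 t2 w 0 (w + t2)) + r.
Proof.
move=> w0 r0; have h : w + t2 = sgb R true * (w + t2 + 0) by rewrite /sgb mul1r addr0.
rewrite [in RHS]h /gamma !profileX_ray// !profileZ_ray// !dotE !vec3E !coE.
have := @sqr_co R t2; rewrite gtr0_norm// => /(_ t21) hc.
move: (claspZ t2 t1 t2) (co t2) hc => Z k hc.
have -> : sgb R e * k * (sgb R e * (w + t2 + r * k)) = k * (w + t2) + r * k ^+ 2.
  by case: e; rewrite /sgb; ring.
by rewrite hc /sgb; ring.
Qed.

End Reach.

Section Conclusion.
Variable R : realType.

Lemma clasp_links_strongly_critical (L : glink R) (b c : bool -> comp L)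
    (t1 t2 w c1 c2 hb hc : R) :
  0 < t1 -> t1 <= 1 -> 0 < t2 -> t2 <= 1 -> t1 <= t2 -> t2 <= 2 * t1 -> 0 <= w ->
  w + t1 <= hb -> 1 / 2 + t2 <= hc ->
  (forall e, [/\ curve (b e) =1 beta t1 t2 w (sgb R e * (1 / 2)),
     lo (b e) = - hb, hi (b e) = hb & is_arc (b e)]) ->
  (forall e, [/\ curve (c e) =1 gamma t1 t2 (1 / 2) (sgb R e * w),
     lo (c e) = - hc, hi (c e) = hc & is_arc (c e)]) ->
  (forall e e', anchor (b e) e' = plane (beta_normal t1 e') c1 /\
      anchor (b e) e' (curve (b e) (param_end (b e) e'))) ->
  (forall e e', anchor (c e) e' = plane (gamma_normal t2 e') c2 /\
      anchor (c e) e' (curve (c e) (param_end (c e) e'))) ->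
  (forall e e', b e != c e') -> b true != b false ->
  c true = c false \/ (c true != c false /\ w = 1 / 2) ->
  (forall dd : comp L -> R,
     \sum_i dd i = \sum_(e : bool) dd (b e) + t1 / t2 * \sum_(e : bool) dd (c e)) ->
  (forall i, (exists e, i = b e) \/ (exists e, i = c e)) ->
  (forall j, exists n k, dot n n = 1 /\ @gobs R L j = fun p => k - dot n p) ->
  in_region L -> strongly_critical L.
Proof.
move=> t10 t11 t20 t21 t12 t212 w0 whb whc hB hC aB aC bc bb cc hsum cover walls reg.
have [k11 k22 k12 [m11 m22 m12]] := vec3_orthonormal R.
have w20 : 0 <= 1 / 2 :> R by rewrite divr_ge0.
have signed_half : sgb R true * (1 / 2) = 1 / 2 /\ sgb R false * (1 / 2) = -1 / 2.
  by rewrite /sgb mul1r; split=> //; lra.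
have bbd x y : 1 <= edist (curve (b true) x) (curve (b false) y).
  have [cu _ _ _] := hB true; have [cu' _ _ _] := hB false; rewrite cu cu'.
  by rewrite signed_half.1 signed_half.2; exact: beta_beta_edist_ge1.
have bcd e e' x y : 1 <= edist (curve (b e) x) (curve (c e') y).
  have [cu _ _ _] := hB e; have [cu' _ _ _] := hC e'; rewrite cu cu'.
  exact: beta_gamma_edist_ge1.
have ccd x y : c true != c false -> 1 <= edist (curve (c true) x) (curve (c false) y).
  have [cu _ _ _] := hC true; have [cu' _ _ _] := hC false; rewrite cu cu'.
  case: cc => [->|[_ ->] _]; first by rewrite eqxx.
  by rewrite signed_half.1 signed_half.2; exact: gamma_gamma_edist_ge1.
have far (i i' : comp L) (x y : R) : i != i' -> 1 <= edist (curve i x) (curve i' y).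
  have [[e ->]|[e ->]] := cover i; have [[e' ->]|[e' ->]] := cover i'.
  - case: e; case: e' => ii; [by rewrite eqxx in ii|exact: bbd| |by rewrite eqxx in ii].
    by rewrite edistC; exact: bbd.
  - by move=> _; exact: bcd.
  - by move=> _; rewrite edistC; exact: bcd.
  - case: e; case: e' => ii; [by rewrite eqxx in ii|exact: ccd| |by rewrite eqxx in ii].
    by rewrite edistC; apply: ccd; rewrite eq_sym.
have hb0 : 0 <= hb by lra.
have thi : GThi L = 1%:E.
  apply/eqP; rewrite eq_le; apply/andP; split.
    apply: ereal_inf_lbound; exists (b true), (b false), 0, 0.
    have [cu lo_ hi_ _] := hB true; have [cu' lo'_ hi'_ _] := hB false; split=> //.
    - by rewrite /dom/= in_itv/= lo_ hi_; lra.
    - by rewrite /dom/= in_itv/= lo'_ hi'_; lra.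
    rewrite cu cu'; congr EFin; rewrite /edist.
    have -> : beta t1 t2 w (sgb R true * (1 / 2)) 0 - beta t1 t2 w (sgb R false * (1 / 2)) 0 = vec3 0 1 0.
      by apply: row3P; rewrite !mxE/=; field.
    by rewrite enorm_vec3 expr0n expr1n/= add0r addr0 sqrtr1.
  apply: le_ereal_inf_tmp => _ [i [i' [x [y [ii _ _ ->]]]]].
  by rewrite lee_fin far.
split; last exact: (@clasp_links_critical R L b c t1 t2 w c1 c2 hb hc).
have smooth (i : comp L) base (e1 e2 : 'rV[R]_3) s t w' : 0 < s -> s <= 1 -> 0 < t -> t <= 1 -> 0 <= w' ->
    dot e1 e1 = 1 -> dot e2 e2 = 1 -> dot e1 e2 = 0 ->
    curve i =1 planar base e1 e2 s t w' -> lo i < hi i ->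
    [/\ lo i < hi i, {within dom i, continuous (curve i)} & has_BV_unit_tangent i].
  move=> s0 s1 t0 t1' w'0 d11 d22 d12 cu lh; split=> //.
    rewrite (funext cu); apply: continuous_subspaceT; exact: continuous_planar.
  exact: (planar_has_BV_unit_tangent (base := base) (e1 := e1) (e2 := e2) (s := s) (t := t) (w := w')).
split.
- move=> i; have [[e ->]|[e ->]] := cover i.
    have [cu lo_ hi_ _] := hB e.
    apply: (smooth _ (vec3 0 (sgb R e * (1 / 2)) (clasp_height t1 t2)) _ _ t1 t2 w _ _ _ _ _ k11 k22 k12) => //.
      by move=> x; rewrite cu betaE.
    by rewrite lo_ hi_; lra.
  have [cu lo_ hi_ _] := hC e.
  apply: (smooth _ (vec3 (sgb R e * w) 0 0) _ _ t2 t1 (1 / 2) _ _ _ _ _ m11 m22 m12) => //.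
    by move=> x; rewrite cu gammaE.
  by rewrite lo_ hi_; lra.
- move=> i i' x y ii _ _ e; have := far i i' x y ii.
  by rewrite e /edist subrr /enorm dot0l sqrtr0 ler10.
- move=> i; have [[e ->]|[e ->]] := cover i.
    have [_ _ _ ->] := hB e; move=> e'; have [an hn] := aB e e'; split=> //.
    by rewrite an; apply: affine_subspace_plane; exact: beta_normal_unit.
  have [_ _ _ ->] := hC e; move=> e'; have [an hn] := aC e e'; split=> //.
  by rewrite an; apply: affine_subspace_plane; exact: gamma_normal_unit.
- move=> j; have [n [k [n1 ->]]] := walls j.
  by split; [exact: C1_affine|exact: regular_value_affine].
- exact: reg.
Qed.

Lemma clasp_wall_affine (t1 t2 c1 c2 : R) (j : bool + bool) :
  0 < t1 -> t1 <= 1 -> 0 < t2 -> t2 <= 1 ->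
  exists n k, dot n n = 1 /\ clasp_wall t1 t2 c1 c2 j = fun p => k - dot n p.
Proof.
move=> t10 t11 t20 t21; case: j => e.
  by exists (beta_normal t1 e), c1; split; [exact: beta_normal_unit|].
by exists (gamma_normal t2 e), c2; split; [exact: gamma_normal_unit|].
Qed.

Lemma L1_strongly_critical (tau c1 c2 : R) : 0 < tau -> tau <= 1 ->
  in_region (L1 tau c1 c2) -> strongly_critical (L1 tau c1 c2).
Proof.
move=> tau0 tau1 reg.
have s0 : 0 < tau / 2 by lra.
have s1 : tau / 2 <= 1 by lra.
have true_end (x : R) : sgb R true * (x + 0) = x by rewrite /sgb mul1r addr0.
have half e : sgb R e / 2 = sgb R e * (1 / 2) by rewrite div1r.
have w2 : 0 <= 1 / 2 :> R by rewrite divr_ge0.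
pose bn := dot (beta_normal (tau / 2) true) (beta (tau / 2) tau 0 0 (0 + tau / 2)).
pose gn := dot (gamma_normal tau true) (gamma (tau / 2) tau (1 / 2) 0 (1 / 2 + tau)).
have m1 x : 0 <= Num.max 0 x :> R by rewrite le_max lexx.
(* If the maximum in [beta_hi] were attained only by 0, the curve would end at
   the outer end of the clasp part, beyond the plane and outside the region. *)
have rb : 0 <= c1 - bn.
  have := reg (inl true) (0 + tau / 2) (inl true); rewrite /dom/= in_itv/= => /(_ _).
  have -> : dot (beta_normal (tau / 2) true) (beta (tau / 2) tau 0 (sgb R true / 2) (0 + tau / 2)) = bn.
    have := @beta_reach _ (tau / 2) tau s0 s1 tau0 tau1 0 (sgb R true / 2) 0 true (lexx 0) (lexx 0).
    by rewrite true_end addr0.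
  by apply; rewrite /beta_hi; have := m1 (c1 - bn); rewrite /bn; lra.
have rg : 0 <= c2 - gn.
  have := reg (inr tt) (1 / 2 + tau) (inr true); rewrite /dom/= in_itv/= => /(_ _).
  by apply; rewrite /gamma_hi; have := m1 (c2 - gn); rewrite /gn; lra.
have eb : beta_hi (tau / 2) tau 0 c1 = 0 + tau / 2 + (c1 - bn).
  by rewrite /beta_hi -/bn max_r.
have eg : gamma_hi (tau / 2) tau (1 / 2) c2 = 1 / 2 + tau + (c2 - gn).
  by rewrite /gamma_hi -/gn max_r.
apply: (@clasp_links_strongly_critical (L1 tau c1 c2) (fun e => inl e) (fun=> inr tt)
  (tau / 2) tau 0 c1 c2 (beta_hi (tau / 2) tau 0 c1) (gamma_hi (tau / 2) tau (1 / 2) c2)) => //.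
- by lra.
- by lra.
- by rewrite eb lerDl.
- by rewrite eg lerDl.
- by move=> e; split=> //= x; rewrite half.
- by move=> e; split=> //= x; rewrite mulr0.
- move=> e e'; split=> //=; rewrite /plane/=.
  have -> : param_end (inl e : comp (L1 tau c1 c2)) e' = sgb R e' * (0 + tau / 2 + (c1 - bn)).
    by rewrite /param_end/= -eb; case: e'; rewrite /sgb ?mul1r ?mulN1r.
  by rewrite beta_reach// -/bn subrKC.
- move=> e e'; split=> //=; rewrite /plane/=.
  have -> : param_end (inr tt : comp (L1 tau c1 c2)) e' = sgb R e' * (1 / 2 + tau + (c2 - gn)).
    by rewrite /param_end/= -eg; case: e'; rewrite /sgb ?mul1r ?mulN1r.
  by rewrite gamma_reach// -/gn subrKC.
- by left.
- move=> dd; rewrite /= big_sumType/=; congr (_ + _).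
  rewrite (bigD1 tt)//= big1 ?addr0; last by case.
  by rewrite big_bool/=; field; rewrite gt_eqF.
- by case=> [e|[]]; [left; exists e|right; exists true].
- by move=> j; exact: clasp_wall_affine.
Qed.

Lemma L2_strongly_critical (tau c1 c2 : R) : 0 < tau -> tau <= 1 ->
  in_region (L2 tau c1 c2) -> strongly_critical (L2 tau c1 c2).
Proof.
move=> tau0 tau1 reg.
have true_end (x : R) : sgb R true * (x + 0) = x by rewrite /sgb mul1r addr0.
have half e : sgb R e / 2 = sgb R e * (1 / 2) by rewrite div1r.
have w2 : 0 <= 1 / 2 :> R by rewrite divr_ge0.
pose bn := dot (beta_normal tau true) (beta tau tau (1 / 2) 0 (1 / 2 + tau)).
pose gn := dot (gamma_normal tau true) (gamma tau tau (1 / 2) 0 (1 / 2 + tau)).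
have m1 x : 0 <= Num.max 0 x :> R by rewrite le_max lexx.
(* If the maximum in [beta_hi] were attained only by 0, the curve would end at
   the outer end of the clasp part, beyond the plane and outside the region. *)
have rb : 0 <= c1 - bn.
  have := reg (inl true) (1 / 2 + tau) (inl true); rewrite /dom/= in_itv/= => /(_ _).
  have -> : dot (beta_normal tau true) (beta tau tau (1 / 2) (sgb R true / 2) (1 / 2 + tau)) = bn.
    have := @beta_reach _ tau tau tau0 tau1 tau0 tau1 (1 / 2) (sgb R true / 2) 0 true w2 (lexx 0).
    by rewrite true_end addr0.
  by apply; rewrite /beta_hi; have := m1 (c1 - bn); rewrite /bn; lra.
have rg : 0 <= c2 - gn.
  have := reg (inr true) (1 / 2 + tau) (inr true); rewrite /dom/= in_itv/= => /(_ _).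
  have -> : dot (gamma_normal tau true) (gamma tau tau (1 / 2) (sgb R true / 2) (1 / 2 + tau)) = gn.
    have := @gamma_reach _ tau tau tau0 tau1 tau0 tau1 (1 / 2) (sgb R true / 2) 0 true w2 (lexx 0).
    by rewrite true_end addr0.
  by apply; rewrite /gamma_hi; have := m1 (c2 - gn); rewrite /gn; lra.
have eb : beta_hi tau tau (1 / 2) c1 = 1 / 2 + tau + (c1 - bn).
  by rewrite /beta_hi -/bn max_r.
have eg : gamma_hi tau tau (1 / 2) c2 = 1 / 2 + tau + (c2 - gn).
  by rewrite /gamma_hi -/gn max_r.
apply: (@clasp_links_strongly_critical (L2 tau c1 c2) (fun e => inl e) (fun e => inr e)
  tau tau (1 / 2) c1 c2 (beta_hi tau tau (1 / 2) c1) (gamma_hi tau tau (1 / 2) c2)) => //.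
- by lra.
- by rewrite eb lerDl.
- by rewrite eg lerDl.
- by move=> e; split=> //= x; rewrite half.
- by move=> e; split=> //= x; rewrite half.
- move=> e e'; split=> //=; rewrite /plane/=.
  have -> : param_end (inl e : comp (L2 tau c1 c2)) e' = sgb R e' * (1 / 2 + tau + (c1 - bn)).
    by rewrite /param_end/= -eb; case: e'; rewrite /sgb ?mul1r ?mulN1r.
  by rewrite beta_reach// -/bn subrKC.
- move=> e e'; split=> //=; rewrite /plane/=.
  have -> : param_end (inr e : comp (L2 tau c1 c2)) e' = sgb R e' * (1 / 2 + tau + (c2 - gn)).
    by rewrite /param_end/= -eg; case: e'; rewrite /sgb ?mul1r ?mulN1r.
  by rewrite gamma_reach// -/gn subrKC.
- by right.
- by move=> dd; rewrite /= big_sumType/= divff ?gt_eqF// mul1r.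
- by case=> e; [left; exists e|right; exists e].
- by move=> j; exact: clasp_wall_affine.
Qed.

End Conclusion.

Theorem theorem5p1 (R : realType) (tau : R) (tau_gt0 : 0 < tau)
    (tau_le1 : tau <= 1) (c1 c2 : R) :
  (in_region (L1 tau c1 c2) -> strongly_critical (L1 tau c1 c2)) /\
  (in_region (L2 tau c1 c2) -> strongly_critical (L2 tau c1 c2)).
Proof.
by split; [exact: L1_strongly_critical|exact: L2_strongly_critical].
Qed.
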